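(* Let $n\ge 2$ be an integer and let $k\in\{1,\ldots,n-1\}$ be fixed. Let $$\mathcal{S}=\Theta H^2(\mathbb{D}^k)\otimes\mathcal{Q}_{\theta_1}\otimes\cdots\otimes\mathcal{Q}_{\theta_{n-k}}$$ be a subspace of $H^2(\mathbb{D}^n)$ jointly invariant under $(M_{z_1},\ldots,M_{z_k},M_{z_{k+1}}^*,\ldots,M_{z_n}^* )$, where $\Theta\in H^\infty(\mathbb{D}^k)$ is an inner function and each $\mathcal{Q}_{\theta_j}$ is either a Jordan block of $H^2(\mathbb{D})$ or the Hardy space $H^2(\mathbb{D})$. Let $V_j=P_{\mathcal{S}}M_{z_j}|_{\mathcal{S}}$ for $1\le j\le n$. Then $(V_1,\ldots,V_n)$ is a doubly commuting tuple, where $V_j$ is a pure isometry for $1\le j\le k$ and $V_j$ is a pure contraction for $k+1\le j\le n$.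
   Context: $H^2(\mathbb{D}^n)$ is the Hardy space of holomorphic functions on the open unit polydisc $\mathbb{D}^n\subset\mathbb{C}^n$, and $M_{z_j}$ is multiplication by the $j$-th coordinate function. $P_{\mathcal{S}}$ is the orthogonal projection onto $\mathcal{S}$. A tuple $(V_1,\ldots,V_n)$ of bounded operators is doubly commuting if $V_iV_j=V_jV_i$ and $V_iV_j^*=V_j^*V_i$ for all $i\ne j$. A contraction (resp. isometry) $T$ is pure if $T^{*m}\to 0$ in the strong operator topology as $m\to\infty$. $H^\infty(\mathbb{D}^k)$ is the algebra of bounded holomorphic functions on $\mathbb{D}^k$; $\Theta\in H^\infty(\mathbb{D}^k)$ is inner if its radial boundary values have modulus $1$ a.e. on the torus $\mathbb{T}^k$. A Jordan block of $H^2(\mathbb{D})$ is a proper closed subspace of $H^2(\mathbb{D})$ that is invariant under $M_z^*$; equivalently (by Beurling's theorem) it is of the form $\mathcal{Q}_\theta=H^2(\mathbb{D})\ominus\theta H^2(\mathbb{D})$ for an inner function $\theta\in H^\infty(\mathbb{D})$. $H^2(\mathbb{D}^n)$ is identified with the Hilbert space tensor product $H^2(\mathbb{D}^k)\otimes H^2(\mathbb{D})\otimes\cdots\otimes H^2(\mathbb{D})$ ($n-k$ copies of $H^2(\mathbb{D})$) via the unitary sending $z_1^{m_1}\cdots z_n^{m_n}$ to $(z_1^{m_1}\cdots z_k^{m_k})\otimes z^{m_{k+1}}\otimes\cdots\otimes z^{m_n}$; tensor products of closed subspaces are closed Hilbert space tensor products. *)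

(* Defs.v *)
From HB Require Import structures.
From mathcomp Require Import all_boot all_order all_algebra.
From mathcomp Require Import complex finmap.
From mathcomp Require Import all_classical all_reals all_analysis.
From mathcomp Require Import summability.

Set Implicit Arguments.
Unset Strict Implicit.
Unset Printing Implicit Defensive.

Import Order.TTheory GRing.Theory Num.Theory.
Import numFieldNormedType.Exports.
Import ComplexField.Normc.

Local Open Scope classical_set_scope.
Local Open Scope ring_scope.
Local Open Scope complex_scope.

(* Operators on a closed subspace [A] of an ambient complex inner product     *)
(* space [V]. An operator on [A] is given by a map [V -> V], of which only    *)
(* the restriction to [A] matters.                                            *)
Section Operators.
Variables (R : realType) (V : lmodType R[i]) (ip : V -> V -> R[i]).
Implicit Types (A B H : set V) (T : V -> V) (f g h : V).

Definition hnorm f : R := Num.sqrt (complex.Re (ip f f)).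

(* closure of [A] in the ambient Hilbert space [H] *)
Definition hclosure H A : set V :=
  [set f | H f /\ forall e : R, 0 < e -> exists2 g, A g & hnorm (f - g) < e].

Definition lin_span A : set V :=
  [set f | exists (m : nat) (c : 'I_m -> R[i]) (u : 'I_m -> V),
     (forall i, A (u i)) /\ f = \sum_(i < m) c i *: u i].

Definition closed_subspace H A : Prop :=
  [/\ A `<=` H, A 0, forall (c : R[i]) f g, A f -> A g -> A (c *: f + g)
    & hclosure H A `<=` A].

Definition invariant_under A T : Prop := forall f, A f -> A (T f).

(* The orthogonal projection onto [A]; its value at [f] is the unique [g] in  *)
(* [A] with [f - g] orthogonal to [A] (the default 0 is never used when [A]   *)
(* is complete).                                                              *)
Definition orthoproj A f : V :=
  xget 0 [set g | A g /\ forall h, A h -> ip (f - g) h = 0].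

(* The compression P_A T |_A *)
Definition compression A T f : V := orthoproj A (T f).

(* The Hilbert space adjoint of [T], as an operator on [A]; its value at [g]  *)
(* is the unique vector given by the Riesz representation theorem (the        *)
(* default 0 is never used when [A] is complete and [T] bounded on [A]).      *)
Definition adjoint A T g : V :=
  xget 0 [set h | A h /\ forall f, A f -> ip (T f) g = ip f h].

Definition bounded_operator A T : Prop :=
  [/\ invariant_under A T,
      forall (c : R[i]) f g, A f -> A g -> T (c *: f + g) = c *: T f + T g
    & exists M : R, forall f, A f -> hnorm (T f) <= M * hnorm f].

Definition is_contraction A T : Prop :=
  bounded_operator A T /\ forall f, A f -> hnorm (T f) <= hnorm f.

Definition is_isometry A T : Prop :=
  bounded_operator A T /\ forall f, A f -> hnorm (T f) = hnorm f.

Definition is_pure A T : Prop :=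
  forall f, A f -> hnorm (iter m (adjoint A T) f) @[m --> \oo] --> (0 : R).

Definition pure_contraction A T : Prop := is_contraction A T /\ is_pure A T.

Definition pure_isometry A T : Prop := is_isometry A T /\ is_pure A T.

Definition doubly_commuting n A (T : 'I_n -> V -> V) : Prop :=
  (forall j, bounded_operator A (T j)) /\
  (forall i j, i != j -> forall f, A f ->
     T i (T j f) = T j (T i f) /\
     T i (adjoint A (T j) f) = adjoint A (T j) (T i f)).

End Operators.

Definition polydisc (R : realType) (n : nat) : Type :=
  {z : 'rV[R[i]]_n | [forall j, `|z 0 j| < 1]}.

Notation dfun R n := (polydisc R n -> R[i]^o).

Notation multi_index n := {ffun 'I_n -> nat}.

Section Polydisc.
Variable R : realType.

Lemma polydisc0_subproof n : [forall j, `|(0 : 'rV[R[i]]_n) 0 j| < 1].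
Proof. by apply/forallP => j; rewrite mxE normr0 ltr01. Qed.

Definition polydisc0 n : polydisc R n := exist _ 0 (polydisc0_subproof n).

(* The point [z] of C^n as a point of the polydisc; only meaningful when [z]  *)
(* lies in the polydisc.                                                      *)
Definition to_polydisc n (z : 'rV[R[i]]_n) : polydisc R n :=
  insubd (polydisc0 n) z.

Definition monom n (a : multi_index n) (z : 'rV[R[i]]_n) : R[i] :=
  \prod_(j < n) z 0 j ^+ a j.

(* [s] is the sum of the multiple power series sum_a c_a z^a; convergence is  *)
(* unconditional (along finite sets of multi-indices), that is, absolute.     *)
Definition psum_at n (c : multi_index n -> R[i]^o) (z : 'rV[R[i]]_n)
    (s : R[i]^o) : Prop :=
  partial_sum (fun a => c a * monom a z : R[i]^o) @ totally --> s.

(* Holomorphic in the sense of Weierstrass: near each point of the polydisc,  *)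
(* the function is the sum of a convergent multiple power series.             *)
Definition holomorphic n (f : dfun R n) : Prop :=
  forall w : polydisc R n, exists (r : R) (c : multi_index n -> R[i]^o),
    0 < r /\ forall z : polydisc R n,
      (forall j, normc (val z 0 j - val w 0 j) < r) ->
      psum_at c (val z - val w) (f z).

Definition bounded_fun n (f : dfun R n) : Prop :=
  exists M : R, forall z, normc (f z) <= M.

Definition Hinfty n : set (dfun R n) :=
  [set f | holomorphic f /\ bounded_fun f].

Definition square_summable n (c : multi_index n -> R[i]^o) : Prop :=
  (\esum_(a in [set: multi_index n]) (normc (c a) ^+ 2)%:E < +oo)%E.

Definition taylor_series n (f : dfun R n) (c : multi_index n -> R[i]^o) : Prop :=
  forall z : polydisc R n, psum_at c (val z) (f z).

Definition taylor_coef n (f : dfun R n) : multi_index n -> R[i]^o :=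
  xget (fun=> 0) [set c | taylor_series f c].

(* The Hardy space: the holomorphic functions f = sum_a c_a z^a on the        *)
(* polydisc with sum_a |c_a|^2 finite                                         *)
Definition H2 n : set (dfun R n) :=
  [set f | exists2 c, taylor_series f c & square_summable c].

Definition H2ip n (f g : dfun R n) : R[i] :=
  summability.sum (fun a => taylor_coef f a * (taylor_coef g a)^* : R[i]^o).

Arguments H2 : clear implicits.
Arguments H2ip : clear implicits.

Definition Mz n (j : 'I_n) (f : dfun R n) : dfun R n := fun z => val z 0 j * f z.

(* The k-torus, parametrized by the angles (t_1, ..., t_k) in [0, 2 pi]^k,    *)
(* with the k-fold product of the normalized Lebesgue measure on [0, 2 pi]    *)
Lemma two_pi_gt0 : (0 : R) < 2 * pi.
Proof. by rewrite mulr_gt0 ?pi_gt0. Qed.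

Record probability_space := ProbabilitySpace {
  ps_display : measure_display ;
  ps_type : measurableType ps_display ;
  ps_prob : probability ps_type R }.

Fixpoint angles (k : nat) : probability_space :=
  if k is k'.+1 then
    @ProbabilitySpace _ (measurableTypeR R * ps_type (angles k'))%type
      ((uniform_prob two_pi_gt0 : probability (measurableTypeR R) R)
         \x ps_prob (angles k'))%E
  else @ProbabilitySpace _ unit (dirac tt).

Fixpoint angle (k : nat) : ps_type (angles k) -> nat -> R :=
  if k is k'.+1 then
    fun t j => if j is j'.+1 then angle t.2 j' else t.1
  else fun _ _ => 0.

(* The point (e^{i t_1}, ..., e^{i t_k}) of the torus *)
Definition torus_pt k (t : ps_type (angles k)) : 'rV[R[i]]_k :=
  \row_(j < k) (cos (angle t j) +i* sin (angle t j)).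

Definition ae_torus k (P : 'rV[R[i]]_k -> Prop) : Prop :=
  {ae ps_prob (angles k), forall t, P (torus_pt t)}.

Definition radial_limit k (f : dfun R k) (x : 'rV[R[i]]_k) (w : R[i]^o) : Prop :=
  f (to_polydisc (r%:C *: x)) @[r --> (1 : R)^'-] --> w.

Definition inner_function k (f : dfun R k) : Prop :=
  Hinfty f /\
  ae_torus (fun x => exists2 w, radial_limit f x w & normc w = 1).

Definition mul_range k (Theta : dfun R k) : set (dfun R k) :=
  (fun f : dfun R k => (fun z => Theta z * f z) : dfun R k) @` H2 k.

Definition jordan_block (Q : set (dfun R 1)) : Prop :=
  [/\ closed_subspace (H2ip 1) (H2 1) Q, Q <> H2 1
    & invariant_under Q (adjoint (H2ip 1) (H2 1) (Mz ord0))].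

(* Splitting of the coordinates z_1, ..., z_n into the first k and the last   *)
(* n - k.                                                                     *)
Definition head_ord n k (hk : (k <= n)%N) (j : 'I_k) : 'I_n :=
  cast_ord (subnKC hk) (lshift (n - k) j).
Definition tail_ord n k (hk : (k <= n)%N) (j : 'I_(n - k)) : 'I_n :=
  cast_ord (subnKC hk) (rshift k j).

Definition head_pt n k (hk : (k <= n)%N) (z : polydisc R n) : polydisc R k :=
  to_polydisc (\row_j val z 0 (head_ord hk j)).
Definition tail_pt n k (hk : (k <= n)%N) (j : 'I_(n - k)) (z : polydisc R n) :
    polydisc R 1 :=
  to_polydisc (\row__ val z 0 (tail_ord hk j)).

(* The image in H^2(D^n) of the elementary tensor f (x) g_1 (x) ... (x)       *)
(* g_{n-k} under the identification of the Hilbert tensor product             *)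
(* H^2(D^k) (x) H^2(D) (x) ... (x) H^2(D) with H^2(D^n)                       *)
Definition elem_tensor n k (hk : (k <= n)%N) (f : dfun R k)
    (g : 'I_(n - k) -> dfun R 1) : dfun R n :=
  fun z => f (head_pt hk z) * \prod_(j < n - k) g j (tail_pt hk j z).

(* The Hilbert space tensor product F (x) G_1 (x) ... (x) G_{n-k} *)
Definition tensor_subspace n k (hk : (k <= n)%N) (F : set (dfun R k))
    (G : 'I_(n - k) -> set (dfun R 1)) : set (dfun R n) :=
  hclosure (H2ip n) (H2 n) (lin_span
    [set h | exists (f : dfun R k) (g : 'I_(n - k) -> dfun R 1),
       [/\ F f, forall j, G j (g j) & h = elem_tensor hk f g]]).

End Polydisc.

Arguments H2 : clear implicits.
Arguments H2ip : clear implicits.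

(* Main.v *)
(* Taylor coefficients identify H^2(D^n) with l^2(N^n): a bounded, locally
   analytic function is the sum of a single power series on the polydisc, since
   Cauchy's estimates (Parseval on the torus) give a uniform radius of
   convergence on smaller polydiscs and the series can be recentered and
   extended step by step. Under this identification M_{z_j} shifts the j-th
   index and its adjoint is the backward shift B_j, which tends strongly to 0.
   Multiplication by an inner function is isometric: by dominated convergence
   along the radii for polynomials, then by density.

   On an elementary tensor Theta f (x) g_1 (x) ... (x) g_{n-k} of S, the
   compression V_j and its adjoint, the compression of B_j, each act on a single
   tensor factor: on f by M_{z_j} and B_j, on g_i by the compression of M_z to
   Q_i and by B. Operators acting on different factors commute, and so do
   M_{z_i} and B_j for i <> j in the first factor; by density the tuple is
   doubly commuting. For j <= k, S is invariant under M_{z_j}, so V_j is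
   isometric and V_j^{*m} f = P_S B_j^m f. For j > k, S is invariant under B_j,
   so V_j^{*m} f = B_j^m f. *)
From mathcomp Require Import all_boot all_order all_algebra.
From mathcomp Require Import complex finmap.
From mathcomp Require Import all_classical all_reals all_analysis.
From mathcomp Require Import measurable_realfun summability ring lra.
Require Import Defs.

Set Implicit Arguments.
Unset Strict Implicit.
Unset Printing Implicit Defensive.

Import Order.TTheory GRing.Theory Num.Theory.
Import numFieldNormedType.Exports.
Import ComplexField.Normc.

Local Open Scope classical_set_scope.
Local Open Scope ring_scope.
Local Open Scope complex_scope.

(** The definitions give elements of [Hinfty] only local expansions, with no control of their
    radius, whereas [H2] asks for one series on the whole polydisc. This gap has to be closed before
    [Theta] can multiply [H2], and the only estimates used are mean values over tori. The radius
    grows because one can estimate twice: the [p]-th coefficient of the expansion at [w] is bounded,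
    and it is itself a power series in [w], so the coefficients of that series are bounded too;
    summed over [p] with weights [2^-|p|], these bounds rebuild a binomial expansion of larger
    radius. Radial limits of [Theta] exist only almost everywhere, and bounded convergence asks for
    a bound uniform in the radius. Polynomials have one, general elements of [H2] do not, which is
    why the isometry starts with polynomials. [orthoproj], [adjoint] and [taylor_coef] are choices
    with a default. Each is computed by exhibiting a candidate that a uniqueness lemma identifies;
    on [S] the candidates are elementary tensors, and testing them against elementary tensors
    suffices. *)

Local Notation Re := (@complex.Re _).
Local Notation Im := (@complex.Im _).
Local Notation "x ^*" := (Num.conj x) : complex_scope.

(** * Unconditional sums of complex numbers *)

Section ComplexNorm.
Variable R : realType.
Implicit Types (x y z : R[i]) (a : R).

Lemma normrE x : `|x| = (normc x)%:C.
Proof. by case: x. Qed.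

Lemma normc_ge0 x : 0 <= normc x.
Proof. by case: x => a b; apply: sqrtr_ge0. Qed.

Lemma normcT x y : normc (x + y) <= normc x + normc y.
Proof. by rewrite -lecR rmorphD/= -!normrE ler_normD. Qed.

Lemma normc_opp x : normc (- x) = normc x.
Proof. by apply: complexI; rewrite -!normrE normrN. Qed.

Lemma normc_distC x y : normc (x - y) = normc (y - x).
Proof. by rewrite -normc_opp opprB. Qed.

Lemma normc_distT z x y : normc (x - y) <= normc (x - z) + normc (z - y).
Proof. by apply: le_trans (normcT _ _); rewrite addrA subrK. Qed.

Lemma normc_dist x y : `|normc x - normc y| <= normc (x - y).
Proof.
rewrite ler_distl lerBlDr; apply/andP; split.
  by have := normcT x (y - x); rewrite addrC subrK normc_distC.
by have := normcT y (x - y); rewrite addrC subrK.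
Qed.

Lemma normcC a : normc a%:C = `|a|.
Proof. by rewrite /normc /= expr0n /= addr0 sqrtr_sqr. Qed.

Lemma normc_conj x : normc x^* = normc x.
Proof. by case: x => a b; rewrite /normc /= sqrrN. Qed.

Lemma conjM x y : (x * y)^* = x^* * y^*.
Proof. exact: rmorphM. Qed.

Lemma conjD x y : (x + y)^* = x^* + y^*.
Proof. exact: rmorphD. Qed.

Lemma conjN x : (- x)^* = - x^*.
Proof. exact: rmorphN. Qed.

Lemma conjB x y : (x - y)^* = x^* - y^*.
Proof. exact: rmorphB. Qed.

Lemma conj_sum (I : Type) (s : seq I) (F : I -> R[i]) :
  (\sum_(i <- s) F i)^* = \sum_(i <- s) (F i)^*.
Proof. exact: rmorph_sum. Qed.

Lemma conj_real a : (a%:C)^* = a%:C.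
Proof. exact: conjc_real. Qed.

Lemma Re_conj x : Re x^* = Re x.
Proof. by case: x. Qed.

Lemma Im_conj x : Im x^* = - Im x.
Proof. by case: x. Qed.

Lemma normcX x n : normc (x ^+ n) = normc x ^+ n.
Proof.
elim: n => [|n IHn]; first by rewrite !expr0 normc1.
by rewrite !exprS normcM IHn.
Qed.

Lemma normc_sum (I : Type) (s : seq I) (P : pred I) (F : I -> R[i]) :
  normc (\sum_(i <- s | P i) F i) <= \sum_(i <- s | P i) normc (F i).
Proof.
elim/big_ind2: _ => //; first by rewrite normc0.
by move=> x1 x2 y1 y2 h1 h2; apply: le_trans (normcT _ _) (lerD h1 h2).
Qed.

Lemma normc_prod (I : Type) (s : seq I) (P : pred I) (F : I -> R[i]) :
  normc (\prod_(i <- s | P i) F i) = \prod_(i <- s | P i) normc (F i).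
Proof. by apply: big_morph; [exact: normcM | exact: normc1]. Qed.

Lemma normc_Re x : `|Re x| <= normc x.
Proof. by rewrite -lecR -normrE normc_ge_Re. Qed.

Lemma normc_Im x : `|Im x| <= normc x.
Proof.
case: x => a b; rewrite /normc /= -(sqrtr_sqr b).
by rewrite ler_wsqrtr // lerDr sqr_ge0.
Qed.

Lemma normc_ReIm x : normc x <= `|Re x| + `|Im x|.
Proof.
rewrite {1}[x]complexE; apply: le_trans (normcT _ _) _; rewrite normcM !normcC.
by rewrite [normc 'i](_ : _ = 1) ?mul1r // /normc /= expr0n expr1n add0r sqrtr1.
Qed.

Lemma mulJ_normc x : x * x^* = (normc x ^+ 2)%:C.
Proof. by rewrite rmorphXn /= -normrE; exact/esym/sqr_normc. Qed.

Lemma Re_mulJ x : Re (x * x^*) = normc x ^+ 2.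
Proof. by rewrite mulJ_normc. Qed.

Lemma Re_sum (I : Type) (s : seq I) (F : I -> R[i]) :
  Re (\sum_(i <- s) F i) = \sum_(i <- s) Re (F i).
Proof. by elim/big_rec2: _ => // i x y _ <-; case: (F i); case: y. Qed.

Lemma ReIm_eq x y : Re x = Re y -> Im x = Im y -> x = y.
Proof. by case: x y => a b [c d] /= -> ->. Qed.

Lemma mulr_le_sqr (x y : R) : x * y <= x ^+ 2 + y ^+ 2.
Proof. nra. Qed.

End ComplexNorm.

Section UnconditionalSums.
Variable R : realType.
Implicit Types (I J K : choiceType).

(** Convergence along [totally], with a real epsilon in place of neighbourhoods in [R[i]];
    [hsum_partial_sum] is the bridge to the definitions. *)
Definition hsum I (F : I -> R[i]) (s : R[i]) : Prop :=
  forall e : R, 0 < e -> exists J0 : {fset I}, forall J : {fset I},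
    (J0 `<=` J)%fset -> normc (\sum_(i <- J) F i - s) < e.

(** For complex families this is equivalent to having a sum ([absum_hsum], [hsum_absum]), so
    summability can be obtained from termwise bounds alone. *)
Definition absum I (F : I -> R[i]) : Prop :=
  exists M : R, forall J : {fset I}, \sum_(i <- J) normc (F i) <= M.

Lemma le_sum_fset I (f : I -> R) (A B : {fset I}) :
  (A `<=` B)%fset -> (forall i, 0 <= f i) ->
  \sum_(i <- A) f i <= \sum_(i <- B) f i.
Proof.
move=> AB f0; rewrite [leRHS](big_fsetID _ (mem A)) /=.
have -> : [fset x in B | x \in A]%fset = A.
  by apply/fsetP => i; rewrite !inE /= andb_idl // => /(fsubsetP AB).
by rewrite lerDl sumr_ge0.
Qed.

Lemma hsum_uniq I (F : I -> R[i]) s t : hsum F s -> hsum F t -> s = t.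
Proof.
move=> hs ht; apply/eqP; rewrite -subr_eq0; apply/eqP/eq0_normc/eqP.
rewrite eq_le normc_ge0 andbT; apply/ler_addgt0Pr => e e0; rewrite add0r.
have e2 : 0 < e / 2 by rewrite divr_gt0.
have [J0 h0] := hs _ e2; have [J1 h1] := ht _ e2.
have := h0 _ (fsubsetUl J0 J1); have := h1 _ (fsubsetUr J0 J1).
set S := \sum_(i <- _) _ => hS hT.
apply: le_trans (normc_distT S _ _) _; rewrite normc_distC.
by rewrite [e]splitr lerD // ltW.
Qed.

Lemma hsum0 I : hsum (fun _ : I => 0) 0.
Proof.
by move=> e e0; exists fset0 => J _; rewrite big1 // subr0 normc0.
Qed.

Lemma hsumD I (F G : I -> R[i]) s t :
  hsum F s -> hsum G t -> hsum (fun i => F i + G i) (s + t).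
Proof.
move=> hs ht e e0; have e2 : 0 < e / 2 by rewrite divr_gt0.
have [J0 h0] := hs _ e2; have [J1 h1] := ht _ e2.
exists (J0 `|` J1)%fset => J; rewrite fsubUset => /andP[/h0 hF /h1 hG].
rewrite big_split /= opprD addrACA; apply: le_lt_trans (normcT _ _) _.
by rewrite [e]splitr ltrD.
Qed.

Lemma hsumZ I (F : I -> R[i]) s c : hsum F s -> hsum (fun i => c * F i) (c * s).
Proof.
have [->|c0] := eqVneq c 0.
  by move=> _; rewrite mul0r; under eq_fun do rewrite mul0r; exact: hsum0.
have nc0 : 0 < normc c.
  by rewrite lt_neqAle normc_ge0 andbT eq_sym; apply: contra c0 => /eqP/eq0_normc->.
move=> hs e e0; have [|J0 h0] := hs (e / normc c); first by rewrite divr_gt0.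
by exists J0 => J /h0 h; rewrite -mulr_sumr -mulrBr normcM mulrC -ltr_pdivlMr.
Qed.

Lemma hsumN I (F : I -> R[i]) s : hsum F s -> hsum (fun i => - F i) (- s).
Proof.
by move=> /(hsumZ (-1)); rewrite mulN1r; under eq_fun do rewrite mulN1r.
Qed.

Lemma hsumB I (F G : I -> R[i]) s t :
  hsum F s -> hsum G t -> hsum (fun i => F i - G i) (s - t).
Proof. by move=> hF hG; apply: hsumD => //; exact: hsumN. Qed.

Lemma hsum_conj I (F : I -> R[i]) s : hsum F s -> hsum (fun i => (F i)^*) s^*.
Proof.
move=> hs e e0; have [J0 h0] := hs _ e0; exists J0 => J /h0.
by rewrite -rmorph_sum -conjB normc_conj.
Qed.

Lemma hsum_le I (F : I -> R[i]) s M :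
  hsum F s -> (forall J : {fset I}, normc (\sum_(i <- J) F i) <= M) ->
  normc s <= M.
Proof.
move=> hs hM; apply/ler_addgt0Pr => e e0; have [J0 h0] := hs _ e0.
have := h0 _ (fsubset_refl _); set S := \sum_(i <- _) _ => h.
rewrite -[s](subrK S); apply: le_trans (normcT _ _) _; rewrite addrC.
by rewrite lerD ?hM // normc_distC ltW.
Qed.

Lemma hsum_fin I (F : I -> R[i]) (J : {fset I}) :
  (forall i, i \notin J -> F i = 0) -> hsum F (\sum_(i <- J) F i).
Proof.
move=> F0 e e0; exists J => J' JJ'; rewrite (big_fset_incl _ JJ') ?subrr ?normc0 //.
by move=> x _ /F0.
Qed.

Lemma hsum_Re I (F : I -> R[i]) s :
  hsum F s -> hsum (fun i => (Re (F i))%:C) (Re s)%:C.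
Proof.
move=> hs e e0; have [J0 h0] := hs _ e0; exists J0 => J /h0; apply: le_lt_trans.
rewrite -rmorph_sum -rmorphB normcC -Re_sum; apply: le_trans (normc_Re _).
by case: (\sum_(i <- _) _); case: s {hs h0}.
Qed.

Lemma hsum_ge I (f : I -> R) (s : R) (J : {fset I}) :
  (forall i, 0 <= f i) -> hsum (fun i => (f i)%:C) s%:C ->
  \sum_(i <- J) f i <= s.
Proof.
move=> f0 hs; apply/ler_addgt0Pr => e e0; have [J0 h0] := hs _ e0.
have := h0 _ (fsubsetUl J0 J).
rewrite -rmorph_sum -rmorphB normcC ltr_norml => /andP[_ /ltW].
rewrite lerBlDl; apply: le_trans.
by apply: le_sum_fset => //; exact: fsubsetUr.
Qed.

Lemma hsum_le_real I (f : I -> R) (s M : R) :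
  hsum (fun i => (f i)%:C) s%:C -> (forall J : {fset I}, \sum_(i <- J) f i <= M) ->
  s <= M.
Proof.
move=> hs hM; apply/ler_addgt0Pr => e e0; have [J0 h0] := hs _ e0.
have := h0 _ (fsubset_refl _).
rewrite -rmorph_sum -rmorphB normcC ltr_distl => /andP[h _].
by have := hM J0; lra.
Qed.

Lemma hsum_ge0 I (f : I -> R) (s : R) :
  (forall i, 0 <= f i) -> hsum (fun i => (f i)%:C) s%:C -> 0 <= s.
Proof. by move=> f0 /(hsum_ge fset0 f0); rewrite big_seq_fset0. Qed.

Lemma hsum_real I (f : I -> R) s : hsum (fun i => (f i)%:C) s -> s = (Re s)%:C.
Proof. by move=> hs; apply: (hsum_uniq hs); have := hsum_Re hs. Qed.

Lemma nneg_hsum I (f : I -> R) M : (forall i, 0 <= f i) ->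
  (forall J : {fset I}, \sum_(i <- J) f i <= M) ->
  exists s, hsum (fun i => (f i)%:C) s%:C.
Proof.
move=> f0 hM; pose A : set R := [set x | exists J : {fset I}, x = \sum_(i <- J) f i].
have supA : has_sup A.
  split; first by exists (\sum_(i <- fset0) f i); exists fset0.
  by exists M => x [J ->].
exists (sup A) => e e0; have [x [J0 ->] hx] := sup_adherent e0 supA.
exists J0 => J J0J; rewrite -rmorph_sum -rmorphB normcC.
have h1 : \sum_(i <- J) f i <= sup A by apply: sup_upper_bound => //; exists J.
have h2 := le_sum_fset J0J f0; rewrite ltr_norml; apply/andP; split; lra.
Qed.

(** Write [f] as [(f + |f|) - |f|], a difference of two nonnegative families with bounded finite
    sums. *)
Lemma real_hsum I (f : I -> R) M :
  (forall J : {fset I}, \sum_(i <- J) `|f i| <= M) ->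
  exists s, hsum (fun i => (f i)%:C) s%:C.
Proof.
move=> hM; have [s hs] := @nneg_hsum _ (fun i => `|f i|) M (fun=> normr_ge0 _) hM.
have h0 i : 0 <= f i + `|f i| by have := ler_norm (- f i); rewrite normrN; lra.
have [J|t ht] := @nneg_hsum _ (fun i => f i + `|f i|) (M + M) h0.
  rewrite big_split /= lerD //; apply: le_trans (hM J).
  by apply: ler_sum => i _; exact: ler_norm.
exists (t - s); have := hsumB ht hs; rewrite -rmorphB /=.
by under eq_fun do rewrite -rmorphB /= addrK.
Qed.

Lemma absum_hsum I (F : I -> R[i]) : absum F -> exists s, hsum F s.
Proof.
move=> [M hM].
have [J|a ha] := @real_hsum _ (fun i => Re (F i)) M.
  by apply: le_trans (hM J); apply: ler_sum => i _; exact: normc_Re.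
have [J|b hb] := @real_hsum _ (fun i => Im (F i)) M.
  by apply: le_trans (hM J); apply: ler_sum => i _; exact: normc_Im.
exists (a%:C + 'i * b%:C); have := hsumD ha (hsumZ 'i hb).
by under eq_fun do rewrite -complexE.
Qed.

(** The sum over [J] is the difference of the sums over the union of [J0] and [J] and over [J0],
    both within [e / 2] of [s]. *)
Lemma hsum_cauchy I (F : I -> R[i]) s : hsum F s -> forall e : R, 0 < e ->
  exists J0 : {fset I}, forall J : {fset I}, [disjoint J & J0]%fset ->
    normc (\sum_(i <- J) F i) < e.
Proof.
move=> hs e e0; have e2 : 0 < e / 2 by rewrite divr_gt0.
have [J0 h0] := hs _ e2; exists J0 => J dJ.
have h1 := h0 _ (fsubset_refl _); have h2 := h0 _ (fsubsetUl J0 J).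
have E : \sum_(i <- (J0 `|` J)%fset) F i = \sum_(i <- J0) F i + \sum_(i <- J) F i.
  rewrite (big_fsetID _ (mem J0)) /=; congr (_ + _); apply: eq_fbigl => i; rewrite !inE /=.
    by case: (i \in J0); rewrite ?andbF.
  case: (boolP (i \in J0)) => // iJ0; rewrite ?andbF /= ?andbT //.
  by apply/esym/negbTE/negP => iJ; move/fdisjointP: dJ => /(_ _ iJ); rewrite iJ0.
rewrite E in h2.
have -> : \sum_(i <- J) F i =
   (\sum_(i <- J0) F i + \sum_(i <- J) F i - s) - (\sum_(i <- J0) F i - s) by ring.
apply: le_lt_trans (normcT _ _) _; rewrite normc_opp.
by rewrite [e]splitr ltrD.
Qed.

(** Off the set [J0] that the Cauchy criterion gives for 1, the nonnegative terms of a finite set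
    add up to at most 1, and so do the moduli of the negative ones; hence the constant 2. *)
Lemma real_hsum_abs I (f : I -> R) s : hsum (fun i => (f i)%:C) s ->
  exists M, forall J : {fset I}, \sum_(i <- J) `|f i| <= M.
Proof.
move=> hs; have [J0 h0] := hsum_cauchy hs ltr01.
exists (2 + \sum_(i <- J0) `|f i|) => J.
rewrite (big_fsetID _ (mem J0)) /= addrC lerD //; last first.
  by apply: le_sum_fset => //; apply/fsubsetP => i; rewrite !inE => /andP[].
set J1 := [fset _ in _ | _]%fset.
have d1 (A : {fset I}) : (A `<=` J1)%fset -> [disjoint A & J0]%fset.
  by move=> AJ; apply/fdisjointP => i /(fsubsetP AJ); rewrite !inE => /andP[].
have d2 (A : {fset I}) : (A `<=` J1)%fset -> `|\sum_(i <- A) f i| <= 1.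
  by move=> /d1 /h0; rewrite -rmorph_sum normcC => /ltW.
rewrite (big_fsetID _ [pred i | 0 <= f i]) /= -[2]/(1 + 1) lerD //.
  rewrite (eq_big_seq f); last by move=> i; rewrite !inE => /andP[_ /ger0_norm].
  apply: le_trans (ler_norm _) (d2 _ _).
  by apply/fsubsetP => i; rewrite inE => /andP[].
rewrite (eq_big_seq (fun i => - f i)); last first.
  by move=> i; rewrite !inE -ltNge => /andP[_ /ltW /ler0_norm].
rewrite sumrN; apply: le_trans (ler_norm _) _; rewrite normrN; apply: d2.
by apply/fsubsetP => i; rewrite inE => /andP[].
Qed.

Lemma hsum_Im I (F : I -> R[i]) s :
  hsum F s -> hsum (fun i => (Im (F i))%:C) (Im s)%:C.
Proof.
move=> /(hsumZ (- 'i)) /hsum_Re.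
have E z : Re (- 'i * z) = Im z :> R by case: z => a b /=; ring.
by rewrite E; under eq_fun do rewrite E.
Qed.

Lemma hsum_absum I (F : I -> R[i]) s : hsum F s -> absum F.
Proof.
move=> hs; have [M hM] := real_hsum_abs (hsum_Re hs).
have [N hN] := real_hsum_abs (hsum_Im hs).
exists (M + N) => J; apply: le_trans (lerD (hM J) (hN J)).
by rewrite -big_split /=; apply: ler_sum => i _; exact: normc_ReIm.
Qed.

Lemma absum_le I (F G : I -> R[i]) :
  (forall i, normc (F i) <= normc (G i)) -> absum G -> absum F.
Proof. by move=> FG [M hM]; exists M => J; apply: le_trans (hM J); exact: ler_sum. Qed.

Lemma absum_norm I (F : I -> R[i]) : absum F ->
  absum (fun i => (normc (F i))%:C).
Proof.
by apply: absum_le => i; rewrite normcC ger0_norm // normc_ge0.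
Qed.

Lemma absumD I (F G : I -> R[i]) : absum F -> absum G -> absum (fun i => F i + G i).
Proof.
move=> [M hM] [N hN]; exists (M + N) => J; apply: le_trans (lerD (hM J) (hN J)).
by rewrite -big_split /=; apply: ler_sum => i _; exact: normcT.
Qed.

Lemma absumZ I (F : I -> R[i]) c : absum F -> absum (fun i => c * F i).
Proof. by move=> /absum_hsum[s /(hsumZ c)/hsum_absum]. Qed.

Lemma absum_tail I (F : I -> R[i]) : absum F -> forall e : R, 0 < e ->
  exists J0 : {fset I}, forall J : {fset I}, [disjoint J & J0]%fset ->
    \sum_(i <- J) normc (F i) < e.
Proof.
move=> /absum_norm/absum_hsum[s hs] e e0; have [J0 h] := hsum_cauchy hs e0.
exists J0 => J /h; rewrite -rmorph_sum normcC ger0_norm // sumr_ge0 // => i _.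
exact: normc_ge0.
Qed.

Lemma hsum_inj I K (h : K -> I) (F : I -> R[i]) s : injective h ->
  (forall i, (exists k, i = h k) \/ F i = 0) ->
  hsum (fun k => F (h k)) s -> hsum F s.
Proof.
move=> hI hF hs e e0; have [J0 h0] := hs _ e0.
exists [fset h k | k in J0]%fset => J J0J.
pose J1 := [fset k in J0 | true]%fset.
(* [L] is the preimage of [J] under [h], finite because [h] is injective; it is listed by means of a
   partial inverse of [h]. *)
have [L hL] : exists L : {fset K}, forall k, (k \in L) = (h k \in J).
  have /choice[g hg] i : exists o : option K,
      if o is Some k then i = h k else ~ exists k, i = h k.
    by have [[k ->]|nk] := pselect (exists k, i = h k); [exists (Some k)|exists None].
  exists [fset k in pmap g J]%fset => k; rewrite !inE /= mem_pmap.
  apply/mapP/idP => [[i iJ ik]|kJ]; first by have := hg i; rewrite -ik => <-.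
  exists (h k) => //; have := hg (h k); case: (g (h k)) => [k' /hI -> //|].
  by case; exists k.
have -> : \sum_(i <- J) F i = \sum_(k <- L) F (h k).
  rewrite -(@big_imfset _ _ _ _ _ imfset_key h (mem L) F) /=; last by move=> x y _ _ /hI.
  apply/esym/big_fset_incl; first by apply/fsubsetP => i /imfsetP[k /= ]; rewrite hL => ? ->.
  move=> i iJ; case: (hF i) => // -[k ik] /imfsetP; case.
  by exists k; rewrite //= hL -ik.
apply: h0; apply/fsubsetP => k kJ0; rewrite hL; apply: (fsubsetP J0J).
by apply/imfsetP; exists k.
Qed.

Lemma hsum_comp I K (h : K -> I) (F : I -> R[i]) s : injective h ->
  (forall i, (exists k, i = h k) \/ F i = 0) ->
  hsum F s -> hsum (fun k => F (h k)) s.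
Proof.
move=> hI hF hs; have [M hM] := hsum_absum hs.
have [|t ht] := @absum_hsum _ (fun k => F (h k)).
  exists M => J; rewrite -(@big_imfset _ _ _ _ _ imfset_key h (mem J) (fun i => normc (F i))) //=.
  by move=> x y _ _ /hI.
by rewrite (hsum_uniq hs (hsum_inj hI hF ht)).
Qed.

Lemma hsum_bij I K (h : K -> I) (g : I -> K) (F : I -> R[i]) s :
  cancel h g -> cancel g h ->
  hsum F s <-> hsum (fun k => F (h k)) s.
Proof.
move=> hg gh; have hS i : (exists k, i = h k) \/ F i = 0 by left; exists (g i).
by split; [apply: hsum_comp | apply: hsum_inj] => //; exact: can_inj hg.
Qed.

Lemma absum_comp I K (h : K -> I) (F : I -> R[i]) :
  injective h -> absum F -> absum (fun k => F (h k)).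
Proof.
move=> hI [M hM]; exists M => J.
rewrite -(@big_imfset _ _ _ _ _ imfset_key h (mem J) (fun i => normc (F i))) //=.
by move=> x y _ _ /hI.
Qed.

(** Both sides are compared with the sum over a finite rectangle [A * L]: it contains the set that
    settles the double sum, and [L] is so large that every row in [A] is close to its own sum. *)
Lemma hsum_fubini I J (F : I * J -> R[i]) (g : I -> R[i]) s :
  hsum F s -> (forall i, hsum (fun j => F (i, j)) (g i)) -> hsum g s.
Proof.
move=> hs hg e e0; have e2 : 0 < e / 2 by rewrite divr_gt0.
have [X0 h0] := hs _ e2; exists [fset x.1 | x in X0]%fset => A hA.
have [L hL] : exists L : {fset J}, (forall x, x \in X0 -> x.2 \in L) /\
    normc (\sum_(i <- A) \sum_(j <- L) F (i, j) - \sum_(i <- A) g i) < e / 2.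
  (* The error is shared among the rows of [A]; the added 1 covers the case of an empty [A]. *)
  pose d := e / 2 / (#|` A|%:R + 1).
  have c0 : (0 : R) < #|` A|%:R + 1 by rewrite ltr_wpDl.
  have d0 : 0 < d by rewrite divr_gt0.
  have /choice[Lf hLf] i : exists L : {fset J}, forall L' : {fset J}, (L `<=` L')%fset ->
     normc (\sum_(j <- L') F (i, j) - g i) < d by apply: hg.
  pose L := ([fset x.2 | x in X0] `|` \bigcup_(i <- A) Lf i)%fset.
  exists L; split.
    by move=> x xX; rewrite inE; apply/orP; left; apply/imfsetP; exists x.
  rewrite -sumrB; apply: le_lt_trans (normc_sum _ _ _) _.
  apply: (@le_lt_trans _ _ (\sum_(i <- A) d)).
    rewrite big_seq [leRHS]big_seq; apply: ler_sum => i iA; apply/ltW/hLf.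
    by apply: fsubset_trans (fsubsetUr _ _); exact: bigfcup_sup.
  rewrite big_const_seq count_predT iter_addr addr0 -(mulr_natr d) /d.
  by rewrite mulrAC ltr_pdivrMr // ltr_pM2l // ltrDl.
case: hL => hX hL.
have h1 : normc (\sum_(i <- A) \sum_(j <- L) F (i, j) - s) < e / 2.
  rewrite -(@big_imfset2 _ _ _ _ (fun=> J) (I * J)%type imfset_key (mem A) (fun=> mem L) (fun i j => (i, j)) F) /=; last first.
    by move=> [x1 x2] [y1 y2] _ _ /= [-> ->].
  apply: h0; apply/fsubsetP => -[i j] xX; apply/imfset2P; exists i => /=.
    by apply: (fsubsetP hA); apply/imfsetP; exists (i, j).
  by exists j => //; exact: (hX (i, j)).
apply: le_lt_trans (normc_distT (\sum_(i <- A) \sum_(j <- L) F (i, j)) _ _) _.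
by rewrite [e]splitr ltrD // normc_distC.
Qed.

Lemma absum_slice I J (F : I * J -> R[i]) i : absum F -> absum (fun j => F (i, j)).
Proof. by apply: (@absum_comp _ _ (fun j => (i, j))) => x y []. Qed.

Lemma hsum_swap I J (F : I * J -> R[i]) s :
  hsum F s -> hsum (fun x : J * I => F (x.2, x.1)) s.
Proof.
by move=> /(@hsum_bij _ _ (fun x : J * I => (x.2, x.1)) (fun x => (x.2, x.1))); apply; case.
Qed.

(** A finite set of pairs lies in the rectangle spanned by its two projections. *)
Lemma absum_pair I J (F : I * J -> R[i]) (B : I -> R) (M : R) :
  (forall i (L : {fset J}), \sum_(j <- L) normc (F (i, j)) <= B i) ->
  (forall A : {fset I}, \sum_(i <- A) B i <= M) -> absum F.
Proof.
move=> hB hM; exists M => X.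
pose A := [fset x.1 | x in X]%fset; pose L := [fset x.2 | x in X]%fset.
apply: (@le_trans _ _ (\sum_(i <- A) \sum_(j <- L) normc (F (i, j)))); last first.
  by apply: le_trans (hM A); apply: ler_sum => i _.
rewrite -(@big_imfset2 _ _ _ _ (fun=> J) (I * J)%type imfset_key (mem A) (fun=> mem L) (fun i j => (i, j)) (fun x => normc (F x))) /=; last first.
  by move=> [x1 x2] [y1 y2] _ _ /= [-> ->].
apply: le_sum_fset => [|x]; last exact: normc_ge0.
apply/fsubsetP => -[i j] xX; apply/imfset2P; exists i => /=.
  by apply/imfsetP; exists (i, j).
by exists j => //; apply/imfsetP; exists (i, j).
Qed.

Lemma absumM I J (F : I -> R[i]) (G : J -> R[i]) :
  absum F -> absum G -> absum (fun x : I * J => F x.1 * G x.2).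
Proof.
move=> [M hM] [N hN]; have N0 : 0 <= N by have := hN fset0; rewrite big_seq_fset0.
apply: (@absum_pair _ _ _ (fun i => normc (F i) * N) (M * N)) => [i L|A].
  rewrite (eq_bigr (fun j => normc (F i) * normc (G j))); last by move=> j _; rewrite normcM.
  by rewrite -mulr_sumr ler_wpM2l // normc_ge0.
by rewrite -mulr_suml ler_wpM2r.
Qed.

Lemma hsumM I J (F : I -> R[i]) (G : J -> R[i]) s t :
  hsum F s -> hsum G t -> hsum (fun x : I * J => F x.1 * G x.2) (s * t).
Proof.
move=> hs ht; have [u hu] := absum_hsum (absumM (hsum_absum hs) (hsum_absum ht)).
suff -> : s * t = u by [].
have h1 : hsum (fun i => F i * t) u by apply: hsum_fubini hu _ => i; exact: (hsumZ (F i) ht).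
have h2 : hsum (fun i => F i * t) (s * t).
  by rewrite mulrC; under eq_fun do rewrite mulrC; exact: hsumZ.
exact: hsum_uniq h2 h1.
Qed.

(** A finite product of series is a series over tuples of indices. The multi-index binomial theorem,
    the geometric series over multi-indices and the factorization over tensor slots all come from
    this. *)
Lemma hsum_prod_ffun m I (F : 'I_m -> I -> R[i]) (s : 'I_m -> R[i]) :
  (forall j, hsum (F j) (s j)) ->
  hsum (fun p : {ffun 'I_m -> I} => \prod_(j < m) F j (p j)) (\prod_(j < m) s j).
Proof.
elim: m F s => [|m IHm] F s hs.
  rewrite big_ord0; under eq_fun do rewrite big_ord0.
  pose p0 : {ffun 'I_0 -> I} := ffun0 (card_ord 0).
  have := @hsum_fin _ (fun p : {ffun 'I_0 -> I} => 1) [fset p0]%fset.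
  rewrite big_seq_fset1; apply => i; rewrite inE => /eqP[].
  by apply/ffunP; case.
rewrite big_ord_recl.
have := hsumM (hs ord0) (IHm (fun j => F (lift ord0 j)) (fun j => s (lift ord0 j)) (fun j => hs _)).
pose h (p : {ffun 'I_m.+1 -> I}) := (p ord0, [ffun j => p (lift ord0 j)]).
pose g (x : I * {ffun 'I_m -> I}) : {ffun 'I_m.+1 -> I} :=
  [ffun i => if unlift ord0 i is Some j then x.2 j else x.1].
have hg : cancel h g.
  move=> p; apply/ffunP => i; rewrite !ffunE.
  by case: unliftP => [j ->|->] //; rewrite ffunE.
have gh : cancel g h.
  move=> [i p]; rewrite /h /g ffunE unlift_none /=; congr (_, _).
  by apply/ffunP => j; rewrite !ffunE liftK.
move=> /(hsum_bij _ _ hg gh) /=; congr (hsum _ _); apply/funext => p.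
by rewrite big_ord_recl; congr (_ * _); apply: eq_bigr => j _; rewrite ffunE.
Qed.

Lemma hsum_partial_sum I (F : I -> R[i]^o) (s : R[i]^o) :
  partial_sum F @ totally --> s <-> hsum F s.
Proof.
have Ft : ProperFilter (@totally I) := totally_filter.
split=> [/cvgrPdist_lt h e e0|h].
  have e0' : 0 < e%:C :> R[i] by rewrite ltcR.
  have [J0 _ hJ0] := h _ e0'.
  exists J0 => J /hJ0 /=; rewrite normrE ltcR normc_distC.
  by rewrite /partial_sum -(big_seq_fsetE _ J predT).
apply/cvgrPdist_lt => e e0.
have [e0' eE] : 0 < Re e /\ e = (Re e)%:C.
  by move: e0; rewrite ltcE /= => /andP[/eqP]; case: e => a b /= -> ->.
have [J0 hJ0] := h _ e0'; exists J0 => // J /= /hJ0.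
by rewrite eE normrE ltcR normc_distC /partial_sum -(big_seq_fsetE _ J predT).
Qed.

Lemma esum_fin_absum I (f : I -> R) : (forall i, 0 <= f i) ->
  (\esum_(i in [set: I]) (f i)%:E < +oo)%E <->
  exists M : R, forall J : {fset I}, \sum_(i <- J) f i <= M.
Proof.
move=> f0; split=> [h|[M hM]].
  have fin : (\esum_(i in [set: I]) (f i)%:E)%E \is a fin_num.
    by rewrite ge0_fin_numE // esum_ge0 // => i _; rewrite lee_fin.
  exists (fine (\esum_(i in [set: I]) (f i)%:E)%E) => J.
  rewrite -lee_fin fineK //; apply: esum_ge; exists [set` J] => //.
  by rewrite fsbig_finite //= set_fsetK sumEFin.
apply: (@le_lt_trans _ _ M%:E); last exact: ltry.
apply: ge_ereal_sup => _ [A [finA _] <-].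
by rewrite fsbig_finite //= sumEFin lee_fin.
Qed.

End UnconditionalSums.

(** * Projections, adjoints and compressions *)

Section Hilbert.
Variables (R : realType) (V : lmodType R[i]) (ip : V -> V -> R[i]) (H : set V).
Implicit Types (f g h : V) (A G : set V).

(** In the application [V] consists of all functions on the polydisc and [ip] is meaningful only on
    [H], so every law is restricted to [H]. *)
Record hilbert : Prop := Hilbert {
  hilbert0 : H 0 ;
  hilbertL : forall (c : R[i]) f g, H f -> H g -> H (c *: f + g) ;
  ip_linear : forall (c : R[i]) f g h, H f -> H g -> H h ->
    ip (c *: f + g) h = c * ip f h + ip g h ;
  ip_conj : forall f g, H f -> H g -> ip g f = (ip f g)^* ;
  ip_ge0 : forall f, H f -> 0 <= Re (ip f f) ;
  ip_eq0 : forall f, H f -> Re (ip f f) = 0 -> f = 0 ;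
  hilbert_complete : forall u : nat -> V, (forall n, H (u n)) ->
    (forall e : R, 0 < e -> exists N, forall m n, (N <= m)%N -> (N <= n)%N ->
       hnorm ip (u m - u n) < e) ->
    exists2 f, H f & forall e : R, 0 < e -> exists N, forall n, (N <= n)%N ->
       hnorm ip (u n - f) < e }.

Definition subspace A : Prop :=
  [/\ A `<=` H, A 0 & forall (c : R[i]) f g, A f -> A g -> A (c *: f + g)].

Lemma subspaceD A f g : subspace A -> A f -> A g -> A (f + g).
Proof. by move=> [_ _ L] Af Ag; have := L 1 f g Af Ag; rewrite scale1r. Qed.

Lemma subspaceZ A (c : R[i]) f : subspace A -> A f -> A (c *: f).
Proof. by move=> [_ A0 L] Af; have := L c f 0 Af A0; rewrite addr0. Qed.

Lemma subspaceB A f g : subspace A -> A f -> A g -> A (f - g).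
Proof.
by move=> [_ _ L] Af Ag; have := L (-1) g f Ag Af; rewrite scaleN1r addrC.
Qed.

Lemma closed_subspaceW A : closed_subspace ip H A -> subspace A.
Proof. by case. Qed.

Hypothesis hH : hilbert.

Lemma subspaceT : subspace H.
Proof. by case: hH => H0 HL *; split. Qed.

Lemma closed_subspaceT : closed_subspace ip H H.
Proof. by case: hH => H0 HL *; split => // f []. Qed.

Let HD f g : H f -> H g -> H (f + g). Proof. exact: subspaceD subspaceT. Qed.
Let HB f g : H f -> H g -> H (f - g). Proof. exact: subspaceB subspaceT. Qed.
Let HZ c f : H f -> H (c *: f). Proof. exact: subspaceZ subspaceT. Qed.
Let H0 : H 0. Proof. exact: hilbert0. Qed.

Lemma ip0l h : H h -> ip 0 h = 0.
Proof.
move=> Hh; have := ip_linear hH (-1) H0 H0 Hh.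
by rewrite scaler0 addr0 mulN1r addNr.
Qed.

Lemma ipZl c f h : H f -> H h -> ip (c *: f) h = c * ip f h.
Proof.
by move=> Hf Hh; have := ip_linear hH c Hf H0 Hh; rewrite addr0 ip0l // addr0.
Qed.

Lemma ipDl f g h : H f -> H g -> H h -> ip (f + g) h = ip f h + ip g h.
Proof.
by move=> Hf Hg Hh; have := ip_linear hH 1 Hf Hg Hh; rewrite scale1r mul1r.
Qed.

Lemma ipBl f g h : H f -> H g -> H h -> ip (f - g) h = ip f h - ip g h.
Proof.
move=> Hf Hg Hh; rewrite -scaleN1r ipDl // ?ipZl ?mulN1r //; exact: HZ.
Qed.

Lemma ip0r h : H h -> ip h 0 = 0.
Proof. by move=> Hh; rewrite (ip_conj hH H0 Hh) ip0l // rmorph0. Qed.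

Lemma ipZr c f h : H f -> H h -> ip h (c *: f) = c^* * ip h f.
Proof.
by move=> Hf Hh; rewrite (ip_conj hH (HZ c Hf) Hh) ipZl // (ip_conj hH Hf Hh) conjM.
Qed.

Lemma ipDr f g h : H f -> H g -> H h -> ip h (f + g) = ip h f + ip h g.
Proof.
move=> Hf Hg Hh; rewrite (ip_conj hH (HD Hf Hg) Hh) ipDl // conjD.
by rewrite (ip_conj hH Hf Hh) (ip_conj hH Hg Hh).
Qed.

Lemma ipBr f g h : H f -> H g -> H h -> ip h (f - g) = ip h f - ip h g.
Proof.
move=> Hf Hg Hh; rewrite (ip_conj hH (HB Hf Hg) Hh) ipBl // conjB.
by rewrite (ip_conj hH Hf Hh) (ip_conj hH Hg Hh).
Qed.

Lemma hnorm_ge0 f : 0 <= hnorm ip f.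
Proof. exact: sqrtr_ge0. Qed.

Lemma hnorm_sqr f : H f -> hnorm ip f ^+ 2 = Re (ip f f).
Proof. by move=> Hf; rewrite sqr_sqrtr // ip_ge0. Qed.

Lemma ip_self f : H f -> ip f f = (hnorm ip f ^+ 2)%:C.
Proof.
move=> Hf; rewrite hnorm_sqr //; have := ip_conj hH Hf Hf.
by move=> /(congr1 (@complex.Im R)); rewrite Im_conj => h; apply: ReIm_eq => //=; lra.
Qed.

Lemma hnorm0 : hnorm ip 0 = 0.
Proof. by rewrite /hnorm ip0l // sqrtr0. Qed.

Lemma hnorm_eq0 f : H f -> hnorm ip f = 0 -> f = 0.
Proof. by move=> Hf f0; apply: (ip_eq0 hH Hf); rewrite -hnorm_sqr // f0 expr0n. Qed.

Lemma hnormZ c f : H f -> hnorm ip (c *: f) = normc c * hnorm ip f.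
Proof.
move=> Hf; rewrite /hnorm ipZl ?ipZr //; last exact: HZ.
rewrite mulrA mulJ_normc ip_self // -rmorphM /=.
by rewrite sqrtrM ?sqr_ge0 // !sqrtr_sqr !ger0_norm ?normc_ge0 ?hnorm_ge0.
Qed.

Lemma hnorm_distC f g : H f -> H g -> hnorm ip (f - g) = hnorm ip (g - f).
Proof.
by move=> Hf Hg; rewrite -[f - g]opprB -[- (g - f)]scaleN1r hnormZ ?normc_opp ?normc1 ?mul1r //; exact: HB.
Qed.

Lemma hnormD_sqr f g : H f -> H g ->
  hnorm ip (f + g) ^+ 2 = hnorm ip f ^+ 2 + 2 * Re (ip f g) + hnorm ip g ^+ 2.
Proof.
move=> Hf Hg; rewrite !hnorm_sqr //; last exact: HD.
rewrite ipDl // ?ipDr //; last exact: HD.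
rewrite (ip_conj hH Hf Hg) !raddfD /= Re_conj; ring.
Qed.

Lemma parallelogram f g : H f -> H g ->
  hnorm ip (f + g) ^+ 2 + hnorm ip (f - g) ^+ 2 =
  2 * hnorm ip f ^+ 2 + 2 * hnorm ip g ^+ 2.
Proof.
move=> Hf Hg; rewrite hnormD_sqr // -[- g]scaleN1r hnormD_sqr //; last exact: HZ.
rewrite hnormZ // ipZr // normc_opp normc1 conjN rmorph1 mulN1r raddfN /=; ring.
Qed.

Lemma cauchy_schwarz f g : H f -> H g ->
  normc (ip f g) <= hnorm ip f * hnorm ip g.
Proof.
move=> Hf Hg; have [g0|g0] := eqVneq (hnorm ip g) 0.
  by rewrite g0 mulr0 (hnorm_eq0 Hg g0) ip0r // normc0.
have gp : 0 < hnorm ip g by rewrite lt_neqAle eq_sym g0 hnorm_ge0.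
rewrite -(@ler_pXn2r _ 2) ?nnegrE ?normc_ge0 ?mulr_ge0 ?hnorm_ge0 // exprMn.
pose N := hnorm ip g ^+ 2; have Np : 0 < N by rewrite exprn_gt0.
(* With this [c], the vector [f + c *: g] is the component of [f] orthogonal to [g]. That its
   squared norm is nonnegative becomes the claim after multiplication by [N]. *)
pose w := ip f g; pose c := - (w * (N^-1)%:C).
have := sqr_ge0 (hnorm ip (f + c *: g)).
rewrite hnormD_sqr //; last exact: HZ.
rewrite ipZr // hnormZ // exprMn -/N -/w /c normc_opp normcM normcC conjN conjM.
rewrite conj_real mulNr mulrAC [_^* * w]mulrC mulJ_normc -rmorphM /=.
rewrite exprMn real_normK ?num_real // exprVn => h.
have : 0 <= N * (hnorm ip f ^+ 2 + 2 * - (normc w ^+ 2 / N) + normc w ^+ 2 * (N ^+ 2)^-1 * N).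
  by rewrite mulr_ge0 // ltW.
have -> : N * (hnorm ip f ^+ 2 + 2 * - (normc w ^+ 2 / N) + normc w ^+ 2 * (N ^+ 2)^-1 * N)
  = N * hnorm ip f ^+ 2 - normc w ^+ 2 by field; rewrite gt_eqF.
by rewrite subr_ge0 mulrC.
Qed.

Lemma hnormT f g : H f -> H g -> hnorm ip (f + g) <= hnorm ip f + hnorm ip g.
Proof.
move=> Hf Hg; rewrite -(@ler_pXn2r _ 2) ?nnegrE ?addr_ge0 ?hnorm_ge0 //.
rewrite hnormD_sqr // sqrrD lerD2r lerD2l -[leRHS]mulr_natl ler_pM2l //.
by apply: le_trans (ler_norm _) (le_trans (normc_Re _) (cauchy_schwarz Hf Hg)).
Qed.

Lemma hnorm_distT h f g : H f -> H g -> H h ->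
  hnorm ip (f - g) <= hnorm ip (f - h) + hnorm ip (h - g).
Proof.
by move=> Hf Hg Hh; apply: le_trans (hnormT (HB Hf Hh) (HB Hh Hg)); rewrite addrA subrK.
Qed.

(* A minimizing sequence for the distance is Cauchy by the parallelogram law. *)
Lemma projection_exists A f : closed_subspace ip H A -> H f ->
  exists2 g, A g & forall h, A h -> ip (f - g) h = 0.
Proof.
move=> [AH A0 AL Acl] Hf; have sA : subspace A by split.
pose D : set R := [set x | exists2 g, A g & x = hnorm ip (f - g) ^+ 2].
have infD : has_inf D.
  split; first by exists (hnorm ip (f - 0) ^+ 2); exists 0.
  by exists 0 => x [g _ ->]; exact: sqr_ge0.
have Dle g : A g -> inf D <= hnorm ip (f - g) ^+ 2.
  by move=> Ag; apply: ge_inf; [case: infD | exists g].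
have /choice[u hu] (n : nat) : exists g, A g /\ hnorm ip (f - g) ^+ 2 < inf D + n.+1%:R^-1.
  have [|x [g Ag ->] hx] := inf_adherent (eps := n.+1%:R^-1) _ infD.
    by rewrite invr_gt0.
  by exists g.
have uA n : A (u n) by case: (hu n).
have uH n : H (u n) by apply: AH.
have par m n : hnorm ip (u m - u n) ^+ 2 <= 2 * (m.+1%:R^-1 + n.+1%:R^-1).
  have := parallelogram (HB Hf (uH n)) (HB Hf (uH m)).
  have -> : f - u n - (f - u m) = u m - u n by rewrite opprB addrC addrA addrNK.
  have -> : f - u n + (f - u m) = (2 : R)%:C *: (f - (2^-1 : R)%:C *: (u n + u m)).
    rewrite scalerBr scalerA -rmorphM /= mulfV // scale1r opprD.
    by rewrite (_ : (2 : R)%:C = 1 + 1) ?rmorphD // scalerDl scale1r addrACA.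
  have Am : A ((2^-1 : R)%:C *: (u n + u m)) by apply: subspaceZ => //; exact: subspaceD.
  rewrite hnormZ ?normcC ?exprMn; last by apply: HB => //; exact: AH.
  have := Dle _ Am; have := (hu m).2; have := (hu n).2.
  rewrite (ger0_norm (ler0n _ 2)).
  move: (hnorm ip (f - u n)) (hnorm ip (f - u m)) (hnorm ip (f - _ *: _)) => a b c.
  set t := inf D; move: (m.+1%:R^-1) (n.+1%:R^-1) => p q; nra.
have [e e0|g Hg ug] := hilbert_complete hH uH.
  have [N hN] : exists N : nat, (4 / e ^+ 2) < N.+1%:R.
    exists (Num.truncn (4 / e ^+ 2)); exact: truncnS_gt.
  have ne : N.+1%:R^-1 < e ^+ 2 / 4 :> R.
    by rewrite -[ltRHS]invrK ltf_pV2 ?posrE ?invr_gt0 ?divr_gt0 ?exprn_gt0 // invf_div.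
  exists N => m n Nm Nn; rewrite -(@ltr_pXn2r _ 2) ?nnegrE ?hnorm_ge0 ?(ltW e0) //.
  apply: le_lt_trans (par m n) _.
  have hle k : (N <= k)%N -> k.+1%:R^-1 <= N.+1%:R^-1 :> R.
    by move=> Nk; rewrite lef_pV2 ?posrE // ler_nat.
  have := hle _ Nm; have := hle _ Nn; move: ne.
  by move: (m.+1%:R^-1) (n.+1%:R^-1) (N.+1%:R^-1) (e ^+ 2) => *; lra.
have Ag : A g.
  apply: Acl; split => // e e0; have [N hN] := ug e e0.
  by exists (u N); [|rewrite hnorm_distC //; exact: hN].
exists g => // h Ah.
have gle : hnorm ip (f - g) ^+ 2 <= inf D.
  apply/ler_addgt0Pr => e e0.
  pose d := hnorm ip (f - g); have d0 : 0 <= d by exact: hnorm_ge0.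
  have k0 : 0 < e / (4 * (d + 1)) by rewrite divr_gt0 // mulr_gt0 // ltr_wpDl.
  have [N hN] := ug _ k0.
  have [M hM] : exists N : nat, (2 / e) < N.+1%:R.
    exists (Num.truncn (2 / e)); exact: truncnS_gt.
  have me : M.+1%:R^-1 < e / 2 :> R.
    by rewrite -[ltRHS]invrK ltf_pV2 ?posrE ?invr_gt0 ?divr_gt0 // invf_div.
  pose n := maxn N M; have := hN n (leq_maxl _ _); set t := hnorm ip _ => ht.
  have hdt : d <= hnorm ip (f - u n) + t by exact: hnorm_distT.
  have [_ hun] := hu n; set s := hnorm ip _ in hdt hun.
  have s0 : 0 <= s by exact: hnorm_ge0.
  have mM : n.+1%:R^-1 <= M.+1%:R^-1 :> R.
    by rewrite lef_pV2 ?posrE // ler_nat ltnS leq_maxr.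
  have t0 : 0 <= t by exact: hnorm_ge0.
  have dt : 2 * (d * t) <= e / 2.
    have : d * t <= (d + 1) * (e / (4 * (d + 1))).
      by apply: ler_pM => //; [rewrite lerDl | exact: ltW].
    have -> : (d + 1) * (e / (4 * (d + 1))) = e / 4 by field; rewrite gt_eqF // ltr_wpDl.
    lra.
  have ss : s ^+ 2 < inf D + e / 2.
    by apply: lt_trans hun _; rewrite ltrD2l; exact: le_lt_trans mM me.
  have s2 := sqr_ge0 s; rewrite -/d.
  have [td|dt'] := leP t d; first nra.
  have : d ^+ 2 <= d * t by nra.
  lra.
(* Moving [g] by [(w * s) *: h] would lower the squared distance unless [w = 0]: with [W] and [Y] as
   below, minimality gives [2 W s <= W s (s Y)], while [s Y <= 1]. The summand 1 in [s] avoids a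
   separate case [h = 0]. *)
pose w := ip (f - g) h; pose s := (hnorm ip h ^+ 2 + 1)^-1.
have Hh : H h by exact: AH.
have Hfg := HB Hf Hg.
have s0 : 0 < s by rewrite invr_gt0 ltr_wpDl ?sqr_ge0.
have Agh : A (g + (w * s%:C) *: h) by apply: subspaceD => //; exact: subspaceZ.
have := le_trans gle (Dle _ Agh).
rewrite opprD addrA -scaleNr (hnormD_sqr Hfg (HZ _ Hh)).
rewrite ipZr // hnormZ // exprMn normc_opp normcM normcC conjN conjM conj_real -/w.
rewrite mulNr mulrAC [_^* * w]mulrC mulJ_normc -rmorphM /= exprMn real_normK ?num_real //.
have hs : s * hnorm ip h ^+ 2 <= 1.
  by rewrite mulrC ler_pdivrMr ?ltr_wpDl ?sqr_ge0 // mul1r lerDl.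
move=> hw; apply/eq0_normc/eqP; rewrite -sqrf_eq0 eq_le sqr_ge0 andbT.
move: hw; rewrite -/w; have := sqr_ge0 (normc w).
set W := normc w ^+ 2; set Y := hnorm ip h ^+ 2 in hs *.
set Z := hnorm ip (f - g) ^+ 2 => W0 hw.
have h1 : 2 * (W * s) <= (W * s) * (s * Y) by lra.
have h2 : W * s * (s * Y) <= W * s by rewrite ler_piMr // mulr_ge0 // ltW.
have : W * s <= 0 by lra.
by rewrite pmulr_lle0.
Qed.

Lemma ip_orth_uniq A f g : subspace A -> A f -> A g ->
  (forall h, A h -> ip f h = ip g h) -> f = g.
Proof.
move=> sA Af Ag E; have [AH _ _] := sA; apply/eqP; rewrite -subr_eq0; apply/eqP.
have Afg : A (f - g) by exact: subspaceB.
by apply: (ip_eq0 hH (AH _ Afg)); rewrite ipBl ?E ?subrr //; exact: AH.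
Qed.

(** Since [orthoproj] is a choice, this is the way to compute it: a vector of [A] with the same
    inner products against [A] must be the chosen one. *)
Lemma orthoproj_uniq A f g : closed_subspace ip H A -> H f -> A g ->
  (forall h, A h -> ip f h = ip g h) -> orthoproj ip A f = g.
Proof.
move=> cA Hf Ag E; have sA := closed_subspaceW cA; have [AH _ _] := sA.
rewrite /orthoproj; case: xgetP => [p -> [Ap pE]|/(_ g)[]].
  apply: (ip_orth_uniq sA Ap Ag) => h Ah; rewrite -E //.
  by apply/esym/eqP; rewrite -subr_eq0 -ipBl ?pE //; exact: AH.
by split => // h Ah; rewrite ipBl ?E ?subrr //; exact: AH.
Qed.

Lemma orthoprojP A f : closed_subspace ip H A -> H f ->
  A (orthoproj ip A f) /\ forall h, A h -> ip (orthoproj ip A f) h = ip f h.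
Proof.
move=> cA Hf; have [g Ag gE] := projection_exists cA Hf.
have [AH _ _] := closed_subspaceW cA.
have E h : A h -> ip f h = ip g h.
  by move=> Ah; apply/eqP; rewrite -subr_eq0 -ipBl ?gE //; exact: AH.
by rewrite (orthoproj_uniq cA Hf Ag E); split => // h /E.
Qed.

Lemma orthoproj_id A f : closed_subspace ip H A -> A f -> orthoproj ip A f = f.
Proof. by move=> cA Af; apply: orthoproj_uniq => //; case: cA => AH *; exact: AH. Qed.

Lemma orthoproj_linear A c f g : closed_subspace ip H A -> H f -> H g ->
  orthoproj ip A (c *: f + g) = c *: orthoproj ip A f + orthoproj ip A g.
Proof.
move=> cA Hf Hg; have [AH _ AL _] := cA.
have [Af fE] := orthoprojP cA Hf; have [Ag gE] := orthoprojP cA Hg.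
apply: orthoproj_uniq => //; [exact: hilbertL | exact: AL | move=> h Ah].
by rewrite !ip_linear // ?fE ?gE //; exact: AH.
Qed.

Lemma orthoproj_le A f : closed_subspace ip H A -> H f ->
  hnorm ip (orthoproj ip A f) <= hnorm ip f.
Proof.
move=> cA Hf; have [Af fE] := orthoprojP cA Hf; have [AH _ _] := closed_subspaceW cA.
set p := orthoproj ip A f in Af fE *; have Hp := AH _ Af.
have [p0|p0] := eqVneq (hnorm ip p) 0; first by rewrite p0 hnorm_ge0.
have pp : 0 < hnorm ip p by rewrite lt_neqAle eq_sym p0 hnorm_ge0.
rewrite -(ler_pM2r pp) -expr2 hnorm_sqr // fE //.
by apply: le_trans (ler_norm _) (le_trans (normc_Re _) (cauchy_schwarz Hf Hp)).
Qed.

Lemma adjoint_uniq A (T : V -> V) g h : subspace A -> A h ->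
  (forall f, A f -> ip (T f) g = ip f h) -> adjoint ip A T g = h.
Proof.
move=> sA Ah E; have [AH _ _] := sA.
rewrite /adjoint; case: xgetP => [p -> [Ap pE]|/(_ h)[] //].
apply: (ip_orth_uniq sA) => // f Af.
rewrite (ip_conj hH (AH _ Af) (AH _ Ap)) (ip_conj hH (AH _ Af) (AH _ Ah)).
by rewrite -pE // E.
Qed.

Lemma lin_span_sub G A : subspace A -> G `<=` A -> lin_span G `<=` A.
Proof.
move=> sA GA f [m [c [u [uG ->]]]].
elim: m c u uG => [|m IHm] c u uG; first by rewrite big_ord0; case: sA.
rewrite big_ord_recl; case: (sA) => _ _ L; apply: L; first exact/GA.
by apply: IHm => i; exact: uG.
Qed.

Lemma lin_span_linear G (c : R[i]) f g :
  lin_span G f -> lin_span G g -> lin_span G (c *: f + g).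
Proof.
move=> [m [a [u [uG ->]]]] [p [b [v [vG ->]]]]; exists (m + p)%N.
exists (fun i => match fintype.split i with inl j => c * a j | inr j => b j end).
exists (fun i => match fintype.split i with inl j => u j | inr j => v j end).
split; first by move=> i; case: fintype.split.
rewrite big_split_ord /= scaler_sumr; congr (_ + _); apply: eq_bigr => i _.
  by rewrite (unsplitK (inl i) : fintype.split (lshift p i) = _) scalerA.
by rewrite (unsplitK (inr i) : fintype.split (rshift m i) = _).
Qed.

Lemma lin_span0 G : lin_span G 0.
Proof.
exists 0%N, (fun=> 0), (fun=> 0); split; first by case.
by rewrite big_ord0.
Qed.

Lemma lin_span_gen G : G `<=` lin_span G.
Proof.
move=> f Gf; exists 1%N, (fun=> 1), (fun=> f); split => //.
by rewrite big_ord1 scale1r.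
Qed.

Lemma hclosure_sub A : A `<=` H -> A `<=` hclosure ip H A.
Proof.
move=> AH f Af; split; first exact: AH.
by move=> e e0; exists f => //; rewrite subrr hnorm0.
Qed.

Lemma hclosure_closed A : subspace A -> closed_subspace ip H (hclosure ip H A).
Proof.
move=> sA; have [AH A0 AL] := sA; split; first by move=> f [].
- by apply: hclosure_sub.
- move=> c f g [Hf hf] [Hg hg]; split; first exact: hilbertL.
  move=> e e0; have e1 : 0 < e / 2 / (normc c + 1).
    by rewrite !divr_gt0 // ltr_wpDl // normc_ge0.
  have e2 : 0 < e / 2 by rewrite divr_gt0.
  have [f' Af' ff'] := hf _ e1; have [g' Ag' gg'] := hg _ e2.
  exists (c *: f' + g'); first exact: AL.
  have Hf' := AH _ Af'; have Hg' := AH _ Ag'.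
  rewrite opprD addrACA -scalerBr; apply: le_lt_trans (hnormT _ _) _.
  - by apply/HZ/HB.
  - exact: HB.
  rewrite [e]splitr ler_ltD // hnormZ; last exact: HB.
  apply: (@le_trans _ _ ((normc c + 1) * (e / 2 / (normc c + 1)))).
    by apply: ler_pM; rewrite ?normc_ge0 ?hnorm_ge0 ?lerDl // ltW.
  by rewrite mulrC divfK // gt_eqF // ltr_wpDl // normc_ge0.
- move=> f [Hf hf]; split => // e e0; have e2 : 0 < e / 2 by rewrite divr_gt0.
  have [g [Hg hg] fg] := hf _ e2; have [h Ah gh] := hg _ e2; exists h => //.
  apply: le_lt_trans (hnorm_distT Hf (AH _ Ah) Hg) _.
  by rewrite [e]splitr ltrD.
Qed.

(** * Extension by density from a set of generators *)

Section Density.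
Variables (G S : set V).
Hypotheses (GH : G `<=` H) (hS : S = hclosure ip H (lin_span G)).

Lemma lin_span_subspace : subspace (lin_span G).
Proof.
split; [|exact: lin_span0|exact: lin_span_linear].
by apply: lin_span_sub => //; exact: subspaceT.
Qed.

Lemma span_closed : closed_subspace ip H S.
Proof. by rewrite hS; apply: hclosure_closed; exact: lin_span_subspace. Qed.

Lemma span_gen : G `<=` S.
Proof.
move=> f Gf; rewrite hS; apply: hclosure_sub; last exact: lin_span_gen.
by case: lin_span_subspace.
Qed.

(** The kernel of [T] contains the span of [G]; a vector of [S] is approximated by that span, and
    the bound makes [T] continuous. *)
Lemma span_ext (T : V -> V) (M : R) :
  (forall f, S f -> H (T f)) ->
  (forall c f g, S f -> S g -> T (c *: f + g) = c *: T f + T g) ->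
  (forall f, S f -> hnorm ip (T f) <= M * hnorm ip f) ->
  (forall f, G f -> T f = 0) -> forall f, S f -> T f = 0.
Proof.
move=> TH TL TM TG; have [SH S0 SL _] := span_closed.
have TG' f : lin_span G f -> S f /\ T f = 0.
  apply: (@lin_span_sub G [set f | S f /\ T f = 0]); last first.
    by move=> {}f Gf; split; [exact: span_gen | exact: TG].
  split; first by move=> g [/SH].
    split => //; have := TL (-1) 0 0 S0 S0; rewrite scaler0 addr0 scaleN1r => E.
    by rewrite E addNr.
  move=> c g h [Sg g0] [Sh h0]; split; first exact: SL.
  by rewrite TL // g0 h0 scaler0 addr0.
move=> f Sf; apply: hnorm_eq0; first exact: TH.
apply/eqP; rewrite eq_le hnorm_ge0 andbT; apply/ler_addgt0Pr => e e0; rewrite add0r.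
have [_ fc] : hclosure ip H (lin_span G) f by rewrite -hS.
(* The sign of [M] is unknown, so [|M| + 1] serves as a positive bound by which one can divide. *)
have M0 : 0 < `|M| + 1 by rewrite ltr_wpDl.
have [|g /TG'[Sg g0] fg] := fc (e / (`|M| + 1)); first by rewrite divr_gt0.
have SB := subspaceB (closed_subspaceW span_closed) Sf Sg.
have -> : T f = T (f - g).
  by have := TL (-1) g f Sg Sf; rewrite g0 scaler0 add0r scaleN1r addrC => <-.
apply: le_trans (TM _ SB) _.
apply: (@le_trans _ _ ((`|M| + 1) * hnorm ip (f - g))).
  rewrite ler_wpM2r ?hnorm_ge0 //; apply: le_trans (ler_norm _) _; by rewrite lerDl.
by rewrite mulrC -ler_pdivlMr // ltW.
Qed.

Lemma span_ip_ext g h : H g -> H h ->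
  (forall f, G f -> ip f g = ip f h) -> forall f, S f -> ip f g = ip f h.
Proof.
move=> Hg Hh E f Sf; have [SH _ _ _] := span_closed.
pose w := g - h; have Hw : H w by exact: HB.
have E' f' : G f' -> ip f' w = 0.
  by move=> Gf'; rewrite ipBr ?E ?subrr //; exact: GH.
suff : ip f w = 0 by move/eqP; rewrite ipBr ?subr_eq0 => [/eqP||| ]//; exact: SH.
(* [span_ext] speaks of maps into [V], so the functional [ip _ w] is turned into the rank-one map
   [f |-> ip f w *: w], which is bounded by the squared norm of [w]. *)
have : ip f w *: w = 0.
  apply: (@span_ext (fun f => ip f w *: w) (hnorm ip w ^+ 2)) Sf => //.
  - by move=> f' _; exact: HZ.
  - move=> c f1 f2 /SH Hf1 /SH Hf2.
    by rewrite ip_linear // scalerDl scalerA.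
  - move=> f' /SH Hf'; rewrite hnormZ //; apply: le_trans (ler_wpM2r (hnorm_ge0 _) (cauchy_schwarz Hf' Hw)) _.
    by rewrite -mulrA -expr2 mulrC.
  - by move=> f' /E' ->; rewrite scale0r.
move/eqP; rewrite scaler_eq0 => /orP[/eqP//|/eqP w0].
by rewrite w0 ip0r //; exact: SH.
Qed.

End Density.

(** The adjoint is given explicitly, so that its values need not be recovered from the choice made
    by [adjoint]. *)
Definition contraction_pair (T Ts : V -> V) : Prop :=
  [/\ is_contraction ip H T, is_contraction ip H Ts
    & forall f g, H f -> H g -> ip (T f) g = ip f (Ts g)].

Section Compression.
Variables (S : set V) (T Ts : V -> V).
Hypotheses (cS : closed_subspace ip H S) (hT : contraction_pair T Ts).

Lemma contraction_pairC : contraction_pair Ts T.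
Proof.
have [cT cTs E] := hT; split => // f g Hf Hg.
have [[iT _ _] _] := cT; have [[iTs _ _] _] := cTs.
by rewrite (ip_conj hH Hg (iTs _ Hf)) -E // -ip_conj //; exact: iT.
Qed.

Lemma compression_contraction : is_contraction ip S (compression ip S T).
Proof.
have [SH S0 SL _] := cS; have [[[iT LT _] cT] _ _] := hT.
have le f : S f -> hnorm ip (compression ip S T f) <= hnorm ip f.
  by move=> /SH Hf; apply: le_trans (orthoproj_le cS (iT _ Hf)) (cT _ Hf).
split => //; split.
- by move=> f /SH /iT Hf; case: (orthoprojP cS Hf).
- move=> c f g /SH Hf /SH Hg; rewrite /compression LT // orthoproj_linear //; exact: iT.
- by exists 1 => f; rewrite mul1r; exact: le.
Qed.

(** The projection [P] onto [S] is self-adjoint and fixes [S]: for [f] in [S], [ip (P T f) g = ip (T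
    f) g = ip f (Ts g) = ip f (P Ts g)]. *)
Lemma adjoint_compression g : S g ->
  adjoint ip S (compression ip S T) g = compression ip S Ts g.
Proof.
move=> Sg; have [SH _ _ _] := cS; have [[[iT _ _] _] [[iTs _ _] _] E] := hT.
have Hg := SH _ Sg; have [SP PE] := orthoprojP cS (iTs _ Hg).
apply: adjoint_uniq => //; first exact: closed_subspaceW.
move=> f Sf; have Hf := SH _ Sf; have [SQ QE] := orthoprojP cS (iT _ Hf).
rewrite QE // E // (ip_conj hH (iTs _ Hg) Hf) -PE // -ip_conj //; exact: SH.
Qed.

Lemma compression_invariant f : invariant_under S T -> S f ->
  compression ip S T f = T f.
Proof. by move=> iS Sf; apply: orthoproj_id => //; exact: iS. Qed.

End Compression.

Lemma iter_compression_invariant S (T : V -> V) m f :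
  closed_subspace ip H S -> invariant_under S T -> S f ->
  iter m (compression ip S T) f = iter m T f /\ S (iter m T f).
Proof.
move=> cS iS Sf; elim: m => [|m [IHm Sm]] //=; split; last exact: iS.
by rewrite IHm compression_invariant.
Qed.

(* If S is invariant under the adjoint of T, then P T P = P T. *)
Lemma iter_compression_coinvariant S (T Ts : V -> V) m f :
  closed_subspace ip H S -> contraction_pair T Ts -> invariant_under S Ts ->
  S f -> iter m (compression ip S T) f = orthoproj ip S (iter m T f).
Proof.
move=> cS hT iS Sf; have [SH _ _ _] := cS; have [[[iT _ _] _] _ E] := hT.
have Hm p : H (iter p T f) by elim: p => [|p IHp]; [exact: SH | exact: iT].
elim: m => [|m IHm] /=; first by rewrite orthoproj_id.
rewrite IHm; have [SP PE] := orthoprojP cS (Hm m).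
have [SQ QE] := orthoprojP cS (iT _ (Hm m)).
apply: orthoproj_uniq => // [|h Sh]; first exact/iT/SH.
rewrite QE // !E //; try exact: SH.
by rewrite PE //; exact: iS.
Qed.

(** The commutator of two contractions is linear with bound 2, so [span_ext] applies to it. *)
Lemma commute_span (G S : set V) (A B : V -> V) :
  G `<=` H -> S = hclosure ip H (lin_span G) ->
  is_contraction ip S A -> is_contraction ip S B ->
  (forall f, G f -> A (B f) = B (A f)) -> forall f, S f -> A (B f) = B (A f).
Proof.
move=> GH hS [[iA LA _] cA] [[iB LB _] cB] E f Sf.
have cS := span_closed GH hS; have [SH _ _ _] := cS.
have sS := closed_subspaceW cS.
apply/eqP; rewrite -subr_eq0; apply/eqP; move: f Sf.
apply: (@span_ext G S GH hS _ 2).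
- by move=> f Sf; apply: HB; apply: SH; [apply/iA/iB | apply/iB/iA].
- move=> c f g Sf Sg; rewrite (LB _ _ _ Sf Sg) (LA _ _ _ (iB _ Sf) (iB _ Sg)).
  rewrite (LA _ _ _ Sf Sg) (LB _ _ _ (iA _ Sf) (iA _ Sg)).
  by rewrite opprD addrACA scalerBr.
- move=> f Sf.
  have H1 : H (A (B f)) by apply/SH/iA/iB.
  have H2 : H (B (A f)) by apply/SH/iB/iA.
  rewrite -scaleN1r; apply: le_trans (hnormT H1 (HZ _ H2)) _.
  rewrite hnormZ // normc_opp normc1 mul1r [2]mulr2n mulrDl mul1r lerD //.
    exact: le_trans (cA _ (iB _ Sf)) (cB _ Sf).
  exact: le_trans (cB _ (iA _ Sf)) (cA _ Sf).
- by move=> f Gf; rewrite E // subrr.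
Qed.

End Hilbert.

(** * Parseval's identity on the torus *)

Section Torus.
Variable R : realType.

Definition cis (x : R) : R[i] := cos x +i* sin x.

Lemma cis0 : cis 0 = 1.
Proof. by rewrite /cis cos0 sin0. Qed.

Lemma cisD (x y : R) : cis (x + y) = cis x * cis y.
Proof.
apply: ReIm_eq; rewrite /cis /= ?cosD ?sinD //.
by rewrite [cos x * sin y]mulrC addrC.
Qed.

Lemma cisMn (x : R) n : cis x ^+ n = cis (n%:R * x).
Proof.
elim: n => [|n IHn]; first by rewrite expr0 mul0r cis0.
by rewrite exprS IHn -cisD -natr1 mulrDl mul1r addrC.
Qed.

Lemma cis_conj (x : R) : (cis x)^* = cis (- x).
Proof. by rewrite /cis cosN sinN. Qed.

Lemma normc_cis (x : R) : normc (cis x) = 1.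
Proof. by rewrite /normc /= cos2Dsin2 sqrtr1. Qed.

Lemma cis_sum (I : Type) (s : seq I) (P : pred I) (F : I -> R) :
  cis (\sum_(i <- s | P i) F i) = \prod_(i <- s | P i) cis (F i).
Proof. by apply: big_morph; [exact: cisD | exact: cis0]. Qed.

Lemma sin_period (x : R) (n : nat) : sin (x + n%:R * (2 * pi)) = sin x.
Proof.
elim: n => [|n IHn]; first by rewrite mul0r addr0.
rewrite -natr1 mulrDl mul1r addrA sinD IHn.
by rewrite mulr_natl cos2pi sin2pi mulr0 mulr1 addr0.
Qed.

(** Orthogonality of the characters of the circle. The phase [phi] absorbs the other angles in the
    induction on their number, and [phi = pi / 2] covers sines. *)
Lemma integral_uniform_cos (a b : nat) (phi : R) :
  (\int[uniform_prob (two_pi_gt0 R)]_t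
     (cos (phi + (a%:R - b%:R) * t))%:E = (if a == b then cos phi else 0)%:E)%E.
Proof.
set c : R := a%:R - b%:R.
have P1 : uniform_prob (two_pi_gt0 R) setT = 1%E by exact: probability_setT.
have mcos : measurable_fun setT (fun t : R => cos (phi + c * t)).
  apply: (measurableT_comp (continuous_measurable_fun (@continuous_cos R))).
  apply: measurable_funD => //; exact: measurable_funM.
have [ab|ab] := eqVneq a b.
  have c0 : c = 0 by rewrite /c ab subrr.
  under eq_integral do rewrite c0 mul0r addr0.
  by rewrite integral_cst // [X in (_ * X)%E](_ : _ = 1%E) ?mule1.
have c0 : c != 0.
  by rewrite /c subr_eq0 eqr_nat.
have intc : (uniform_prob (two_pi_gt0 R)).-integrable setT (EFin \o (fun t : R => cos (phi + c * t))).
  apply: measurable_bounded_integrable => //.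
    by rewrite -ge0_fin_numE // fin_num_measure.
  exists 1; split => // M M1 t _ /=; apply: le_trans (ltW M1).
  by rewrite ler_norml cos_geN1 cos_le1.
have int1 : (uniform_prob (two_pi_gt0 R)).-integrable setT (EFin \o (fun t : R => 1 : R)).
  exact: finite_measure_integrable_cst.
(* [integral_uniform] is applied to a nonnegative integrand, so 1 is added to the cosine and its
   mean, again 1, is removed. *)
suff : (\int[uniform_prob (two_pi_gt0 R)]_t (1 + cos (phi + c * t))%:E = 1)%E.
  under eq_integral do rewrite EFinD.
  rewrite integralD // integral_cst // [X in (_ * X)%E](_ : _ = 1%E) ?mule1 //.
  have fin := integrable_fin_num measurableT intc.
  rewrite -[X in (_ + X)%E](fineK fin) -EFinD => -[h].
  by rewrite -[LHS](fineK fin); congr EFin; apply: (addrI 1); rewrite addr0.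
rewrite integral_uniform; last 2 first.
- by apply/measurable_EFinP/measurable_funD.
- by move=> t; rewrite lee_fin -lerBlDl sub0r cos_geN1.
pose F (t : R) := t + c^-1 * sin (phi + c * t).
have dF (t : R) : is_derive t 1 F (1 + cos (phi + c * t)).
  rewrite /F; apply: is_derive_eq.
  rewrite add0r mul1r; congr (_ + _).
  transitivity (c^-1 * (cos (phi + c * t) * (c * 1))) => //.
  by rewrite mulr1 mulrCA mulVf // mulr1.
have cF : continuous F by move=> t; apply/differentiable_continuous/derivable1_diffP; exact: ex_derive.
have cf : continuous (fun t => 1 + cos (phi + c * t)).
  move=> t; apply: cvgD; first exact: cvg_cst.
  apply: (continuous_comp (f := fun t => phi + c * t)); last exact: continuous_cos.
  by apply: cvgD; [exact: cvg_cst | apply: cvgM; [exact: cvg_cst | exact: cvg_id]].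
have -> := @continuous_FTC2 R (fun t => 1 + cos (phi + c * t)) F 0 (2 * pi) (two_pi_gt0 R).
- rewrite /F mulr0 addr0 add0r [c * _](_ : _ = a%:R * (2 * pi) - b%:R * (2 * pi)); last by rewrite mulrBl.
  (* [sin_period] shifts by natural multiples of the period only, so the shift by [- b] periods is
     first undone by adding [b] of them. *)
  rewrite -[sin (phi + (_ - _))](sin_period _ b) addrA subrK sin_period.
  by rewrite -EFinB addrK subr0 -EFinM mulVf // gt_eqF // two_pi_gt0.
- exact: continuous_subspaceT.
- split => [x _||].
  + exact: ex_derive.
  + exact/cvg_at_right_filter/cF.
  + exact/cvg_at_left_filter/cF.
- by move=> x _; rewrite derive1E derive_val.
Qed.

Lemma measurable_angle k j : measurable_fun setT (fun t : ps_type (angles R k) => angle t j).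
Proof.
elim: k j => [|k IHk] j /=; first exact: measurable_cst.
case: j => [|j]; first exact: measurable_fst.
exact: (measurableT_comp (IHk j) measurable_snd).
Qed.

Definition phase k (a b : 'I_k -> nat) (t : ps_type (angles R k)) : R :=
  \sum_(j < k) ((a j)%:R - (b j)%:R) * angle t j.

Lemma measurable_phase k a b : measurable_fun setT (@phase k a b).
Proof.
apply: measurable_sum => j; apply: measurable_funM => //.
exact: measurable_angle.
Qed.

Lemma measurable_cos_phase k a b phi :
  measurable_fun setT (fun t => cos (phi + @phase k a b t)).
Proof.
apply: (measurableT_comp (continuous_measurable_fun (@continuous_cos R))).
by apply: measurable_funD => //; exact: measurable_phase.
Qed.

Lemma integrable_bounded k (f : ps_type (angles R k) -> R) (M : R) :
  measurable_fun setT f -> (forall t, `|f t| <= M) ->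
  (ps_prob (angles R k)).-integrable setT (EFin \o f).
Proof.
move=> mf fM; apply: measurable_bounded_integrable => //.
  by rewrite -ge0_fin_numE // fin_num_measure.
by exists M; split; [exact: num_real | move=> N MN t _ /=; apply: le_trans (ltW MN)].
Qed.

Lemma integrable_cos_phase k a b phi :
  (ps_prob (angles R k)).-integrable setT (EFin \o fun t => cos (phi + phase a b t)).
Proof.
apply: (@integrable_bounded _ _ 1); first exact: measurable_cos_phase.
by move=> t; rewrite ler_norml cos_geN1 cos_le1.
Qed.

(** Fubini in the first angle: when it is fixed, its contribution joins [phi], and the induction
    hypothesis evaluates the integral over the other angles. *)
Lemma integral_cos_phase k a b phi :
  (\int[ps_prob (angles R k)]_t (cos (phi + phase a b t))%:E =
   (if [forall j : 'I_k, a j == b j] then cos phi else 0)%:E)%E.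
Proof.
elim: k a b phi => [|k IHk] a b phi.
  under eq_integral do rewrite /phase big_ord0 addr0.
  rewrite integral_cst //= (_ : dirac tt setT = 1%E) ?mule1; last by rewrite diracT.
  by case: ifPn => // /forallPn[[]].
have := integrable_cos_phase a b phi.
rewrite /= => intf; rewrite -integral12_prod_meas1 //.
pose a' j := a (lift ord0 j); pose b' j := b (lift ord0 j).
have E (x : R) : (\int[ps_prob (angles R k)]_y
   (cos (phi + @phase k.+1 a b (x, y)))%:E = (if [forall j : 'I_k, a' j == b' j] then
    cos (phi + ((a ord0)%:R - (b ord0)%:R) * x) else 0)%:E)%E.
  rewrite -IHk; apply: eq_integral => y _; congr (cos _)%:E.
  by rewrite /phase big_ord_recl /= addrA.
rewrite /fubini_F; under eq_integral do rewrite /= E.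
have -> : [forall j : 'I_k.+1, a j == b j] = (a ord0 == b ord0) && [forall j : 'I_k, a' j == b' j].
  apply/forallP/andP => [h|[h0 /forallP h] j].
    by split; [exact: (h ord0) | apply/forallP => j; exact: (h (lift ord0 j))].
  by case: (unliftP ord0 j) => [i ->|-> //]; exact: h.
case: [forall j : 'I_k, a' j == b' j]; last by rewrite andbF integral0_eq.
by rewrite andbT integral_uniform_cos.
Qed.

Lemma torus_monom k (a : multi_index k) t :
  monom a (torus_pt (R:=R) t) = cis (\sum_(j < k) (a j)%:R * angle t j).
Proof.
rewrite cis_sum; apply: eq_bigr => j _.
by rewrite /torus_pt mxE -/(cis _) cisMn.
Qed.

End Torus.

Section Exhaustion.
Variables (R : realType) (I : countType).

(** Dominated convergence takes sequences, while [hsum] runs over all finite sets; these initial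
    segments of an enumeration eventually contain each finite set. *)
Definition exhaust (n : nat) : {fset I} := [fset a in pmap choice.unpickle (iota 0 n)]%fset.

Lemma exhaust_cover (A : {fset I}) :
  exists N, forall n, (N <= n)%N -> (A `<=` exhaust n)%fset.
Proof.
exists (\max_(a <- A) choice.pickle a).+1 => n hn; apply/fsubsetP => a aA.
rewrite !inE /= mem_pmap; apply/mapP; exists (choice.pickle a); last by rewrite choice.pickleK.
rewrite mem_iota /= add0n; apply: leq_trans hn; rewrite ltnS.
exact: (@leq_bigmax_seq _ _ xpredT).
Qed.

Lemma hsum_exhaust (F : I -> R[i]) s : hsum F s -> forall e : R, 0 < e ->
  exists N, forall n, (N <= n)%N -> normc (\sum_(a <- exhaust n) F a - s) < e.
Proof.
move=> hs e e0; have [J0 h0] := hs _ e0; have [N hN] := exhaust_cover J0.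
by exists N => n /hN /h0.
Qed.

Lemma hsum_exhaust_cvg (f : I -> R) (s : R) : hsum (fun a => (f a)%:C) s%:C ->
  \sum_(a <- exhaust n) f a @[n --> \oo] --> s.
Proof.
move=> hs; apply/cvgrPdist_lt => e e0; have [N hN] := hsum_exhaust hs e0.
exists N => // n /= /hN; rewrite -rmorph_sum -rmorphB normcC distrC.
by apply: le_lt_trans.
Qed.

End Exhaustion.

(** * Means of bounded measurable functions over the torus *)

Section TorusMean.
Variables (R : realType) (k : nat).
Local Notation T := (ps_type (angles R k)).
Local Notation P := (ps_prob (angles R k)).
Implicit Types f g : T -> R.

Definition bmeas f : Prop :=
  measurable_fun setT f /\ exists M, forall t, `|f t| <= M.

Definition tmean f : R := \int[P]_t f t.

Lemma bmeas_integrable f : bmeas f -> P.-integrable setT (EFin \o f).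
Proof. by move=> [mf [M hM]]; exact: integrable_bounded hM. Qed.

Lemma bmeas_cst (c : R) : bmeas (fun=> c).
Proof. by split; [exact: measurable_cst | exists `|c|]. Qed.

Lemma bmeasD f g : bmeas f -> bmeas g -> bmeas (fun t => f t + g t).
Proof.
move=> [mf [M hM]] [mg [N hN]]; split; first exact: measurable_funD.
by exists (M + N) => t; apply: le_trans (ler_normD _ _) (lerD _ _).
Qed.

Lemma bmeasM f g : bmeas f -> bmeas g -> bmeas (fun t => f t * g t).
Proof.
move=> [mf [M hM]] [mg [N hN]]; split; first exact: measurable_funM.
by exists (M * N) => t; rewrite normrM ler_pM.
Qed.

Lemma bmeas_sum (I : Type) (s : seq I) (F : I -> T -> R) :
  (forall i, bmeas (F i)) -> bmeas (fun t => \sum_(i <- s) F i t).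
Proof.
move=> hF; elim: s => [|i s IHs].
  by under eq_fun do rewrite big_nil; exact: bmeas_cst.
by under eq_fun do rewrite big_cons; exact: bmeasD.
Qed.

Lemma tmean_cst (c : R) : tmean (fun=> c) = c.
Proof.
rewrite /tmean Rintegral_cst // [X in fine X](_ : _ = 1%E) ?mulr1 //.
exact: probability_setT.
Qed.

Lemma tmeanD f g : bmeas f -> bmeas g ->
  tmean (fun t => f t + g t) = tmean f + tmean g.
Proof. by move=> bf bg; apply: RintegralD => //; exact: bmeas_integrable. Qed.

Lemma tmeanZ c f : bmeas f -> tmean (fun t => c * f t) = c * tmean f.
Proof. by move=> bf; apply: RintegralZl => //; exact: bmeas_integrable. Qed.

Lemma tmean_sum (I : Type) (s : seq I) (F : I -> T -> R) :
  (forall i, bmeas (F i)) ->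
  tmean (fun t => \sum_(i <- s) F i t) = \sum_(i <- s) tmean (F i).
Proof.
move=> hF; elim: s => [|i s IHs].
  by under eq_fun do rewrite big_nil; rewrite big_nil tmean_cst.
under eq_fun do rewrite big_cons; rewrite big_cons -IHs tmeanD //.
exact: bmeas_sum.
Qed.

Lemma tmean_le f g : bmeas f -> bmeas g -> (forall t, f t <= g t) ->
  tmean f <= tmean g.
Proof.
by move=> bf bg fg; apply: le_Rintegral => //; exact: bmeas_integrable.
Qed.

(** Dominated convergence: the measure is finite, so the constant [M] is an integrable bound. *)
Lemma tmean_cvg (f_ : nat -> T -> R) f M :
  (forall n, measurable_fun setT (f_ n)) -> measurable_fun setT f ->
  (forall n t, `|f_ n t| <= M) ->
  {ae P, forall t, f_ n t @[n --> \oo] --> f t} ->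
  tmean (f_ n) @[n --> \oo] --> tmean f.
Proof.
move=> mf_ mf hM hcvg.
have [|||||i1 _ i2] := @dominated_convergence _ T R P setT measurableT
  (fun n t => (f_ n t)%:E) (EFin \o f) (fun=> M%:E).
- by move=> n; apply/measurable_EFinP.
- exact/measurable_EFinP.
- by apply: filterS hcvg => t ht _; apply: cvg_EFin; [exact: nearW | exact: ht].
- exact: finite_measure_integrable_cst.
- by apply: aeW => t n _; rewrite lee_fin.
apply: (fine_cvg (f := fun n => (\int[P]_t (f_ n t)%:E)%E)).
rewrite fineK; first exact: i2.
exact: integrable_fin_num.
Qed.

End TorusMean.

Section Parseval.
Variables (R : realType) (k : nat).
Local Notation T := (ps_type (angles R k)).
Local Notation P := (ps_prob (angles R k)).
Implicit Types (c : multi_index k -> R[i]) (a b : multi_index k).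

Definition tmonom a (t : T) : R[i] := monom a (torus_pt t).

Lemma normc_tmonom a t : normc (tmonom a t) = 1.
Proof. by rewrite /tmonom torus_monom normc_cis. Qed.

Lemma tmonomMJ a b t : tmonom a t * (tmonom b t)^* = cis (phase a b t).
Proof.
rewrite /tmonom !torus_monom cis_conj -cisD -sumrB; congr cis.
by apply: eq_bigr => j _; rewrite mulrBl.
Qed.

(** Means are real integrals. This splits the real part of a character with a complex coefficient
    into the shifted cosines of [integral_cos_phase]. *)
Lemma Re_mul_cis (w : R[i]) (x : R) :
  Re (w * cis x) = Re w * cos (0 + x) + Im w * cos (pi / 2 + x).
Proof.
by case: w => a b; rewrite /cis /= add0r [pi / 2 + x]addrC cosDpihalf mulrN.
Qed.

Lemma bmeas_cos_phase (f g : 'I_k -> nat) (x : R) : bmeas (fun t : T => cos (x + phase f g t)).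
Proof.
split; first exact: measurable_cos_phase.
by exists 1 => t; rewrite ler_norml cos_geN1 cos_le1.
Qed.

Lemma bmeas_Re_cis (w : R[i]) a b : bmeas (fun t : T => Re (w * cis (phase a b t))).
Proof.
under eq_fun do rewrite Re_mul_cis.
by apply: bmeasD; apply: bmeasM; (try exact: bmeas_cst); exact: bmeas_cos_phase.
Qed.

Lemma tmean_cos_phase a b (x : R) :
  tmean (fun t : T => cos (x + phase a b t)) = if a == b then cos x else 0.
Proof.
rewrite /tmean /Rintegral integral_cos_phase /=.
suff -> : [forall j, a j == b j] = (a == b) by [].
by apply/forallP/eqP => [h|-> //]; apply/ffunP => j; exact/eqP.
Qed.

Lemma tmean_Re_cis (w : R[i]) a b :
  tmean (fun t : T => Re (w * cis (phase a b t))) = if a == b then Re w else 0.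
Proof.
under eq_fun do rewrite Re_mul_cis.
rewrite tmeanD ?tmeanZ; try exact: bmeas_cos_phase.
- rewrite !tmean_cos_phase cos0 cos_pihalf; case: eqP => _; last by rewrite !mulr0 addr0.
  by rewrite mulr1 mulr0 addr0.
- by apply: bmeasM; [exact: bmeas_cst | exact: bmeas_cos_phase].
- by apply: bmeasM; [exact: bmeas_cst | exact: bmeas_cos_phase].
Qed.

Lemma normc_sum_sqr (J : {fset multi_index k}) c t :
  normc (\sum_(a <- J) c a * tmonom a t) ^+ 2 =
  \sum_(a <- J) \sum_(b <- J) Re (c a * (c b)^* * cis (phase a b t)).
Proof.
rewrite -Re_mulJ conj_sum mulr_suml Re_sum; apply: eq_bigr => a _.
rewrite mulr_sumr Re_sum; apply: eq_bigr => b _.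
by rewrite conjM mulrACA tmonomMJ.
Qed.

Lemma bmeas_normc_sum (J : {fset multi_index k}) c :
  bmeas (fun t : T => normc (\sum_(a <- J) c a * tmonom a t) ^+ 2).
Proof.
under eq_fun do rewrite normc_sum_sqr.
by apply: bmeas_sum => a; apply: bmeas_sum => b; exact: bmeas_Re_cis.
Qed.

(** In the double sum for the square, only the diagonal survives the mean. *)
Lemma parseval_fin (J : {fset multi_index k}) c :
  tmean (fun t : T => normc (\sum_(a <- J) c a * tmonom a t) ^+ 2) =
  \sum_(a <- J) normc (c a) ^+ 2.
Proof.
under eq_fun do rewrite normc_sum_sqr.
rewrite tmean_sum; last by move=> a; apply: bmeas_sum => b; exact: bmeas_Re_cis.
rewrite big_seq [RHS]big_seq; apply: eq_bigr => a aJ.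
rewrite tmean_sum; last by move=> b; exact: bmeas_Re_cis.
rewrite (big_fsetD1 a) //= tmean_Re_cis eqxx Re_mulJ big1_fset ?addr0 //.
by move=> b; rewrite !inE => /andP[/negbTE ba _] _; rewrite tmean_Re_cis eq_sym ba.
Qed.

Lemma sqr_cvg_normc (u : nat -> R[i]) (s : R[i]) :
  (forall e : R, 0 < e -> exists N, forall n, (N <= n)%N -> normc (u n - s) < e) ->
  normc (u n) ^+ 2 @[n --> \oo] --> normc s ^+ 2.
Proof.
move=> h; suff hn : normc (u n) @[n --> \oo] --> normc s by apply: cvgM.
apply/cvgrPdist_lt => e e0; have [N hN] := h e e0; exists N => // n /= /hN.
by apply: le_lt_trans; rewrite distrC normc_dist.
Qed.

Section Series.
Variables (c : multi_index k -> R[i]) (F : T -> R[i]) (B : R).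
Hypotheses (cB : forall J : {fset multi_index k}, \sum_(a <- J) normc (c a) <= B).
Hypothesis cF : forall t, hsum (fun a => c a * tmonom a t) (F t).

Lemma normc_partial_le (J : {fset multi_index k}) t :
  normc (\sum_(a <- J) c a * tmonom a t) <= B.
Proof.
apply: le_trans (normc_sum _ _ _) (le_trans _ (cB J)).
by apply: ler_sum => a _; rewrite normcM normc_tmonom mulr1.
Qed.

Lemma partial_sqr_cvg t :
  normc (\sum_(a <- exhaust _ n) c a * tmonom a t) ^+ 2 @[n --> \oo] --> normc (F t) ^+ 2.
Proof. by apply: sqr_cvg_normc; exact: hsum_exhaust. Qed.

Lemma bmeas_series : bmeas (fun t => normc (F t) ^+ 2).
Proof.
split.
  apply: (@measurable_fun_cvg _ _ _ _
    (fun n t => normc (\sum_(a <- exhaust _ n) c a * tmonom a t) ^+ 2)).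
    by move=> n; case: (bmeas_normc_sum (exhaust _ n) c).
  by move=> t _; exact: partial_sqr_cvg.
exists (B ^+ 2) => t; rewrite ger0_norm ?sqr_ge0 // ler_pXn2r ?nnegrE ?normc_ge0 //.
  apply: (hsum_le (cF t)) => J; exact: normc_partial_le.
by have := cB fset0; rewrite big_seq_fset0.
Qed.

(** Pass to the limit along [exhaust] in [parseval_fin]; the squared partial sums are bounded by
    [B ^+ 2] uniformly on the torus. *)
Lemma parseval : hsum (fun a => (normc (c a) ^+ 2)%:C) (tmean (fun t => normc (F t) ^+ 2))%:C.
Proof.
have B0 : 0 <= B by have := cB fset0; rewrite big_seq_fset0.
have [|J|s hs] := @nneg_hsum _ _ (fun a => normc (c a) ^+ 2) (B * B).
- by move=> a; exact: sqr_ge0.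
- apply: (@le_trans _ _ (\sum_(a <- J) B * normc (c a))).
    apply: ler_sum => a _; rewrite expr2 ler_wpM2r ?normc_ge0 //.
    by have := cB [fset a]%fset; rewrite big_seq_fset1.
  by rewrite -mulr_sumr ler_wpM2l.
suff -> : tmean (fun t => normc (F t) ^+ 2) = s by [].
have h1 := hsum_exhaust_cvg hs.
have h2 : tmean (fun t => normc (\sum_(a <- exhaust _ n) c a * tmonom a t) ^+ 2) @[n --> \oo]
    --> tmean (fun t => normc (F t) ^+ 2).
  apply: (@tmean_cvg _ _ _ _ (B ^+ 2)).
  - by move=> n; case: (bmeas_normc_sum (exhaust _ n) c).
  - by case: bmeas_series.
  - move=> n t; rewrite ger0_norm ?sqr_ge0 // ler_pXn2r ?nnegrE ?normc_ge0 //.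
    exact: normc_partial_le.
  - by apply: aeW => t; exact: partial_sqr_cvg.
move: h2; under eq_fun do rewrite parseval_fin; move=> h2.
exact: (cvg_unique _ h2 h1).
Qed.

End Series.

End Parseval.

(** * Power series and global Taylor expansions *)

Section PowerSeries.
Variables (R : realType) (n : nat).
Local Notation I := (multi_index n).
Implicit Types (c d : I -> R[i]) (a b p q : I) (u v w z : 'rV[R[i]]_n) (r s : R) (S : R[i]).

Definition deg a : nat := \sum_(j < n) a j.

Definition addm a b : I := [ffun j => (a j + b j)%N].
Definition subm a b : I := [ffun j => (a j - b j)%N].
Definition binm a b : nat := \prod_(j < n) 'C(a j, b j).

Definition bounded_by z r : Prop := forall j, normc (z 0 j) <= r.

Definition psum c z S : Prop := hsum (fun a => c a * monom a z) S.

(** Absolute convergence at the point [(r, ..., r)], which dominates the series on the closed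
    polydisc of radius [r] ([abs_conv_absum]). *)
Definition abs_conv c r : Prop := absum (fun a => c a * (r ^+ deg a)%:C).

Lemma monomZ (x : R[i]) z a : monom a (x *: z) = x ^+ deg a * monom a z.
Proof.
rewrite /monom -prodrXr -big_split /=; apply: eq_bigr => j _.
by rewrite mxE exprMn.
Qed.

Lemma monom_const (x : R[i]) a : monom a (const_mx x) = x ^+ deg a.
Proof. by rewrite /monom -prodrXr; apply: eq_bigr => j _; rewrite mxE. Qed.

Lemma normc_monom a z : normc (monom a z) = \prod_(j < n) normc (z 0 j) ^+ a j.
Proof. by rewrite normc_prod; apply: eq_bigr => j _; rewrite normcX. Qed.

Lemma normc_monom_le a z r : bounded_by z r -> normc (monom a z) <= r ^+ deg a.
Proof.
move=> zr; rewrite normc_monom /deg -prodrXr; apply: ler_prod => j _.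
by rewrite exprn_ge0 ?normc_ge0 //= lerXn2r // nnegrE ?normc_ge0 // (le_trans _ (zr j)) // normc_ge0.
Qed.

Lemma bounded_by_const r : 0 <= r -> bounded_by (const_mx r%:C) r.
Proof. by move=> r0 j; rewrite mxE normcC ger0_norm. Qed.

Lemma bounded_byZ (x : R) z r : bounded_by z r -> bounded_by (x%:C *: z) (`|x| * r).
Proof. by move=> zr j; rewrite mxE normcM normcC ler_wpM2l. Qed.

Lemma bounded_byD z w r s : bounded_by z r -> bounded_by w s -> bounded_by (z + w) (r + s).
Proof. by move=> zr ws j; rewrite mxE; apply: le_trans (normcT _ _) (lerD _ _). Qed.

Lemma bounded_byW z r s : r <= s -> bounded_by z r -> bounded_by z s.
Proof. by move=> rs zr j; exact: le_trans (zr j) rs. Qed.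

Lemma bounded_by_torus (t : ps_type (angles R n)) : bounded_by (torus_pt t) 1.
Proof. by move=> j; rewrite mxE -/(cis _) normc_cis. Qed.

Lemma monom_torus r a (t : ps_type (angles R n)) :
  monom a (r%:C *: torus_pt t) = (r ^+ deg a)%:C * tmonom a t.
Proof. by rewrite monomZ rmorphXn. Qed.

Lemma abs_conv_absum c r z : abs_conv c r -> bounded_by z r ->
  absum (fun a => c a * monom a z).
Proof.
move=> hc zr; apply: absum_le hc => a.
rewrite !normcM normcC ler_wpM2l ?normc_ge0 //.
by apply: le_trans (normc_monom_le a zr) (ler_norm _).
Qed.

Lemma psum_abs_conv c r S : psum c (const_mx r%:C) S -> abs_conv c r.
Proof.
move=> /hsum_absum; apply: absum_le => a.
by rewrite monom_const rmorphXn.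
Qed.

Lemma abs_convW c r s : 0 <= s -> s <= r -> abs_conv c r -> abs_conv c s.
Proof.
move=> s0 sr hc; have := abs_conv_absum hc (bounded_byW sr (bounded_by_const s0)).
by apply: absum_le => a; rewrite monom_const rmorphXn.
Qed.

Lemma abs_conv_psum c r z : abs_conv c r -> bounded_by z r -> exists S, psum c z S.
Proof. by move=> hc zr; apply: absum_hsum; exact: abs_conv_absum zr. Qed.

(* Cauchy's estimates follow from Parseval's identity. *)
Lemma cauchy_estimate c r M : 0 <= r -> 0 <= M -> abs_conv c r ->
  (forall t : ps_type (angles R n), exists2 s, psum c (r%:C *: torus_pt t) s & normc s <= M) ->
  forall a, normc (c a) * r ^+ deg a <= M.
Proof.
move=> r0 M0 [B hB] hc a; pose c' a := c a * (r ^+ deg a)%:C.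
have /choice[F hF] t : exists S, psum c (r%:C *: torus_pt t) S /\ normc S <= M.
  by have [s] := hc t; exists s.
have cF t : hsum (fun a => c' a * tmonom a t) (F t).
  have [h _] := hF t; move: h; congr (hsum _ _); apply/funext => b.
  by rewrite monom_torus mulrA.
have hp := parseval hB cF.
have := @hsum_ge _ _ (fun a => normc (c' a) ^+ 2) _ [fset a]%fset (fun=> sqr_ge0 _) hp.
rewrite big_seq_fset1 => /le_trans h.
have : normc (c' a) ^+ 2 <= M ^+ 2.
  apply: h; rewrite -[leRHS](tmean_cst n); apply: tmean_le.
  - exact: bmeas_series hB cF.
  - exact: bmeas_cst.
  - by move=> t; rewrite ler_pXn2r ?nnegrE ?normc_ge0 //; case: (hF t).
by rewrite ler_pXn2r ?nnegrE ?normc_ge0 // normcM normcC ger0_norm // exprn_ge0.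
Qed.

(** Cauchy's estimate with the bound 0, for the difference of the two series. *)
Lemma psum_uniq c d r : 0 < r -> abs_conv c r -> abs_conv d r ->
  (forall z, bounded_by z r -> exists2 s, psum c z s & psum d z s) -> c = d.
Proof.
move=> r0 hc hd h; apply/funext => a; apply/eqP; rewrite -subr_eq0.
have hcd : abs_conv (fun a => c a - d a) r.
  have := absumD hc (absumZ (-1) hd); apply: absum_le => b.
  by rewrite mulN1r -mulrBl.
have : normc (c a - d a) * r ^+ deg a <= 0.
  apply: (cauchy_estimate (ltW r0) (lexx 0) hcd) => t; exists 0; last by rewrite normc0.
  have [|s hs ht] := h (r%:C *: torus_pt t).
    by rewrite -[r in bounded_by _ r]mulr1 -{2}(gtr0_norm r0); exact/bounded_byZ/bounded_by_torus.
  have := hsumB hs ht; rewrite subrr; congr (hsum _ _); apply/funext => b.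
  by rewrite mulrBl.
by rewrite pmulr_lle0 ?exprn_gt0 // => h0; apply/eqP/eq0_normc/eqP; rewrite eq_le h0 normc_ge0.
Qed.

Lemma mem_iota_fset (i m : nat) : (i \in [fset j in iota 0 m]%fset) = (i < m)%N.
Proof. by rewrite !inE mem_iota. Qed.

Lemma hsum_exprD (x y : R[i]) (m : nat) :
  hsum (fun i : nat => x ^+ (m - i) * y ^+ i *+ 'C(m, i)) ((x + y) ^+ m).
Proof.
rewrite exprDn -(big_mkord xpredT (fun i => x ^+ (m - i) * y ^+ i *+ 'C(m, i))).
have -> : \sum_(0 <= i < m.+1) x ^+ (m - i) * y ^+ i *+ 'C(m, i) =
  \sum_(i <- [fset i in iota 0 m.+1]%fset) x ^+ (m - i) * y ^+ i *+ 'C(m, i).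
  apply: perm_big; apply: uniq_perm; rewrite ?fset_uniq ?iota_uniq // => i.
  by rewrite mem_index_iota mem_iota_fset.
apply: hsum_fin => i; rewrite mem_iota_fset -leqNgt => mi.
by rewrite bin_small // mulr0n.
Qed.

Lemma prod_mulrn (F : 'I_n -> R[i]) (m : 'I_n -> nat) :
  \prod_(j < n) (F j *+ m j) = (\prod_(j < n) F j) *+ (\prod_(j < n) m j)%N.
Proof.
elim/big_rec3: _ => [|j x y z _ ->]; first by rewrite mulr1n.
by rewrite mulrnAl mulrnAr -mulrnA mulnC.
Qed.

(** The product over the coordinates of one-variable binomial expansions. The sum runs over all [p];
    where some entry of [p] exceeds that of [a], truncated subtraction is harmless because
    [binm a p] vanishes. *)
Lemma hsum_monomD a u v :
  hsum (fun p => monom (subm a p) u * monom p v *+ binm a p) (monom a (u + v)).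
Proof.
have := @hsum_prod_ffun R n nat (fun j i => u 0 j ^+ (a j - i) * v 0 j ^+ i *+ 'C(a j, i))
  (fun j => (u 0 j + v 0 j) ^+ a j) (fun j => hsum_exprD _ _ _).
congr (hsum _ _); last by apply: eq_bigr => j _; rewrite mxE.
apply/funext => p; rewrite prod_mulrn big_split /=; congr (_ * _ *+ _).
by apply: eq_bigr => j _; rewrite ffunE.
Qed.

Lemma hsum_binm_real a r s :
  hsum (fun p => (r ^+ deg (subm a p) * s ^+ deg p *+ binm a p)%:C) ((r + s) ^+ deg a)%:C.
Proof.
have := hsum_monomD a (const_mx r%:C) (const_mx s%:C).
have -> : const_mx r%:C + const_mx s%:C = const_mx (r + s)%:C :> 'rV[R[i]]_n.
  by apply/rowP => j; rewrite !mxE rmorphD.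
rewrite monom_const -rmorphXn; congr (hsum _ _); apply/funext => p.
by rewrite !monom_const rmorphMn rmorphM !rmorphXn.
Qed.

(** Expand each monomial at [u + v] by the binomial theorem and exchange the two sums. In moduli,
    the inner sum is at most [(r + s) ^+ deg a], so the double series converges absolutely. *)
Lemma recenter c r s u : 0 <= r -> 0 < s -> abs_conv c (r + s) -> bounded_by u r ->
  exists d, [/\ forall p, hsum (fun a => c a * (monom (subm a p) u *+ binm a p)) (d p),
    abs_conv d s & forall v S, bounded_by v s -> psum c (u + v) S -> psum d v S].
Proof.
move=> r0 s0 hc ur.
pose G v (x : I * I) := c x.1 * (monom (subm x.1 x.2) u * monom x.2 v *+ binm x.1 x.2).
have absG v : bounded_by v s -> absum (G v).
  move=> vs; have [B hB] := hc.
  apply: (@absum_pair _ _ _ _ (fun a => normc (c a * ((r + s) ^+ deg a)%:C)) B) => // a L.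
  have rs0 : 0 <= (r + s) ^+ deg a by rewrite exprn_ge0 // addr_ge0 // ltW.
  rewrite /G /= (eq_bigr (fun p => normc (c a) * normc (monom (subm a p) u * monom p v *+ binm a p))); last first.
    by move=> p _; rewrite normcM.
  rewrite -mulr_sumr normcM ler_wpM2l ?normc_ge0 // normcC ger0_norm //.
  apply: (@le_trans _ _ (\sum_(p <- L) r ^+ deg (subm a p) * s ^+ deg p *+ binm a p)).
    apply: ler_sum => p _; rewrite -mulr_natr normcM normcM -[leRHS]mulr_natr.
    rewrite (_ : normc _%:R = (binm a p)%:R); last first.
      by rewrite -(rmorph_nat (real_complex R)) normcC ger0_norm.
    rewrite ler_wpM2r // ler_pM ?normc_ge0 //; exact: normc_monom_le.
  apply: hsum_ge (hsum_binm_real a r s) => p.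
  by rewrite mulrn_wge0 // mulr_ge0 // exprn_ge0 // ltW.
have bs := bounded_by_const (ltW s0).
have sl v p : bounded_by v s -> absum (fun a => G v (a, p)).
  move=> vs; have /absum_hsum[S hS] := absG v vs.
  exact: (absum_slice p (hsum_absum (hsum_swap hS))).
have sC p : (s ^+ deg p)%:C != 0 :> R[i].
  by rewrite rmorphXn expf_neq0 // -[0]/(0%:C) (inj_eq (@complexI _)) gt_eqF.
(* Convergence of the series for [d p] is read off at [v = (s, ..., s)], where the factor
   [s ^+ deg p] is nonzero and can be divided out. *)
have /choice[d hd] p : exists e, hsum (fun a => c a * (monom (subm a p) u *+ binm a p)) e.
  have /absum_hsum[S /(hsumZ (s ^+ deg p)%:C^-1) hS] := sl _ p bs.
  exists ((s ^+ deg p)%:C^-1 * S); move: hS; congr (hsum _ _); apply/funext => a.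
  by rewrite /G /= monom_const -rmorphXn -mulrnAl [c a * _]mulrA [X in _ * X]mulrC mulKf.
have hdv v S0 : bounded_by v s -> psum c (u + v) S0 -> psum d v S0.
  move=> vs hz; have /absum_hsum[S hS] := absG v vs.
  have hcS : psum c (u + v) S.
    apply: hsum_fubini hS _ => a; exact: (hsumZ (c a) (hsum_monomD a u v)).
  rewrite (hsum_uniq hz hcS); apply: hsum_fubini (hsum_swap hS) _ => p /=.
  rewrite mulrC; have := hsumZ (monom p v) (hd p); congr (hsum _ _); apply/funext => a.
  by rewrite /G /= -mulrnAl mulrCA [monom p v * _]mulrC.
exists d; split => //.
have [S hS] : exists S, psum c (u + const_mx s%:C) S.
  by apply: (abs_conv_psum hc); exact: bounded_byD.
exact: psum_abs_conv (hdv _ _ bs hS).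
Qed.

Lemma hsum_geom (x : R) : 0 <= x < 1 -> exists S, hsum (fun i : nat => (x ^+ i)%:C) S.
Proof.
move=> /andP[x0 x1]; have [i|J|S hS] := @nneg_hsum R _ (fun i : nat => x ^+ i) ((1 - x)^-1).
- exact: exprn_ge0.
- pose N := (\max_(i <- J) i).+1.
  apply: (@le_trans _ _ (\sum_(i <- [fset i in iota 0 N]%fset) x ^+ i)).
    apply: le_sum_fset => [|i]; last exact: exprn_ge0.
    apply/fsubsetP => i iJ; rewrite mem_iota_fset ltnS.
    exact: (@leq_bigmax_seq _ _ xpredT).
  have -> : \sum_(i <- [fset i in iota 0 N]%fset) x ^+ i = \sum_(0 <= i < N) x ^+ i.
    apply: perm_big; apply: uniq_perm; rewrite ?fset_uniq ?iota_uniq // => i.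
    by rewrite mem_index_iota mem_iota_fset.
  rewrite big_mkord -[leRHS]mul1r ler_pdivlMr ?subr_gt0 // mulrC -opprB mulNr -subrX1 opprB.
  by rewrite lerBlDl lerDr exprn_ge0.
- by exists S%:C.
Qed.

Lemma absum_geom (x : R) : 0 <= x < 1 -> absum (fun a : I => (x ^+ deg a)%:C).
Proof.
move=> hx; have [S hS] := hsum_geom hx.
have := hsum_prod_ffun (fun _ : 'I_n => hS); move/hsum_absum; apply: absum_le => a.
by rewrite /deg -prodrXr rmorph_prod.
Qed.

(** Abel's lemma: comparison with the geometric series in [s / r]. *)
Lemma bounded_abs_conv c (r s M : R) : 0 <= s -> s < r ->
  (forall a, normc (c a) * r ^+ deg a <= M) -> abs_conv c s.
Proof.
move=> s0 sr hM; have r0 : 0 < r by exact: le_lt_trans sr.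
have [|B hB] := @absum_geom (s / r).
  by rewrite divr_ge0 ?(ltW r0) //= ltr_pdivrMr // mul1r.
have M0 : 0 <= M.
  by apply: le_trans (hM [ffun=> 0%N]); rewrite mulr_ge0 ?normc_ge0 // exprn_ge0 // ltW.
exists (M * B) => J; apply: (@le_trans _ _ (\sum_(a <- J) M * (s / r) ^+ deg a)).
  apply: ler_sum => a _; rewrite normcM normcC ger0_norm ?exprn_ge0 //.
  rewrite expr_div_n mulrA ler_pdivlMr ?exprn_gt0 // mulrAC ler_wpM2r ?exprn_ge0 //.
rewrite -mulr_sumr ler_wpM2l //; apply: le_trans (hB J); apply: ler_sum => a _.
by rewrite normcC ler_norm.
Qed.

End PowerSeries.

(** * From local expansions to one Taylor series on the polydisc *)

Section GlobalTaylor.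
Variables (R : realType) (n : nat).
Local Notation I := (multi_index n).
Implicit Types (c d : I -> R[i]) (a b p q : I) (u v w z : 'rV[R[i]]_n) (r s : R).

Definition in_polydisc z : Prop := forall j, normc (z 0 j) < 1.

Lemma in_polydiscP z : reflect (in_polydisc z) [forall j, `|z 0 j| < 1].
Proof.
apply: (iffP forallP) => h j; have := h j; by rewrite normrE ltcR.
Qed.

Lemma val_to_polydisc z : in_polydisc z -> val (to_polydisc z) = z.
Proof. by move=> /in_polydiscP h; rewrite /to_polydisc insubdK. Qed.

Lemma to_polydisc_val (z : polydisc R n) : to_polydisc (val z) = z.
Proof. by rewrite /to_polydisc valKd. Qed.

Lemma polydisc_in (z : polydisc R n) : in_polydisc (val z).
Proof. exact/in_polydiscP/(valP z). Qed.

Lemma max_norm z : in_polydisc z ->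
  exists r, [/\ 0 <= r, r < 1 & bounded_by z r].
Proof.
move=> hz; exists (\big[Num.max/0]_j normc (z 0 j)); split.
- by elim/big_ind: _ => // [x y x0 y0|i _]; rewrite ?le_max ?x0 ?normc_ge0.
- by elim/big_ind: _ => // [x y x0 y0]; rewrite gt_max x0.
- by move=> j; exact: (le_bigmax _ (fun j => normc (z 0 j))).
Qed.

Lemma bounded_in_polydisc z r : r < 1 -> bounded_by z r -> in_polydisc z.
Proof. by move=> r1 zr j; apply: le_lt_trans (zr j) r1. Qed.

Variables (f : dfun R n) (M : R).
Hypotheses (hf : holomorphic f) (fM : forall x : polydisc R n, normc (f x) <= M).

Let F z : R[i] := f (to_polydisc z).

(** The closed polydisc around [w] has to stay inside the unit polydisc: outside it, [F] only takes
    the default value of [f] at 0. *)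
Definition local_psum w c r : Prop := [/\ 0 < r, abs_conv c r
  & forall v, bounded_by v r -> in_polydisc (w + v) /\ psum c v (F (w + v))].

Lemma local_psumW w c r s : 0 < s -> s <= r -> local_psum w c r -> local_psum w c s.
Proof.
move=> s0 sr [r0 hc h]; split => //; first by apply: abs_convW hc => //; exact: ltW.
by move=> v vs; apply: h; exact: bounded_byW vs.
Qed.

Lemma local_psum_exists w : in_polydisc w -> exists c r, local_psum w c r.
Proof.
move=> hw; have [m [m0 m1 wm]] := max_norm hw.
have [r [c [r0 hr]]] := hf (to_polydisc w).
(* Halving [r] makes the strict inequality in [holomorphic] hold on the closed polydisc of radius
   [s], and [(1 - m) / 2] keeps that polydisc around [w] inside the unit one. *)
pose s := Num.min (r / 2) ((1 - m) / 2).
have s0 : 0 < s by rewrite lt_min !divr_gt0 // subr_gt0.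
have sr : s < r by rewrite gt_min ltr_pdivrMr // ltr_pMr // ltr1n.
have sm : m + s < 1.
  have : s <= (1 - m) / 2 by rewrite ge_min lexx orbT.
  lra.
have hs v : bounded_by v s -> in_polydisc (w + v) /\ psum c v (F (w + v)).
  move=> vs; have hwv : in_polydisc (w + v).
    by apply: bounded_in_polydisc sm _; exact: bounded_byD.
  split => //; have := hr (to_polydisc (w + v)).
  rewrite !val_to_polydisc // => h.
  have /hsum_partial_sum : psum_at c (w + v - w) (F (w + v)).
    apply: h => j; rewrite !mxE [w 0 j + _]addrC addrK.
    by apply: le_lt_trans (vs j) sr.
  by rewrite addrC addKr.
exists c, s; split => //.
have [_ h] := hs _ (bounded_by_const (ltW s0)).
exact: psum_abs_conv h.
Qed.

Lemma local_psum_shift w c r u : local_psum w c r -> bounded_by u (r / 2) ->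
  exists d, local_psum (w + u) d (r / 2).
Proof.
move=> [r0 hc h] ur; have r2 : 0 < r / 2 by rewrite divr_gt0.
have := @recenter R n c (r / 2) (r / 2) u (ltW r2) r2; rewrite -splitr.
case=> // d [_ hd hdv]; exists d; split => // v vr.
have uvr : bounded_by (u + v) r by rewrite [r]splitr; exact: bounded_byD.
by have [h1 h2] := h _ uvr; rewrite -addrA; split => //; exact: hdv.
Qed.

(** Compactness of the closed polydisc of radius [s]: if [x] admits an expansion of radius [r], all
    nearby centres share the radius [r / 2]. *)
Lemma uniform_radius s : 0 <= s -> s < 1 ->
  exists2 r, 0 < r & forall w, bounded_by w s -> exists d, local_psum w d r.
Proof.
move=> s0 s1; pose X := 'rV[R]_(n + n).
(* Separating real and imaginary parts places the closed polydisc in a real box of dimension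
   [n + n], compact as a product of segments. *)
pose pt (x : X) : 'rV[R[i]]_n := \row_j (x 0 (lshift n j) +i* x 0 (rshift n j)).
pose K := [set x : X | forall j, `[- s, s]%classic (x 0 j)].
have cK : compact K by apply: (@rV_compact R (n + n) (fun=> `[- s, s]%classic)) => j; exact: segment_compact.
pose Q (r : R) (x : X) := bounded_by (pt x) s -> exists d, local_psum (pt x) d r.
have hK : \forall r \near (0 : R)^'+, K `<=` Q r.
  have /compact_near_coveringP/(_ R (0 : R)^'+ Q) cov := cK.
  apply: cov => x Kx; have [xs|xs] := pselect (bounded_by (pt x) s); last first.
    (* The box is larger than the polydisc. A point with a coordinate of modulus above [s] has a
       neighbourhood of such points, where [Q] holds vacuously. *)
    have [j hj] : exists j, s < normc (pt x 0 j).
      by move/existsNP: xs => [j /negP]; rewrite -ltNge; exists j.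
    pose e := (normc (pt x 0 j) - s) / 2.
    have e0 : 0 < e by rewrite divr_gt0 // subr_gt0.
    exists ([set y | ball x e y], setT) => /=; first by split; [exact: nbhsx_ballx | exact: filterT].
    move=> [y r] [/= [_ xy] _] /(_ j); have h1 := xy 0 (lshift n j); have h2 := xy 0 (rshift n j).
    have : normc (pt x 0 j - pt y 0 j) < e + e.
      by apply: le_lt_trans (normc_ReIm _) _; rewrite !mxE /=; exact: ltrD.
    rewrite /e -splitr.
    have := normcT (pt y 0 j) (pt x 0 j - pt y 0 j); rewrite addrC subrK.
    by move=> *; lra.
  have [c [r hc]] := local_psum_exists (bounded_in_polydisc s1 xs).
  (* Real and imaginary parts each move by less than [r / 4], so each coordinate of the centre moves
     by at most [r / 2], as [local_psum_shift] requires. *)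
  have [r0 _ _] := hc; pose e := r / 4; have e0 : 0 < e by rewrite divr_gt0.
  exists ([set y | ball x e y], [set i | 0 < i] `&` [set i | i < r / 2]) => /=.
    split; first exact: nbhsx_ballx.
    by apply: filterI; [exact: nbhs_right_gt | by apply: nbhs_right_lt; rewrite divr_gt0].
  move=> [y i] [/= [_ xy] [/= i0 ir]] _.
  have ur : bounded_by (pt y - pt x) (r / 2).
    move=> j; have h1 := xy 0 (lshift n j); have h2 := xy 0 (rshift n j); rewrite !mxE; apply: le_trans (normc_ReIm _) _.
    rewrite /= [leRHS](_ : _ = e + e); last by rewrite /e; field.
    by rewrite distrC [X in _ + X]distrC; apply/ltW/ltrD.
  have [d hd] := local_psum_shift hc ur.
  by exists d; rewrite addrC subrK in hd; apply: local_psumW hd => //; exact: ltW.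
have : \forall r \near (0 : R)^'+, 0 < r /\ K `<=` Q r.
  by apply: (@filterI _ _ _ [set r | 0 < r] [set r | K `<=` Q r]); [exact: nbhs_right_gt | exact: hK].
move=> /filter_ex[r [r0 KQ]]; exists r => // w ws.
pose x : X := \row_j match fintype.split j with
  inl i => Re (w 0 i) | inr i => Im (w 0 i) end.
have ptx : pt x = w.
  apply/rowP => j; rewrite !mxE.
  rewrite (unsplitK (inl j) : fintype.split (lshift n j) = _).
  by rewrite (unsplitK (inr j) : fintype.split (rshift n j) = _); case: (w 0 j).
rewrite -ptx; apply: KQ; last by rewrite ptx.
move=> j /=; rewrite in_itv /= -ler_norml mxE; case: fintype.split => i.
  by apply: le_trans (normc_Re _) (ws i).
by apply: le_trans (normc_Im _) (ws i).
Qed.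

Lemma local_psum_bound w c r a : local_psum w c r -> normc (c a) * r ^+ deg a <= M.
Proof.
move=> [r0 hc h]; have M0 : 0 <= M by apply: le_trans (fM (to_polydisc 0)); exact: normc_ge0.
apply: (cauchy_estimate (ltW r0) M0 hc) => t.
have [|_ ht] := h (r%:C *: torus_pt t).
  by rewrite -[r in bounded_by _ r]mulr1 -{2}(gtr0_norm r0); exact/bounded_byZ/bounded_by_torus.
by exists (F (w + r%:C *: torus_pt t)) => //; exact: fM.
Qed.

Definition global_psum c r : Prop :=
  abs_conv c r /\ forall z, bounded_by z r -> psum c z (F z).

Lemma global_psumW c r s : 0 <= s -> s <= r -> global_psum c r -> global_psum c s.
Proof.
move=> s0 sr [hc h]; split; first exact: abs_convW hc.
by move=> z zs; apply: h; exact: bounded_byW zs.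
Qed.

Section Extension.
Variables (c : I -> R[i]) (rho rho' r : R).
Hypotheses (rho0 : 0 <= rho') (rhorho : rho' < rho) (r0 : 0 < r).
Hypothesis hc : global_psum c rho.
Hypothesis hloc : forall w, bounded_by w rho' -> exists d, local_psum w d r.

Let M0 : 0 <= M. Proof. by apply: le_trans (fM (to_polydisc 0)); exact: normc_ge0. Qed.

(** Recentring the global series at [w] gives a second expansion of [F] there, valid on the radius
    [s]; by uniqueness its coefficients are those of [d]. *)
Lemma local_coef w d : bounded_by w rho' -> local_psum w d r ->
  forall p, hsum (fun a => c a * (monom (subm a p) w *+ binm a p)) (d p).
Proof.
move=> wr [_ hd hdv]; pose s := Num.min (rho - rho') r.
have s0 : 0 < s by rewrite lt_min subr_gt0 rhorho.
have sr : s <= r by rewrite ge_min lexx orbT.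
have srho : rho' + s <= rho by rewrite -lerBrDl ge_min lexx.
have cs : abs_conv c (rho' + s).
  by apply: abs_convW srho hc.1; rewrite addr_ge0 // ltW.
have [e [he es hev]] := recenter rho0 s0 cs wr.
suff -> : d = e by [].
apply: (psum_uniq s0 (abs_convW (ltW s0) sr hd) es) => v vs.
have [_ hv] := hdv _ (bounded_byW sr vs).
exists (F (w + v)) => //; apply: hev => //; apply: hc.2.
by apply: bounded_byW srho _; exact: bounded_byD.
Qed.

Lemma addmI p : injective (fun q => addm q p).
Proof.
by move=> q q' /ffunP h; apply/ffunP => j; have := h j; rewrite !ffunE => /addIn.
Qed.

Lemma addmK p q : subm (addm q p) p = q.
Proof. by apply/ffunP => j; rewrite !ffunE addnK. Qed.

Lemma submK p a : (forall j, p j <= a j)%N -> addm (subm a p) p = a.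
Proof. by move=> h; apply/ffunP => j; rewrite !ffunE subnK. Qed.

Lemma binm0 a p : ~ (forall j, p j <= a j)%N -> binm a p = 0%N.
Proof.
move=> /existsNP[j /negP]; rewrite -ltnNge => aj.
by rewrite /binm (bigD1 j) //= bin_small.
Qed.

(* Cauchy's estimate, first for the p-th coefficient of the expansion at w, then
   for that coefficient as a power series in w. *)
Lemma double_estimate a p :
  normc (c a) * (rho' ^+ deg (subm a p) * r ^+ deg p *+ binm a p) <= M.
Proof.
have [pa|/binm0 ->] := pselect (forall j, p j <= a j)%N; last by rewrite mulr0n mulr0.
(* The coefficients of [d p] as a power series in the centre [w]: in [local_coef], only the indices
   [a = q + p] contribute. *)
pose b q := c (addm q p) * (binm (addm q p) p)%:R.
have rp : 0 < r ^+ deg p by rewrite exprn_gt0.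
have hb w : bounded_by w rho' -> exists2 S, psum b w S & normc S <= M / r ^+ deg p.
  move=> wr; have [d hd] := hloc wr; exists (d p); last first.
    by rewrite ler_pdivlMr //; exact: local_psum_bound hd.
  have := hsum_comp (@addmI p) _ (local_coef wr hd p).
  move=> h; have {h}: hsum (fun q => c (addm q p) *
     (monom (subm (addm q p) p) w *+ binm (addm q p) p)) (d p).
    apply: h => i; have [pi|/binm0 ->] := pselect (forall j, p j <= i j)%N.
      by left; exists (subm i p); rewrite submK.
    by right; rewrite mulr0n mulr0.
  congr (hsum _ _); apply/funext => q.
  by rewrite addmK /b -mulrA; congr (_ * _); rewrite mulr_natl.
have [S hS _] := hb _ (bounded_by_const rho0).
have Mr0 : 0 <= M / r ^+ deg p by rewrite divr_ge0 // ltW.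
have ht (t : ps_type (angles R n)) :
    exists2 S, psum b (rho'%:C *: torus_pt t) S & normc S <= M / r ^+ deg p.
  apply: hb; rewrite -[rho' in bounded_by _ rho']mulr1 -{2}(ger0_norm rho0).
  exact/bounded_byZ/bounded_by_torus.
have := cauchy_estimate rho0 Mr0 (psum_abs_conv hS) ht (subm a p).
rewrite /b submK // ler_pdivlMr // normcM (_ : normc _%:R = (binm a p)%:R).
  by move=> h; apply: le_trans h; rewrite -[_ * _ *+ binm a p]mulr_natl !mulrA.
by rewrite -(rmorph_nat (real_complex R)) normcC ger0_norm.
Qed.

(** Sum [double_estimate] over [p] with weights [(1 / 2) ^+ deg p]: the left side becomes the
    binomial expansion of [(rho' + r / 2) ^+ deg a], and the right side is a convergent geometric
    series. *)
Lemma coef_growth : exists M', forall a, normc (c a) * (rho' + r / 2) ^+ deg a <= M'.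
Proof.
have [|B hB] := @absum_geom R n (1 / 2); first by apply/andP; split; lra.
exists (M * B) => a; have := hsumZ (normc (c a))%:C (hsum_binm_real a rho' (r / 2)).
rewrite -rmorphM; set f1 := (fun _ => _).
have -> : f1 = (fun p => (normc (c a) * (rho' ^+ deg (subm a p) * (r / 2) ^+ deg p *+ binm a p))%:C).
  by apply/funext => p; rewrite /f1 -rmorphM.
move=> h; apply: (hsum_le_real h) => J.
apply: (@le_trans _ _ (\sum_(p <- J) M * (1 / 2) ^+ deg p)).
  apply: ler_sum => p _; apply: le_trans (ler_wpM2r _ (double_estimate a p)).
    by rewrite div1r exprMn [rho' ^+ _ * _]mulrA -mulrnAl mulrA.
  by rewrite exprn_ge0 // divr_ge0.
rewrite -mulr_sumr ler_wpM2l //; apply: le_trans (hB J); apply: ler_sum => p _.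
by rewrite normcC ler_norm.
Qed.

Lemma global_extend t : rho' < t -> t < rho' + r / 2 -> global_psum c t.
Proof.
move=> rt tr; have t0 : 0 < t by exact: le_lt_trans rt.
have [M' hM'] := coef_growth.
have ct : abs_conv c t by apply: bounded_abs_conv tr hM'; exact: ltW.
(* [z] is split along its ray: [w] lies in the polydisc of radius [rho'], where local expansions are
   available, and [v] in that of radius [t - rho'], less than [r / 2]. The local series at [w] and
   the recentred global one then have equal coefficients. *)
split => // z zt; pose w := (rho' / t)%:C *: z; pose v := (1 - rho' / t)%:C *: z.
have wv : w + v = z by rewrite -scalerDl -rmorphD /= addrC subrK scale1r.
have wr : bounded_by w rho'.
  have := bounded_byZ (rho' / t) zt; rewrite ger0_norm ?divr_ge0 ?(ltW t0) //.
  by rewrite divfK // gt_eqF.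
have vr : bounded_by v (t - rho').
  have := bounded_byZ (1 - rho' / t) zt; rewrite ger0_norm; last first.
    by rewrite subr_ge0 ler_pdivrMr // mul1r ltW.
  by rewrite mulrBl mul1r divfK // gt_eqF.
have [d hd] := hloc wr; have [_ _ hdv] := hd.
have [|_ hv] := hdv v; first by apply: bounded_byW vr; lra.
have tr0 : 0 < t - rho' by rewrite subr_gt0.
have [||e [he _ hev]] := @recenter R n c rho' (t - rho') w rho0 tr0.
- by rewrite addrC subrK.
- by [].
have ed : e = d.
  by apply/funext => p; exact: hsum_uniq (he p) (local_coef wr hd p).
have [S hS] := abs_conv_psum ct zt.
have := hev v S vr; rewrite wv => /(_ hS); rewrite ed => hS'.
by rewrite wv in hv; rewrite (hsum_uniq hv hS').
Qed.

End Extension.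

(** If the series at 0 failed to represent [F] up to some radius [m < 1], the supremum [sg] of the
    radii where it succeeds would be below 1, and a radius of local expansion common to all centres
    within [sg] would push it further. *)
Lemma global_psum_exists : exists c, forall r, 0 <= r -> r < 1 -> global_psum c r.
Proof.
have [|c [r0 [r00 hc hr0]]] := @local_psum_exists 0.
  by move=> j; rewrite mxE normc0.
exists c; have c0 : global_psum c r0.
  by split => // z /hr0[_]; rewrite add0r.
suff h m : 0 < m -> m < 1 -> global_psum c m.
  move=> r r_ge0 r1; apply: (global_psumW r_ge0 (ltW (midf_lt r1).1)).
  by apply: h; [apply: le_lt_trans (midf_lt r1).1 | exact: (midf_lt r1).2].
move=> m0 m1; apply: contrapT => nm.
pose E := [set r | 0 < r /\ global_psum c r].
have Em r : E r -> r <= m.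
  move=> [_ hr]; rewrite leNgt; apply/negP => mr; apply: nm.
  exact: global_psumW (ltW m0) (ltW mr) hr.
have Er0 : E r0 by [].
have supE : has_sup E by split; [exists r0 | exists m => r /Em].
set sg := sup E; have sg0 : 0 < sg.
  by apply: lt_le_trans r00 _; apply: sup_upper_bound.
have sgm : sg <= m by apply: sup_le_ub; [exists r0 | move=> r /Em].
have [r r_gt0 hr] := uniform_radius (ltW sg0) (le_lt_trans sgm m1).
(* Since [rho > sg - r / 8] and [rho' >= rho - r / 8], the limit [rho' + r / 2] in [global_extend]
   exceeds [sg + r / 4], which leaves room for the radius [sg + r / 8]. *)
pose e := Num.min (r / 8) (sg / 2).
have e0 : 0 < e by rewrite lt_min !divr_gt0.
have er : e <= r / 8 by rewrite ge_min lexx.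
have es : e <= sg / 2 by rewrite ge_min lexx orbT.
have [rho [rho0 hrho] rhos] := sup_adherent e0 supE; rewrite -/sg in rhos.
have rhosg : rho <= sg by apply: sup_upper_bound.
pose rho' := Num.max 0 (rho - r / 8).
have rho'0 : 0 <= rho' by rewrite le_max lexx.
have rho'r : rho - r / 8 <= rho' by rewrite le_max lexx orbT.
have rho'rho : rho' < rho by rewrite gt_max rho0 /= ltrBlDr ltrDl divr_gt0.
have hloc w : bounded_by w rho' -> exists d, local_psum w d r.
  by move=> wr; apply: hr; apply: bounded_byW wr; lra.
have : E (sg + r / 8).
  split; first by rewrite addr_gt0 // divr_gt0.
  by apply: (global_extend rho'0 rho'rho r_gt0 hrho hloc); lra.
move=> /(sup_upper_bound supE); rewrite -/sg; lra.
Qed.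

Lemma taylor_exists : exists c, taylor_series f c.
Proof.
have [c hc] := global_psum_exists; exists c => z.
have [m [m0 m1 zm]] := max_norm (@polydisc_in z).
by apply/hsum_partial_sum; rewrite -[f z]/(f z) -{2}(to_polydisc_val z); apply: (hc m m0 m1).2.
Qed.

End GlobalTaylor.

(** * The Hardy space *)

Section Limits.
Variable R : realType.

Lemma real_cauchy (x : nat -> R) :
  (forall e : R, 0 < e -> exists N, forall m n, (N <= m)%N -> (N <= n)%N -> `|x m - x n| < e) ->
  exists l : R, x n @[n --> \oo] --> l.
Proof.
move=> h; suff : cvg (x n @[n --> \oo]) by exists (lim (x n @[n --> \oo])).
apply: cauchy_cvg; apply: cauchy_exP => e e0; have [N hN] := h e e0.
by exists (x N); exists N => // n /= Nn; apply: hN.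
Qed.

Lemma cvg_sumr (I : Type) (s : seq I) (F : I -> nat -> R) (l : I -> R) :
  (forall i, F i n @[n --> \oo] --> l i) ->
  \sum_(i <- s) F i n @[n --> \oo] --> \sum_(i <- s) l i.
Proof.
move=> h; elim: s => [|i s IHs].
  by under eq_fun do rewrite big_nil; rewrite big_nil; exact: cvg_cst.
by under eq_fun do rewrite big_cons; rewrite big_cons; apply: cvgD.
Qed.

Lemma cvg_epsP (x : nat -> R) l : x n @[n --> \oo] --> l ->
  forall e : R, 0 < e -> exists N, forall n, (N <= n)%N -> `|x n - l| < e.
Proof.
move=> /cvgrPdist_lt h e e0; have [N _ hN] := h e e0.
by exists N => n Nn; rewrite distrC; exact: hN.
Qed.

Lemma normc_distC3 (x y z : R[i]) : normc (y - z) = normc (x - y - (x - z)).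
Proof. by rewrite normc_distC; congr normc; ring. Qed.

Lemma complex_cauchy (x : nat -> R[i]) :
  (forall e : R, 0 < e -> exists N, forall m n, (N <= m)%N -> (N <= n)%N -> normc (x m - x n) < e) ->
  exists l, forall e : R, 0 < e -> exists N, forall n, (N <= n)%N -> normc (x n - l) < e.
Proof.
move=> h.
have [|a ha] := @real_cauchy (fun n => Re (x n)).
  move=> e /h[N hN]; exists N => m n Nm Nn; apply: le_lt_trans (hN _ _ Nm Nn).
  by rewrite -raddfB normc_Re.
have [|b hb] := @real_cauchy (fun n => Im (x n)).
  move=> e /h[N hN]; exists N => m n Nm Nn; apply: le_lt_trans (hN _ _ Nm Nn).
  by rewrite -raddfB normc_Im.
exists (a +i* b) => e e0; have e2 : 0 < e / 2 by rewrite divr_gt0.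
have [N hN] := cvg_epsP ha e2; have [N' hN'] := cvg_epsP hb e2.
exists (maxn N N') => n; rewrite geq_max => /andP[/hN h1 /hN' h2].
apply: le_lt_trans (normc_ReIm _) _; rewrite [e]splitr.
by case: (x n) h1 h2 => u v /= h1 h2; apply: ltrD.
Qed.

End Limits.

(* [taylor_coef] with values in [R[i]] rather than in [R[i]^o], so that
   arithmetic is elaborated in the field R[i]. *)
Definition tcoef (R : realType) (n : nat) (f : dfun R n) : multi_index n -> R[i] :=
  taylor_coef f.

Section Hardy.
Variables (R : realType) (n : nat).
Local Notation I := (multi_index n).
Local Notation H := (H2 R n).
Local Notation ip := (H2ip R n).
Local Notation tc := (@tcoef R n).
Local Notation hn := (hnorm ip).
Implicit Types (c d : I -> R[i]) (a b : I) (f g : dfun R n).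

Definition sqs c : Prop :=
  exists M : R, forall J : {fset I}, \sum_(a <- J) normc (c a) ^+ 2 <= M.

Lemma square_summableP c : square_summable c <-> sqs c.
Proof. by apply: esum_fin_absum => a; exact: sqr_ge0. Qed.

Lemma taylor_psum f c (z : polydisc R n) :
  taylor_series f c -> psum c (val z) (f z).
Proof. by move=> /(_ z)/hsum_partial_sum. Qed.

Lemma taylor_abs_conv f c (r : R) : 0 <= r -> r < 1 -> taylor_series f c -> abs_conv c r.
Proof.
move=> r0 r1 hc; have hr := bounded_in_polydisc r1 (bounded_by_const r0 : bounded_by (const_mx r%:C : 'rV_n) r).
have := @taylor_psum f c (to_polydisc (const_mx r%:C)) hc.
by rewrite val_to_polydisc //; exact: psum_abs_conv.
Qed.

Lemma taylor_uniq f c d : taylor_series f c -> taylor_series f d -> c = d.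
Proof.
move=> hc hd; have h2 : 0 < (1 / 2 : R) by [].
have h1 : 1 / 2 < (1 : R) by lra.
apply: (psum_uniq h2 (taylor_abs_conv (ltW h2) h1 hc) (taylor_abs_conv (ltW h2) h1 hd)) => z zr.
have hz := bounded_in_polydisc h1 zr.
exists (f (to_polydisc z)).
  by have := @taylor_psum f c (to_polydisc z) hc; rewrite val_to_polydisc.
by have := @taylor_psum f d (to_polydisc z) hd; rewrite val_to_polydisc.
Qed.

Lemma taylor_coefE f c : taylor_series f c -> tc f = c.
Proof.
move=> hc; rewrite /tcoef /taylor_coef; case: xgetP => [d _ hd|/(_ c)//].
exact: taylor_uniq hd hc.
Qed.

Lemma H2P f : H f -> taylor_series f (tc f) /\ sqs (tc f).
Proof. by move=> [c hc /square_summableP sc]; rewrite (taylor_coefE hc). Qed.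

Lemma H2I f c : taylor_series f c -> sqs c -> H f /\ tc f = c.
Proof.
by move=> hc sc; split; [exists c => //; exact/square_summableP | exact: taylor_coefE].
Qed.

Lemma taylor_inj f g c : taylor_series f c -> taylor_series g c -> f = g.
Proof.
move=> hf hg; apply/funext => z.
exact: (hsum_uniq (taylor_psum z hf) (taylor_psum z hg)).
Qed.

Lemma H2_inj f g : H f -> H g -> tc f = tc g -> f = g.
Proof. by move=> /H2P[hf _] /H2P[hg _] E; apply: taylor_inj hf _; rewrite E. Qed.

Lemma taylorL (k : R[i]) f g c d : taylor_series f c -> taylor_series g d ->
  taylor_series (k *: f + g) (fun a => k * c a + d a).
Proof.
move=> hf hg z; apply/hsum_partial_sum.
have := hsumD (hsumZ k (taylor_psum z hf)) (taylor_psum z hg).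
by congr (hsum _ _); apply/funext => a; rewrite mulrDl mulrA.
Qed.

Lemma absum_mul c d : sqs c -> sqs d -> absum (fun a => c a * d a).
Proof.
move=> [M hM] [N hN]; exists (M + N) => J; apply: le_trans (lerD (hM J) (hN J)).
by rewrite -big_split /=; apply: ler_sum => a _; rewrite normcM mulr_le_sqr.
Qed.

Lemma sqs_conj c : sqs c -> sqs (fun a => (c a)^*).
Proof. by move=> [M hM]; exists M => J; apply: le_trans (hM J); apply: ler_sum => a _; rewrite normc_conj. Qed.

Lemma sqsZ (k : R[i]) c : sqs c -> sqs (fun a => k * c a).
Proof.
move=> [M hM]; exists (normc k ^+ 2 * M) => J.
rewrite (eq_bigr (fun a => normc k ^+ 2 * normc (c a) ^+ 2)); last first.
  by move=> a _; rewrite normcM exprMn.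
by rewrite -mulr_sumr ler_wpM2l // sqr_ge0.
Qed.

Lemma sqsD c d : sqs c -> sqs d -> sqs (fun a => c a + d a).
Proof.
move=> [M hM] [N hN]; exists (2 * M + 2 * N) => J.
apply: (@le_trans _ _ (\sum_(a <- J) (2 * normc (c a) ^+ 2 + 2 * normc (d a) ^+ 2))).
  apply: ler_sum => a _; apply: (@le_trans _ _ ((normc (c a) + normc (d a)) ^+ 2)).
    by rewrite lerXn2r ?nnegrE ?addr_ge0 ?normc_ge0 // normcT.
  by have := sqr_ge0 (normc (c a) - normc (d a)); rewrite sqrrB sqrrD; lra.
by rewrite big_split /= -!mulr_sumr lerD // ler_wpM2l.
Qed.

Lemma sqs_le c d : (forall a, normc (c a) <= normc (d a)) -> sqs d -> sqs c.
Proof.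
move=> cd [M hM]; exists M => J; apply: le_trans (hM J); apply: ler_sum => a _.
by rewrite lerXn2r // nnegrE normc_ge0.
Qed.

(** At a point of the polydisc the squared moduli of the monomials are dominated by a geometric
    series in [m ^+ 2], so their products with a square summable [c] are summable. *)
Lemma taylor_of_sqs c : sqs c -> exists f, taylor_series f c.
Proof.
move=> sc; have /choice[f hf] (z : polydisc R n) : exists s, psum c (val z) s; last first.
  by exists f => z; apply/hsum_partial_sum; exact: hf.
apply: absum_hsum; apply: absum_mul => //.
have [m [m0 m1 zm]] := max_norm (polydisc_in z).
have [|B hB] := @absum_geom R n (m ^+ 2); first by rewrite sqr_ge0 /= expr_lt1.
exists B => J; apply: le_trans (hB J); apply: ler_sum => a _.
rewrite normcC ger0_norm ?exprn_ge0 ?sqr_ge0 // -exprM mulnC exprM.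
by rewrite lerXn2r ?nnegrE ?normc_ge0 ?exprn_ge0 // normc_monom_le.
Qed.

Definition of_coef c : dfun R n := xget (0 : dfun R n) [set f | taylor_series f c].

Lemma of_coefP c : sqs c -> taylor_series (of_coef c) c.
Proof.
move=> /taylor_of_sqs[f hf].
exact: (@xgetPex _ (0 : dfun R n) [set f | taylor_series f c] (ex_intro _ f hf)).
Qed.

Lemma H2_of_coef c : sqs c -> H (of_coef c) /\ tc (of_coef c) = c.
Proof. by move=> sc; apply: H2I => //; exact: of_coefP. Qed.

Lemma hsum_sum (I' : choiceType) (F : I' -> R[i]^o) (s : R[i]) :
  hsum F s -> summability.sum F = s.
Proof.
move=> /hsum_partial_sum h; rewrite /summability.sum.
have Ft : ProperFilter (@totally I') := totally_filter.
exact: cvg_lim.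
Qed.

Lemma ipP f g : H f -> H g -> hsum (fun a => tc f a * (tc g a)^*) (ip f g).
Proof.
move=> /H2P[_ sf] /H2P[_ sg].
have /absum_hsum[s hs] := absum_mul sf (sqs_conj sg).
by rewrite /H2ip (hsum_sum hs).
Qed.

Lemma ip_coef f g c d s : H f -> H g -> tc f = c -> tc g = d ->
  hsum (fun a => c a * (d a)^*) s -> ip f g = s.
Proof. by move=> Hf Hg <- <-; apply: hsum_uniq; exact: ipP. Qed.

Lemma H2L (k : R[i]) f g : H f -> H g ->
  H (k *: f + g) /\ tc (k *: f + g) = (fun a => k * tc f a + tc g a).
Proof.
move=> /H2P[hf sf] /H2P[hg sg]; apply: H2I; first exact: taylorL.
by apply: sqsD => //; exact: sqsZ.
Qed.

Lemma H20 : H 0 /\ tc 0 = (fun=> 0).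
Proof.
apply: H2I.
  move=> z; apply/hsum_partial_sum.
  by under eq_fun do rewrite mul0r; exact: hsum0.
by exists 0 => J; rewrite big1 // => a _; rewrite normc0 expr0n.
Qed.

Lemma ip_norm f : H f -> hsum (fun a => (normc (tc f a) ^+ 2)%:C) (hn f ^+ 2)%:C.
Proof.
move=> Hf; have := ipP Hf Hf; under eq_fun do rewrite mulJ_normc.
move=> h; have E := hsum_real h; rewrite E in h.
suff -> : hn f ^+ 2 = Re (ip f f) by [].
rewrite sqr_sqrtr //; apply: hsum_ge0 h => a; exact: sqr_ge0.
Qed.

Lemma hn_ge (f : dfun R n) (J : {fset I}) : H f ->
  \sum_(a <- J) normc (tc f a) ^+ 2 <= hn f ^+ 2.
Proof. by move=> Hf; apply: hsum_ge (ip_norm Hf) => a; exact: sqr_ge0. Qed.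

Lemma hn_le (f : dfun R n) (e : R) : H f -> 0 <= e ->
  (forall J : {fset I}, \sum_(a <- J) normc (tc f a) ^+ 2 <= e ^+ 2) -> hn f <= e.
Proof.
move=> Hf e0 h; have := hsum_le_real (ip_norm Hf) h.
by rewrite ler_pXn2r ?nnegrE // sqrtr_ge0.
Qed.

(** As for square summable sequences: the coefficients converge one by one, and the Cauchy bound,
    read on a finite set of indices, survives the limit in the second term. *)
Lemma H2_complete (u : nat -> dfun R n) : (forall m, H (u m)) ->
  (forall e : R, 0 < e -> exists N, forall m p, (N <= m)%N -> (N <= p)%N -> hn (u m - u p) < e) ->
  exists2 f, H f & forall e : R, 0 < e -> exists N, forall m, (N <= m)%N -> hn (u m - f) < e.
Proof.
move=> Hu hC.
have HB m p : H (u m - u p) /\ tc (u m - u p) = (fun a => tc (u m) a - tc (u p) a).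
  have := H2L (-1) (Hu p) (Hu m); rewrite scaleN1r addrC => -[h ->]; split => //.
  by apply/funext => a; rewrite mulN1r addrC.
have /choice[c hc] a : exists l, forall e : R, 0 < e -> exists N, forall m, (N <= m)%N ->
    normc (tc (u m) a - l) < e.
  apply: complex_cauchy => e /hC[N hN]; exists N => m p Nm Np.
  apply: le_lt_trans (hN _ _ Nm Np); have [Hmp E] := HB m p.
  have := hn_ge [fset a]%fset Hmp; rewrite big_seq_fset1 E.
  by rewrite ler_pXn2r ?nnegrE ?normc_ge0 // sqrtr_ge0.
have hlim e : 0 < e -> exists N, forall m, (N <= m)%N -> forall J : {fset I},
    \sum_(a <- J) normc (tc (u m) a - c a) ^+ 2 <= e ^+ 2.
  move=> e0; have [N hN] := hC e e0; exists N => m Nm J.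
  have hcv : \sum_(a <- J) normc (tc (u m) a - tc (u p) a) ^+ 2 @[p --> \oo] -->
      \sum_(a <- J) normc (tc (u m) a - c a) ^+ 2.
    apply: cvg_sumr => a; apply: sqr_cvg_normc => e' e'0.
    have [N' hN'] := hc a e' e'0; exists N' => p /hN'.
    by rewrite -normc_distC3.
  apply: (@cvgr_to_le _ _ _ _ _ _ _ hcv).
  exists N => // p /= Np; have [Hmp E] := HB m p.
  have := hn_ge J Hmp; rewrite E => /le_trans; apply.
  by rewrite lerXn2r // ?nnegrE ?sqrtr_ge0 ?(ltW e0) // ltW // hN.
have [N hN] := hlim 1 ltr01.
have sc : sqs c.
  have s1 : sqs (fun a => tc (u N) a - c a) by exists (1 ^+ 2) => J; exact: hN.
  have := sqsD (H2P (Hu N)).2 (sqsZ (-1) s1); apply: sqs_le => a.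
  by rewrite mulN1r opprB addrC subrK.
have [Hf fc] := H2_of_coef sc; exists (of_coef c) => // e e0.
have e2 : 0 < e / 2 by rewrite divr_gt0.
have [N' hN'] := hlim _ e2; exists N' => m Nm.
have [Hd Ed] : H (u m - of_coef c) /\ tc (u m - of_coef c) = (fun a => tc (u m) a - c a).
  have := H2L (-1) Hf (Hu m); rewrite scaleN1r addrC fc => -[h ->]; split => //.
  by apply/funext => a; rewrite mulN1r addrC.
apply: (@le_lt_trans _ _ (e / 2)); last by lra.
by apply: hn_le => //; [exact: ltW | move=> J; rewrite Ed; exact: hN'].
Qed.

Lemma H2_eq0 (f : dfun R n) : H f -> Re (ip f f) = 0 -> f = 0.
Proof.
move=> Hf f0; apply: (H2_inj Hf H20.1); rewrite H20.2; apply/funext => a.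
have := hn_ge [fset a]%fset Hf; rewrite big_seq_fset1 /hnorm f0 sqrtr0 expr0n.
move=> h; apply: eq0_normc; apply/eqP; rewrite -sqrf_eq0 eq_le h.
exact: sqr_ge0.
Qed.

Lemma H2_hilbert : hilbert ip H.
Proof.
split.
- by case: H20.
- by move=> c f g Hf Hg; case: (H2L c Hf Hg).
- move=> c f g h Hf Hg Hh; have [Hcf Ecf] := H2L c Hf Hg.
  apply: (ip_coef Hcf Hh Ecf erefl).
  have := hsumD (hsumZ c (ipP Hf Hh)) (ipP Hg Hh).
  by congr (hsum _ _); apply/funext => a; rewrite mulrDl mulrA.
- move=> f g Hf Hg; apply: (ip_coef Hg Hf erefl erefl).
  have := hsum_conj (ipP Hf Hg); congr (hsum _ _); apply/funext => a.
  by rewrite conjM conjCK mulrC.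
- move=> f Hf; have := ipP Hf Hf; under eq_fun do rewrite mulJ_normc.
  move=> h; have E := hsum_real h; rewrite E in h.
  by apply: hsum_ge0 h => a; exact: sqr_ge0.
- exact: H2_eq0.
- exact: H2_complete.
Qed.

End Hardy.

(** * Coordinate multiplications and backward shifts *)

Section Shifts.
Local Opaque of_coef tcoef H2ip.
Variables (R : realType) (n : nat).
Local Notation I := (multi_index n).
Local Notation H := (H2 R n).
Local Notation ip := (H2ip R n).
Local Notation tc := (@tcoef R n).
Local Notation hn := (hnorm ip).
Implicit Types (c d : I -> R[i]) (a b : I) (f g : dfun R n) (i j : 'I_n).

Definition unitm j : I := [ffun l => (l == j) : nat].
Definition upm j a : I := addm a (unitm j).
Definition fshift j c a : R[i] := if (0 < a j)%N then c (subm a (unitm j)) else 0.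
Definition bshift j c a : R[i] := c (upm j a).
(** For [f] in [H2] this is [f] minus its restriction to [z_j = 0], divided by [z_j]; through
    coefficients, the adjunction with [Mz j] is a mere reindexing. *)
Definition Bz j f : dfun R n := of_coef (bshift j (tc f)).

Lemma upmE j a l : upm j a l = (a l + (l == j))%N.
Proof. by rewrite !ffunE. Qed.

Lemma upmI j : injective (upm j).
Proof. exact: addmI. Qed.

Lemma upm_image j a : (exists b, a = upm j b) \/ a j = 0%N.
Proof.
have [a0|a0] := posnP (a j); [by right | left; exists (subm a (unitm j))].
by rewrite /upm submK // => l; rewrite ffunE; case: eqP => [->|].
Qed.

Lemma fshift_upm j c a : fshift j c (upm j a) = c a.
Proof. by rewrite /fshift upmE eqxx addn1 ltnS leq0n /upm addmK. Qed.

Lemma bshiftK j c : bshift j (fshift j c) = c.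
Proof. by apply/funext => a; exact: fshift_upm. Qed.

Lemma fshift0 j c a : a j = 0%N -> fshift j c a = 0.
Proof. by rewrite /fshift => ->. Qed.

Lemma fshift_bshiftC i j c : i != j -> fshift i (bshift j c) = bshift j (fshift i c).
Proof.
move=> ij; apply/funext => a; rewrite /fshift /bshift upmE (negbTE ij) addn0.
case: ifP => // ai; congr c; apply/ffunP => l; rewrite !ffunE.
by have [->|_] := eqVneq l j; rewrite 1?eq_sym ?(negbTE ij) ?subn0 // !addn0.
Qed.

Lemma monom_upm j a (z : 'rV[R[i]]_n) : monom (upm j a) z = z 0 j * monom a z.
Proof.
rewrite /monom (bigD1 j) //= [in RHS](bigD1 j) //= upmE eqxx addn1 exprS mulrA.
by congr (_ * _); apply: eq_bigr => l /negbTE lj; rewrite upmE lj addn0.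
Qed.

(** Reindexing along the injection [upm j], whose image misses exactly the indices with [a j = 0].
    It carries the Taylor series, the square sum and the inner product through the shift. *)
Lemma hsum_upm j (F : I -> R[i]) (G : I -> R[i]) s :
  (forall a, F (upm j a) = G a) -> (forall a, a j = 0%N -> F a = 0) ->
  hsum G s -> hsum F s.
Proof.
move=> FG F0 hs; apply: (hsum_inj (@upmI j)).
  by move=> a; have [|/F0] := upm_image j a; [left|right].
by move: hs; congr (hsum _ _); apply/funext => a; rewrite FG.
Qed.

Lemma sqs_absum c : sqs c <-> absum (fun a => c a * c a).
Proof.
by split=> -[M hM]; exists M => J; apply: le_trans (hM J); apply: ler_sum => a _;
  rewrite normcM expr2.
Qed.

Lemma sqs_fshift j c : sqs c -> sqs (fshift j c).
Proof.
move=> /sqs_absum/absum_hsum[s hs]; apply/sqs_absum.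
apply: hsum_absum; apply: (@hsum_upm j _ _ _ _ _ hs) => a; first by rewrite fshift_upm.
by move=> a0; rewrite fshift0 // mul0r.
Qed.

Lemma sqs_bshift j c : sqs c -> sqs (bshift j c).
Proof.
move=> /sqs_absum sc; apply/sqs_absum.
exact: (absum_comp (@upmI j) sc).
Qed.

Lemma taylor_Mz j f c : taylor_series f c -> taylor_series (Mz j f) (fshift j c).
Proof.
move=> hc z; apply/hsum_partial_sum.
apply: (@hsum_upm j _ (fun a => val z 0 j * (c a * monom a (val z)))) => [a|a a0|].
- by rewrite fshift_upm monom_upm mulrCA.
- by rewrite fshift0 // mul0r.
- apply: hsumZ; exact: taylor_psum.
Qed.

Lemma MzC i j f : Mz i (Mz j f) = Mz j (Mz i f).
Proof. by apply/funext => z; rewrite /Mz mulrCA. Qed.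

Lemma Mz_linear j (k : R[i]) f g : Mz j (k *: f + g) = k *: Mz j f + Mz j g.
Proof.
apply/funext => z; rewrite /Mz.
transitivity ((val z 0 j : R[i]) * (k * f z + g z)) => //.
by rewrite mulrDr mulrCA.
Qed.

Local Opaque Mz H2.

Lemma H2_Mz j f : H f -> H (Mz j f) /\ tc (Mz j f) = fshift j (tc f).
Proof.
move=> /H2P[hf sf]; apply: H2I; last exact: sqs_fshift.
exact: taylor_Mz.
Qed.

Lemma H2_Bz j f : H f -> H (Bz j f) /\ tc (Bz j f) = bshift j (tc f).
Proof. by move=> /H2P[hf sf]; apply: H2_of_coef; exact: sqs_bshift. Qed.

Lemma BzMz j f : H f -> Bz j (Mz j f) = f.
Proof.
move=> Hf; have [HM EM] := H2_Mz j Hf; have [HB EB] := H2_Bz j HM.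
by apply: (H2_inj HB Hf); rewrite EB EM bshiftK.
Qed.

Lemma MzBzC i j f : i != j -> H f -> Mz i (Bz j f) = Bz j (Mz i f).
Proof.
move=> ij Hf; have [HB EB] := H2_Bz j Hf; have [HM EM] := H2_Mz i Hf.
have [HMB EMB] := H2_Mz i HB; have [HBM EBM] := H2_Bz j HM.
by apply: (H2_inj HMB HBM); rewrite [LHS]EMB [RHS]EBM EB EM fshift_bshiftC.
Qed.

Lemma Mz_adj j f g : H f -> H g -> ip (Mz j f) g = ip f (Bz j g).
Proof.
move=> Hf Hg; have [HM EM] := H2_Mz j Hf; have [HB EB] := H2_Bz j Hg.
apply: (ip_coef HM Hg EM erefl).
apply: (@hsum_upm j _ _ _ _ _ (ipP Hf HB)) => a; first by rewrite fshift_upm EB.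
by move=> a0; rewrite fshift0 // mul0r.
Qed.

Lemma Mz_ip j f g : H f -> H g -> ip (Mz j f) (Mz j g) = ip f g.
Proof. by move=> Hf Hg; have [HM _] := H2_Mz j Hg; rewrite (Mz_adj j Hf HM) (BzMz j Hg). Qed.

Lemma Mz_isometry j f : H f -> hn (Mz j f) = hn f.
Proof. by move=> Hf; rewrite /hnorm Mz_ip. Qed.

Local Opaque hnorm.

Lemma Bz_linear j (k : R[i]) f g : H f -> H g -> Bz j (k *: f + g) = k *: Bz j f + Bz j g.
Proof.
move=> Hf Hg; have [HL EL] := H2L k Hf Hg; have [H1 E1] := H2_Bz j HL.
have [Hbf Ebf] := H2_Bz j Hf; have [Hbg Ebg] := H2_Bz j Hg.
have [H2' E2] := H2L k Hbf Hbg.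
apply: (H2_inj H1 H2').
exact (etrans (etrans E1 (congr1 (bshift j) EL))
  (esym (etrans E2 (f_equal2 (fun c d a => k * c a + d a) Ebf Ebg)))).
Qed.

(** With [B] for [Bz j]: [|B f|^2 = <Mz B f, f> <= |Mz B f| |f| = |B f| |f|], because [Mz j] is
    isometric. *)
Lemma Bz_contract j f : H f -> hn (Bz j f) <= hn f.
Proof.
move=> Hf; have [HB _] := H2_Bz j Hf; have [HM _] := H2_Mz j HB.
have hh := H2_hilbert R n; have [->|b0] := eqVneq (hn (Bz j f)) 0; first exact: sqrtr_ge0.
have bp : 0 < hn (Bz j f) by rewrite lt_neqAle eq_sym b0 sqrtr_ge0.
have E := hnorm_sqr hh HB; rewrite -(Mz_adj j HB Hf) in E.
have le : hn (Bz j f) ^+ 2 <= hn (Mz j (Bz j f)) * hn f.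
  rewrite E; apply: le_trans (cauchy_schwarz hh HM Hf).
  exact: le_trans (ler_norm _) (normc_Re _).
by rewrite (Mz_isometry j HB) expr2 (ler_pM2l bp) in le.
Qed.

Lemma Mz_pair j : contraction_pair ip H (Mz j) (Bz j).
Proof.
split; last by move=> f g; exact: Mz_adj.
- have le f : H f -> hn (Mz j f) <= hn f by move=> Hf; rewrite (Mz_isometry j Hf) lexx.
  split; last exact: le.
  split; first by move=> f Hf; exact: (H2_Mz j Hf).1.
  + by move=> k f g _ _; exact: Mz_linear.
  + by exists 1 => f Hf; rewrite mul1r; exact: le.
- split; last exact: Bz_contract.
  split; first by move=> f Hf; exact: (H2_Bz j Hf).1.
  + by move=> k f g; exact: Bz_linear.
  + by exists 1 => f Hf; rewrite mul1r; exact: Bz_contract.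
Qed.

Lemma adjoint_Mz j g : H g -> adjoint ip H (Mz j) g = Bz j g.
Proof.
move=> Hg; have [HB _] := H2_Bz j Hg.
apply: (adjoint_uniq (H2_hilbert R n) (subspaceT (H2_hilbert R n)) HB) => f Hf.
exact: Mz_adj.
Qed.

Lemma iter_Bz j m f : H f -> H (iter m (Bz j) f) /\
  tc (iter m (Bz j) f) = fun a => tc f (iter m (upm j) a).
Proof.
move=> Hf; elim: m => [|m [Hm Em]]; first by split.
have [HB EB] := H2_Bz j Hm; rewrite iterS; split; first exact: HB.
by rewrite EB Em; apply/funext => a; rewrite iterSr.
Qed.

Lemma iter_upmE j m a : iter m (upm j) a j = (a j + m)%N.
Proof. by elim: m => [|m IHm]; rewrite ?addn0 //= upmE eqxx IHm addn1 addnS. Qed.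

Lemma iter_upmI j m : injective (iter m (upm j)).
Proof. by elim: m => [|m IHm] a b //= /upmI/IHm. Qed.

(** The square sum of the coefficients has a small tail off a finite set [J0]. Once [m] exceeds
    every [j]-th entry in [J0], the [m]-fold shift sends all indices into that tail. *)
Lemma Bz_pure j f : H f -> forall e : R, 0 < e ->
  exists N, forall m, (N <= m)%N -> hn (iter m (Bz j) f) <= e.
Proof.
move=> Hf e e0; have [_ /sqs_absum sf] := H2P Hf.
have [|J0 hJ0] := absum_tail sf (e := e ^+ 2); first by rewrite exprn_gt0.
exists (\max_(a <- J0) a j).+1 => m hm; have [Hm Em] := iter_Bz j m Hf.
apply: hn_le => //; [exact: ltW | move=> J; rewrite Em].
apply: ltW; apply: le_lt_trans (hJ0 [fset iter m (upm j) a | a in J]%fset _).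
  rewrite (@big_imfset _ _ _ _ _ imfset_key (iter m (upm j)) (mem J)) /=; last first.
    by move=> x y _ _ /iter_upmI.
  by apply: ler_sum => a _; rewrite normcM expr2.
apply/fdisjointP => _ /imfsetP[a /= aJ ->]; apply/negP => hJ.
have h : (iter m (upm j) a j <= \max_(b <- J0) b j)%N.
  exact: (@leq_bigmax_seq _ _ xpredT (fun b : I => b j)).
by have := leq_ltn_trans h hm; rewrite iter_upmE ltnNge leq_addl.
Qed.

End Shifts.

(** * Multiplication by an inner function *)

Section HilbertIsometry.
Variables (R : realType) (V : lmodType R[i]) (ip : V -> V -> R[i]) (H : set V).
Hypothesis hH : hilbert ip H.
Local Notation hn := (hnorm ip).

Lemma hnorm_dist f g : H f -> H g -> `|hn f - hn g| <= hn (f - g).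
Proof.
move=> Hf Hg; have HB := subspaceB (subspaceT hH).
have h1 := hnormT hH Hg (HB _ _ Hf Hg); have h2 := hnormT hH Hf (HB _ _ Hg Hf).
rewrite addrC subrK in h1; rewrite addrC subrK (hnorm_distC hH Hg Hf) in h2.
by rewrite ler_distl lerBlDr h2 h1.
Qed.

(** Polarization: the norms of [f], [g] and [f + g] determine the real part of [ip f g], and
    replacing [f] by ['i *: f] gives the imaginary part. *)
Lemma isometry_ip (T : V -> V) : (forall f, H f -> H (T f)) ->
  (forall (k : R[i]) f g, H f -> H g -> T (k *: f + g) = k *: T f + T g) ->
  (forall f, H f -> hn (T f) = hn f) ->
  forall f g, H f -> H g -> ip (T f) (T g) = ip f g.
Proof.
move=> TH TL Tn.
have key f g : H f -> H g -> Re (ip (T f) (T g)) = Re (ip f g).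
  move=> Hf Hg; have HD := subspaceD (subspaceT hH).
  have TD : T (f + g) = T f + T g by have := TL 1 f g Hf Hg; rewrite !scale1r.
  have h1 := hnormD_sqr hH (TH _ Hf) (TH _ Hg); have h2 := hnormD_sqr hH Hf Hg.
  by rewrite -TD (Tn _ (HD _ _ Hf Hg)) (Tn _ Hf) (Tn _ Hg) h2 in h1; lra.
move=> f g Hf Hg; apply: ReIm_eq; first exact: key.
have HZ := subspaceZ 'i (subspaceT hH).
have TZ : T ('i *: f) = 'i *: T f.
  have := TL 'i f 0 Hf (hilbert0 hH); rewrite addr0 => ->.
  have T0 : hn (T 0) = 0 by rewrite (Tn _ (hilbert0 hH)) (hnorm0 hH).
  by rewrite (hnorm_eq0 hH (TH _ (hilbert0 hH)) T0) addr0.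
have := key _ _ (HZ _ Hf) Hg; rewrite TZ !(ipZl hH) //; try exact: TH.
have E (z : R[i]) : Re ('i * z) = - Im z by case: z => a b /=; ring.
by rewrite !E => /oppr_inj.
Qed.

End HilbertIsometry.

Section Multiplication.
Variables (R : realType) (n : nat).
Local Notation I := (multi_index n).
Local Notation H := (H2 R n).
Local Notation ip := (H2ip R n).
Local Notation tc := (@tcoef R n).
Local Notation hn := (hnorm ip).
Local Opaque tcoef of_coef Mz.
Implicit Types (c d : I -> R[i]) (a b p q : I) (f g : dfun R n).

(** The term of the Cauchy product with total index [a] and first index [p], set to 0 where
    [subm a p] would be truncated. This makes it a family over all pairs, to which [hsum_fubini]
    applies. *)
Definition conv_term c d a p : R[i] :=
  if [forall j, (p j <= a j)%N] then c p * d (subm a p) else 0.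

Lemma monomD p q (z : 'rV[R[i]]_n) : monom (addm p q) z = monom p z * monom q z.
Proof.
by rewrite /monom -big_split /=; apply: eq_bigr => j _; rewrite ffunE exprD.
Qed.

Lemma hsum_conv c d (z : 'rV[R[i]]_n) s t : psum c z s -> psum d z t ->
  hsum (fun x : I * I => conv_term c d x.1 x.2 * monom x.1 z) (s * t).
Proof.
move=> hs ht; have hM := hsumM hs ht.
apply: (@hsum_inj R _ _ (fun x : I * I => (addm x.2 x.1, x.1))).
- by move=> [p q] [p' q'] [h1 h2]; subst p'; rewrite (addmI h1).
- move=> [a p]; rewrite /conv_term /=; case: forallP => [pa|_]; last by right; rewrite mul0r.
  by left; exists (p, subm a p); rewrite /= submK.
- move: hM; congr (hsum _ _); apply/funext => -[p q]; rewrite /conv_term /=.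
  case: forallP => [_|[]]; last by move=> j; rewrite ffunE leq_addl.
  by rewrite addmK monomD mulrACA [monom q z * _]mulrC.
Qed.

Lemma taylorM f g c d : taylor_series f c -> taylor_series g d ->
  exists e, forall z : polydisc R n, psum e (val z) ((f z : R[i]) * g z).
Proof.
move=> hc hd; have h01 : 0 <= (1 / 2 : R) < 1 by apply/andP; split; lra.
have [h0 h1] := andP h01.
pose z0 : 'rV[R[i]]_n := const_mx (1 / 2 : R)%:C.
have bz0 : bounded_by z0 (1 / 2) by apply: bounded_by_const.
have [s hs] := abs_conv_psum (taylor_abs_conv h0 h1 hc) bz0.
have [t ht] := abs_conv_psum (taylor_abs_conv h0 h1 hd) bz0.
have hst := hsum_absum (hsum_conv hs ht).
have m0 a : monom a z0 != 0.
  by rewrite monom_const expf_neq0 // -[0]/(0%:C) (inj_eq (@complexI _)) gt_eqF.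
(* Each coefficient series is a row of the absolutely convergent double series at [(1/2, ..., 1/2)],
   divided by a nonzero monomial. *)
have /choice[e he] a : exists s, hsum (fun p => conv_term c d a p) s.
  have /absum_hsum[u hu] := absum_slice a hst.
  exists ((monom a z0)^-1 * u); have := hsumZ (monom a z0)^-1 hu.
  by congr (hsum _ _); apply/funext => p /=; rewrite mulrCA mulVf // mulr1.
exists e => z; have := hsum_conv (taylor_psum z hc) (taylor_psum z hd).
move=> /hsum_fubini; apply => a /=.
by rewrite mulrC; under eq_fun do rewrite mulrC; exact: hsumZ.
Qed.

Definition circle (r : R) (g : dfun R n) (t : ps_type (angles R n)) : R[i] :=
  g (to_polydisc (r%:C *: torus_pt t)).

Lemma torus_in_polydisc (r : R) (t : ps_type (angles R n)) : 0 <= r -> r < 1 ->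
  in_polydisc (r%:C *: torus_pt t).
Proof.
move=> r0 r1; apply: (bounded_in_polydisc r1).
by have := bounded_byZ r (bounded_by_torus t); rewrite ger0_norm // mulr1.
Qed.

Section Circle.
Variables (g : dfun R n) (c : I -> R[i]) (r : R).
Hypotheses (hg : taylor_series g c) (r0 : 0 <= r) (r1 : r < 1).

Let c' a := c a * (r ^+ deg a)%:C.

Lemma circle_hsum t : hsum (fun a => c' a * tmonom a t) (circle r g t).
Proof.
have := @taylor_psum R n g c (to_polydisc (r%:C *: torus_pt t)) hg.
rewrite val_to_polydisc; last exact: torus_in_polydisc.
congr (hsum _ _); apply/funext => a; by rewrite monom_torus mulrA.
Qed.

Lemma circle_bmeas : bmeas (fun t => normc (circle r g t) ^+ 2).
Proof.
have [B hB] := taylor_abs_conv r0 r1 hg.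
by apply: (@bmeas_series R n c' (circle r g) B hB); exact: circle_hsum.
Qed.

Lemma circle_parseval : hsum (fun a => (normc (c a) ^+ 2 * r ^+ (deg a * 2))%:C)
  (tmean (fun t => normc (circle r g t) ^+ 2))%:C.
Proof.
have [B hB] := taylor_abs_conv r0 r1 hg.
have := @parseval R n c' (circle r g) B hB circle_hsum.
congr (hsum _ _); apply/funext => a; rewrite /c' normcM normcC ger0_norm ?exprn_ge0 //.
by rewrite exprMn exprM.
Qed.

End Circle.

(** A fixed sequence of radii tending to 1, because [tmean_cvg] is stated for sequences. *)
Definition radius (m : nat) : R := 1 - m.+1%:R^-1.

Lemma radius_ge0 m : 0 <= radius m.
Proof. by rewrite /radius subr_ge0 invf_le1 // ler1n. Qed.

Lemma radius_lt1 m : radius m < 1.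
Proof. by rewrite /radius ltrBlDr ltrDl invr_gt0. Qed.

Lemma radius_cvg : radius m @[m --> \oo] --> (1 : R).
Proof.
rewrite -[X in _ --> X]subr0; apply: cvgB; first exact: cvg_cst.
exact: cvg_harmonic.
Qed.

Lemma radiusX_cvg (d : nat) : radius m ^+ d @[m --> \oo] --> (1 : R).
Proof.
elim: d => [|d IHd]; first by under eq_fun do rewrite expr0; exact: cvg_cst.
under eq_fun do rewrite exprS.
have : radius m * radius m ^+ d @[m --> \oo] --> (1 * 1 : R).
  by apply: cvgM; [exact: radius_cvg | exact: IHd].
by rewrite mulr1.
Qed.

Lemma radius_sum_cvg c (J : {fset I}) :
  \sum_(a <- J) (normc (c a) ^+ 2 * radius m ^+ (deg a * 2)) @[m --> \oo] -->
  \sum_(a <- J) normc (c a) ^+ 2.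
Proof.
apply: cvg_sumr => a; rewrite -[X in _ --> X]mulr1.
by apply: cvgM; [exact: cvg_cst | exact: radiusX_cvg].
Qed.

Lemma radius_le1X m (d : nat) : radius m ^+ d <= 1.
Proof. by rewrite exprn_ile1 ?radius_ge0 // ltW // radius_lt1. Qed.

Lemma circle_le f m : H f -> tmean (fun t => normc (circle (radius m) f t) ^+ 2) <= hn f ^+ 2.
Proof.
move=> Hf; have [hf sf] := H2P Hf.
apply: (hsum_le_real (circle_parseval hf (radius_ge0 m) (radius_lt1 m))) => J.
apply: le_trans (hn_ge J Hf); apply: ler_sum => a _.
by rewrite ler_piMr ?sqr_ge0 // radius_le1X.
Qed.

(** By [circle_le] the means never exceed the limit. Conversely, a finite set of coefficients
    carries the squared norm up to [e / 2], and its weights [radius m ^+ (deg a * 2)] tend to 1. *)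
Lemma circle_cvg f : H f ->
  tmean (fun t => normc (circle (radius m) f t) ^+ 2) @[m --> \oo] --> hn f ^+ 2.
Proof.
move=> Hf; have [hf sf] := H2P Hf; apply/cvgrPdist_lt => e e0.
have e2 : 0 < e / 2 by rewrite divr_gt0.
have [J hJ] := ip_norm Hf e2; have := hJ J (fsubset_refl J).
rewrite -rmorph_sum -rmorphB normcC => {}hJ.
have [N hN] := cvg_epsP (@radius_sum_cvg (tc f) J) e2.
exists N => // m /= /hN; set S := \sum_(a <- J) _ in hJ * => hS.
have h1 := circle_le m Hf.
have h2 := @hsum_ge R I _ _ J _ (circle_parseval hf (radius_ge0 m) (radius_lt1 m)).
have {}h2 := h2 (fun a => mulr_ge0 (sqr_ge0 _) (exprn_ge0 _ (radius_ge0 m))).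
move: h1 h2 hS; set L := tmean _; set S' := \sum_(a <- J) _ => h1 h2 hS.
rewrite ger0_norm ?subr_ge0 //.
move: hJ hS; rewrite !ltr_norml => /andP[hJ1 hJ2] /andP[hS1 hS2]; lra.
Qed.

Variables (Theta : dfun R n) (M : R) (cT : I -> R[i]).
Hypotheses (hT : taylor_series Theta cT) (TM : forall z, normc (Theta z) <= M).

Definition multT f : dfun R n := (fun z => Theta z * f z) : dfun R n.

Let M0 : 0 <= M. Proof. by apply: le_trans (TM (polydisc0 R n)); exact: normc_ge0. Qed.

Lemma circle_mult r f t : circle r (multT f) t = circle r Theta t * circle r f t.
Proof. reflexivity. Qed.

Lemma multT_taylor f c : taylor_series f c -> exists d, taylor_series (multT f) d.
Proof.
by move=> hc; have [e he] := taylorM hT hc; exists e => z; apply/hsum_partial_sum/he.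
Qed.

Lemma circle_mult_le m f : H f ->
  tmean (fun t => normc (circle (radius m) (multT f) t) ^+ 2) <= (M * hn f) ^+ 2.
Proof.
move=> Hf; have [hf _] := H2P Hf; have [d hd] := multT_taylor hf.
have bf := circle_bmeas hf (radius_ge0 m) (radius_lt1 m).
have bd := circle_bmeas hd (radius_ge0 m) (radius_lt1 m).
apply: (@le_trans _ _ (tmean (fun t => M ^+ 2 * normc (circle (radius m) f t) ^+ 2))).
  apply: tmean_le => //; first by apply: bmeasM => //; exact: bmeas_cst.
  move=> t; rewrite circle_mult normcM exprMn ler_wpM2r ?sqr_ge0 //.
  by rewrite lerXn2r ?nnegrE ?normc_ge0 //; exact: TM.
by rewrite tmeanZ // exprMn ler_wpM2l ?sqr_ge0 // circle_le.
Qed.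

(** Parseval on the circle of radius [r] bounds the finite sums of [|d a|^2 r^(2|a|)] by
    [(M * hn f) ^+ 2]; then [r] tends to 1. *)
Lemma multT_H2 f : H f -> H (multT f) /\ hn (multT f) <= M * hn f.
Proof.
move=> Hf; have [hf _] := H2P Hf; have [d hd] := multT_taylor hf.
have hJ (J : {fset I}) : \sum_(a <- J) normc (d a) ^+ 2 <= (M * hn f) ^+ 2.
  apply: (@cvgr_to_le _ _ _ _ _ _ _ (@radius_sum_cvg d J)).
  exists 0%N => // m _ /=; apply: le_trans (circle_mult_le m Hf).
  apply: hsum_ge (circle_parseval hd (radius_ge0 m) (radius_lt1 m)) => a.
  by rewrite mulr_ge0 ?sqr_ge0 // exprn_ge0 // radius_ge0.
have [HT ET] : H (multT f) /\ tc (multT f) = d.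
  by apply: H2I => //; exists ((M * hn f) ^+ 2).
split; first exact: HT.
apply: (hn_le HT); first by rewrite mulr_ge0 // sqrtr_ge0.
by move=> J; rewrite ET.
Qed.

Hypothesis Tinner : ae_torus (fun x => exists2 w, radial_limit Theta x w & normc w = 1).

Lemma normc_cvg (u : nat -> R[i]) (s : R[i]) :
  (forall e : R, 0 < e -> exists N, forall m, (N <= m)%N -> normc (u m - s) < e) ->
  normc (u m) @[m --> \oo] --> normc s.
Proof.
move=> h; apply/cvgrPdist_lt => e e0; have [N hN] := h e e0.
by exists N => // m /= /hN; apply: le_lt_trans; rewrite distrC normc_dist.
Qed.

Lemma sqr_ge0_inj (x y : R) : 0 <= x -> 0 <= y -> x ^+ 2 = y ^+ 2 -> x = y.
Proof. by move=> x0 y0 /eqP; rewrite eqrXn2 // => /eqP. Qed.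

Lemma cvg_sqr (u : nat -> R) (l : R) : u m @[m --> \oo] --> l ->
  u m ^+ 2 @[m --> \oo] --> l ^+ 2.
Proof. by move=> h; apply: cvgM. Qed.

Lemma radial_circle_cvg t (w : R[i]) : radial_limit Theta (torus_pt t) w ->
  normc (circle (radius m) Theta t) @[m --> \oo] --> normc w.
Proof.
move=> hw; apply: normc_cvg => e e0.
have e0' : 0 < e%:C :> R[i] by rewrite ltcR.
have h : \forall r \near (1 : R)^'-, `|w - Theta (to_polydisc (r%:C *: torus_pt t))| < e%:C.
  by move/cvgrPdist_lt : hw => /(_ _ e0').
have [N _ hN] := radius_cvg h; exists N => m Nm.
have /= := hN m Nm (radius_lt1 m).
by rewrite normrE ltcR normc_distC.
Qed.

Definition finsupp (J : {fset I}) c : I -> R[i] := fun a => if a \in J then c a else 0.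

Lemma sqs_finsupp J c : sqs (finsupp J c).
Proof.
exists (\sum_(a <- J) normc (c a) ^+ 2) => K.
apply: (@le_trans _ _ (\sum_(a <- (J `|` K)%fset) normc (finsupp J c a) ^+ 2)).
  by apply: le_sum_fset => [|a]; [exact: fsubsetUr | exact: sqr_ge0].
rewrite -(@big_fset_incl _ _ _ _ J) ?fsubsetUl //; last first.
  by move=> a _ /negbTE aJ; rewrite /finsupp aJ normc0 expr0n.
by rewrite big_seq [leRHS]big_seq; apply: ler_sum => a aJ; rewrite /finsupp aJ.
Qed.

(** A polynomial truncation, whose values on all circles have a common bound
    ([circle_poly_part_le]), as bounded convergence requires. *)
Definition poly_part J f : dfun R n := of_coef (finsupp J (tc f)).

Lemma poly_partP J f : H (poly_part J f) /\ tc (poly_part J f) = finsupp J (tc f).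
Proof. by apply: H2_of_coef; exact: sqs_finsupp. Qed.

Lemma hn_poly_part J f : hn (poly_part J f) ^+ 2 = \sum_(a <- J) normc (tc f a) ^+ 2.
Proof.
have [HP EP] := poly_partP J f; have := ip_norm HP; rewrite EP => h.
have h' := @hsum_fin _ _ (fun a => (normc (finsupp J (tc f) a) ^+ 2)%:C) J.
apply: complexI; rewrite -(hsum_uniq (h' _) h).
  rewrite -rmorph_sum /=; congr (_%:C); rewrite big_seq [RHS]big_seq.
  by apply: eq_bigr => a aJ; rewrite /finsupp aJ.
by move=> a /negbTE aJ; rewrite /finsupp aJ normc0 expr0n.
Qed.

Lemma circle_poly_part m J f t :
  circle (radius m) (poly_part J f) t =
  \sum_(a <- J) (tc f a * (radius m ^+ deg a)%:C) * tmonom a t.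
Proof.
have [HP EP] := poly_partP J f; have [hP _] := H2P HP.
apply: (hsum_uniq (circle_hsum hP (radius_ge0 m) (radius_lt1 m) t)).
rewrite EP; have := @hsum_fin _ _ (fun a => finsupp J (tc f) a * (radius m ^+ deg a)%:C * tmonom a t) J.
rewrite (eq_big_seq (fun a => tc f a * (radius m ^+ deg a)%:C * tmonom a t)).
  by apply => a /negbTE aJ; rewrite /finsupp aJ !mul0r.
by move=> a aJ; rewrite /finsupp aJ.
Qed.

Lemma circle_poly_part_le m J f t :
  normc (circle (radius m) (poly_part J f) t) <= \sum_(a <- J) normc (tc f a).
Proof.
rewrite circle_poly_part; apply: le_trans (normc_sum _ _ _) _.
apply: ler_sum => a _; rewrite !normcM normc_tmonom mulr1 normcC.
rewrite ger0_norm ?exprn_ge0 ?radius_ge0 //.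
by rewrite ler_piMr ?normc_ge0 // radius_le1X.
Qed.

Lemma normc_sum_dist (J : {fset I}) c d t :
  normc (\sum_(a <- J) c a * tmonom a t - \sum_(a <- J) d a * tmonom a t) <=
  \sum_(a <- J) normc (c a - d a).
Proof.
rewrite -sumrB; apply: le_trans (normc_sum _ _ _) _; apply: ler_sum => a _.
by rewrite -mulrBl normcM normc_tmonom mulr1.
Qed.

Lemma circle_poly_part_cvg J f t :
  normc (circle (radius m) (poly_part J f) t) @[m --> \oo] -->
  normc (\sum_(a <- J) tc f a * tmonom a t).
Proof.
apply: normc_cvg => e e0.
have hc : \sum_(a <- J) normc (tc f a) * (1 - radius m ^+ deg a) @[m --> \oo] -->
    \sum_(a <- J) normc (tc f a) * (1 - 1).
  apply: cvg_sumr => a; apply: cvgM; first exact: cvg_cst.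
  by apply: cvgB; [exact: cvg_cst | exact: radiusX_cvg].
have [N hN] := cvg_epsP hc e0; exists N => m /hN.
rewrite [X in _ - X]big1 ?subr0; last by move=> a _; rewrite subrr mulr0.
move=> hm; rewrite circle_poly_part; apply: le_lt_trans (normc_sum_dist _ _ _ _) _.
apply: le_lt_trans hm; apply: le_trans (ler_norm _); apply: ler_sum => a _.
rewrite -[X in _ - X]mulr1 -mulrBr normcM ler_wpM2l ?normc_ge0 //.
rewrite -[X in _ - X](rmorph1 (real_complex R)) -rmorphB normcC distrC ger0_norm //.
by rewrite subr_ge0 radius_le1X.
Qed.

(** For [p = poly_part J f], the circle means of [|Theta p|^2] have two limits: the squared norm of
    [multT p], by [circle_cvg], and, since [|Theta|] tends to 1 almost everywhere, the torus mean of
    [|p|^2], which is the squared norm of [p]. *)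
Lemma multT_poly_part J f : hn (multT (poly_part J f)) = hn (poly_part J f).
Proof.
have [HP EP] := poly_partP J f; have [hP _] := H2P HP.
have [HT _] := multT_H2 HP; have [hTP _] := H2P HT.
pose B := \sum_(a <- J) normc (tc f a).
have B0 : 0 <= B by apply: sumr_ge0 => a _; exact: normc_ge0.
pose F t := normc (\sum_(a <- J) tc f a * tmonom a t) ^+ 2 : R.
have h1 := circle_cvg HT.
have h2 : tmean (fun t => normc (circle (radius m) (multT (poly_part J f)) t) ^+ 2)
    @[m --> \oo] --> tmean F.
  apply: (@tmean_cvg _ _ _ _ ((M * B) ^+ 2)).
  - by move=> m; case: (circle_bmeas hTP (radius_ge0 m) (radius_lt1 m)).
  - by case: (bmeas_normc_sum J (tc f)).
  - move=> m t; rewrite ger0_norm ?sqr_ge0 // lerXn2r ?nnegrE ?normc_ge0 ?mulr_ge0 //.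
    rewrite circle_mult normcM ler_pM ?normc_ge0 //; first exact: TM.
    exact: circle_poly_part_le.
  - apply: (@filterS _ _ _ (fun t : ps_type (angles R n) =>
      exists2 w, radial_limit Theta (torus_pt t) w & normc w = 1)); last exact: Tinner.
    move=> t [w hw w1].
    rewrite /F -[normc (\sum_(a <- J) _)]mul1r -w1; apply: cvg_sqr.
    have -> : (fun m => normc (circle (radius m) (multT (poly_part J f)) t)) =
        (fun m => normc (circle (radius m) Theta t) * normc (circle (radius m) (poly_part J f) t)).
      by apply/funext => m; rewrite circle_mult normcM.
    by apply: cvgM; [exact: radial_circle_cvg | exact: circle_poly_part_cvg].
apply: sqr_ge0_inj; [exact: sqrtr_ge0 | exact: sqrtr_ge0 |].
have E : hn (multT (poly_part J f)) ^+ 2 = tmean F by exact: (cvg_unique _ h1 h2).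
exact: (etrans E (etrans (parseval_fin J (tc f)) (esym (hn_poly_part J f)))).
Qed.

Lemma multTE f z : multT f z = (Theta z : R[i]) * f z.
Proof. reflexivity. Qed.

Lemma lin_mulr (x k y z : R[i]) : x * (k * y + z) = k * (x * y) + x * z.
Proof. by rewrite mulrDr mulrCA. Qed.

Lemma dfun_linE (k : R[i]) f g z : (k *: f + g) z = (k * f z + g z : R[i]).
Proof. reflexivity. Qed.

Lemma multT_linear (k : R[i]) f g : multT (k *: f + g) = k *: multT f + multT g.
Proof.
apply/funext => z; apply: (etrans (multTE _ _)).
apply: (etrans (congr1 ( *%R (Theta z : R[i])) (dfun_linE k f g z))).
exact: (etrans (lin_mulr _ _ _ _) (esym (dfun_linE k (multT f) (multT g) z))).
Qed.

Lemma poly_part_dense f : H f -> forall e : R, 0 < e ->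
  exists J, hn (f - poly_part J f) <= e.
Proof.
move=> Hf e e0; have [_ /sqs_absum sf] := H2P Hf.
have [|J hJ] := absum_tail sf (e := e ^+ 2); first by rewrite exprn_gt0.
exists J; have [HP EP] := poly_partP J f.
have := H2L (-1) HP Hf; rewrite scaleN1r addrC => -[Hd Ed].
apply: (hn_le Hd); first exact: ltW.
move=> K; rewrite Ed EP; apply: ltW; apply: le_lt_trans (hJ (K `\` J)%fset _); last first.
  by apply/fdisjointP => a; rewrite inE => /andP[].
rewrite (big_fsetID _ (mem J)) /= [X in X + _]big1_fset ?add0r; last first.
  move=> a; rewrite !inE => /andP[_ aJ] _.
  by rewrite /finsupp aJ mulN1r addNr normc0 expr0n.
rewrite (_ : [fset x in K | x \notin J]%fset = (K `\` J)%fset); last first.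
  by apply/fsetP => a; rewrite !inE andbC.
rewrite big_seq [leRHS]big_seq; apply: ler_sum => a; rewrite inE => /andP[/negbTE aJ _].
by rewrite /finsupp aJ mulr0 add0r normcM expr2.
Qed.

Lemma dist_triangle (x y z u v e : R) :
  `|x - z| <= u -> `|y - z| <= v -> u + v <= e -> `|x - y| <= e.
Proof.
move=> h1 h2 h3; apply: le_trans h3; apply: le_trans (lerD h1 h2).
by rewrite (distrC y z); exact: ler_distD.
Qed.

Lemma multT_isometry f : H f -> hn (multT f) = hn f.
Proof.
move=> Hf; have hh := H2_hilbert R n.
have [HTf _] := multT_H2 Hf.
apply/eqP; rewrite -subr_eq0 -normr_eq0 eq_le normr_ge0 andbT.
apply/ler_addgt0Pr => e e0; rewrite add0r.
(* For a truncation [p], the norms of [multT f] and [f] differ by at most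
   [hn (multT (f - p)) + hn (f - p)], hence by at most [(M + 1) * hn (f - p)]. *)
have [|J hJ] := poly_part_dense Hf (e := e / (M + 1)); first by rewrite divr_gt0 // ltr_wpDl.
have [HP _] := poly_partP J f; have [HTP _] := multT_H2 HP.
set p := poly_part J f in hJ HP HTP.
have [Hd Ed] : H (f - p) /\ multT f - multT p = multT (f - p).
  have := H2L (-1) HP Hf; rewrite scaleN1r addrC => -[Hd _]; split; first exact: Hd.
  by have := multT_linear (-1) p f; rewrite !scaleN1r [- p + f]addrC => ->; rewrite addrC.
have [HTd le_d] := multT_H2 Hd.
have a1 := hnorm_dist hh HTf HTP; have Ep : hn (multT p) = hn p by exact: multT_poly_part.
rewrite Ed Ep in a1.
have a2 := hnorm_dist hh Hf HP.
have a3 : hn (multT (f - p)) + hn (f - p) <= e.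
  apply: (@le_trans _ _ ((M + 1) * hn (f - p))).
    by rewrite mulrDl mul1r; exact: (lerD le_d (lexx _)).
  by rewrite mulrC -ler_pdivlMr ?ltr_wpDl.
exact: dist_triangle a1 a2 a3.
Qed.

Lemma multT_ip f g : H f -> H g -> ip (multT f) (multT g) = ip f g.
Proof.
apply: (isometry_ip (H2_hilbert R n)); first by move=> h /multT_H2[].
  by move=> k h1 h2 _ _; exact: multT_linear.
exact: multT_isometry.
Qed.

End Multiplication.

(** * Elementary tensors *)

Section Tensor.
Variables (R : realType) (n k : nat) (hk : (k <= n)%N).
Local Notation J := 'I_(n - k).
Local Notation tc := (@tcoef R _).
Implicit Types (f : dfun R k) (g : J -> dfun R 1) (z : 'rV[R[i]]_n) (a : multi_index n).

Definition splitn (i : 'I_n) : 'I_k + J := fintype.split (cast_ord (esym (subnKC hk)) i).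

Lemma splitn_head j : splitn (head_ord hk j) = inl j.
Proof. by rewrite /splitn /head_ord cast_ordK; exact: (unsplitK (inl j)). Qed.

Lemma splitn_tail j : splitn (tail_ord hk j) = inr j.
Proof. by rewrite /splitn /tail_ord cast_ordK; exact: (unsplitK (inr j)). Qed.

Lemma splitnP (i : 'I_n) :
  (exists j, i = head_ord hk j) \/ (exists j, i = tail_ord hk j).
Proof.
have := splitK (cast_ord (esym (subnKC hk)) i).
case: fintype.split => j /= E; [left|right]; exists j;
  by rewrite /head_ord /tail_ord E cast_ordKV.
Qed.

Definition head_idx a : multi_index k := [ffun j => a (head_ord hk j)].
Definition tail_idx a : {ffun J -> multi_index 1} := [ffun j => [ffun=> a (tail_ord hk j)]].
Definition join_idx (x : multi_index k * {ffun J -> multi_index 1}) : multi_index n :=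
  [ffun i => match splitn i with inl j => x.1 j | inr j => x.2 j ord0 end].

Lemma join_idxK : cancel (fun a => (head_idx a, tail_idx a)) join_idx.
Proof.
move=> a; apply/ffunP => i; rewrite ffunE.
by have [[j ->]|[j ->]] := splitnP i; rewrite ?splitn_head ?splitn_tail !ffunE.
Qed.

Lemma idx_joinK : cancel join_idx (fun a => (head_idx a, tail_idx a)).
Proof.
move=> [x y]; congr (_, _); apply/ffunP => j; rewrite ffunE.
  by rewrite ffunE splitn_head.
by apply/ffunP => l; rewrite !ffunE splitn_tail (ord1 l).
Qed.

Lemma hsum_tensor (A : multi_index k -> R[i]) (B : J -> multi_index 1 -> R[i])
    (s : R[i]) (t : J -> R[i]) :
  hsum A s -> (forall j, hsum (B j) (t j)) ->
  hsum (fun a => A (head_idx a) * \prod_(j < n - k) B j (tail_idx a j)) (s * \prod_(j < n - k) t j).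
Proof.
move=> hA hB; have := hsumM hA (hsum_prod_ffun hB).
by move=> /(hsum_bij _ _ join_idxK idx_joinK).
Qed.

Lemma prod_splitn (T : comRingType) (F : 'I_n -> T) :
  \prod_(i < n) F i = (\prod_(j < k) F (head_ord hk j)) * \prod_(j < n - k) F (tail_ord hk j).
Proof.
rewrite (reindex (cast_ord (subnKC hk))) /=; last first.
  exists (cast_ord (esym (subnKC hk))) => i _; [exact: cast_ordK | exact: cast_ordKV].
by rewrite big_split_ord.
Qed.

Definition head_row z : 'rV[R[i]]_k := \row_j z 0 (head_ord hk j).
Definition tail_row j z : 'rV[R[i]]_1 := \row__ z 0 (tail_ord hk j).

Lemma monom_split a z :
  monom a z = monom (head_idx a) (head_row z) *
    \prod_(j < n - k) monom (tail_idx a j) (tail_row j z).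
Proof.
rewrite {1}/monom prod_splitn; congr (_ * _).
  by apply: eq_bigr => j _; rewrite ffunE mxE.
by apply: eq_bigr => j _; rewrite /monom big_ord1 !ffunE mxE.
Qed.

Lemma val_head_pt (z : polydisc R n) : val (head_pt hk z) = head_row (val z).
Proof. by apply: val_to_polydisc => j; rewrite mxE; exact: polydisc_in. Qed.

Lemma val_tail_pt j (z : polydisc R n) : val (tail_pt hk j z) = tail_row j (val z).
Proof. by apply: val_to_polydisc => l; rewrite mxE; exact: polydisc_in. Qed.

Definition tensor_coef (c : multi_index k -> R[i]) (d : J -> multi_index 1 -> R[i]) a : R[i] :=
  c (head_idx a) * \prod_(j < n - k) d j (tail_idx a j).

Lemma elem_tensorE f g (z : polydisc R n) :
  elem_tensor hk f g z = (f (head_pt hk z) : R[i]) * \prod_(j < n - k) (g j (tail_pt hk j z) : R[i]).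
Proof. reflexivity. Qed.

Lemma taylor_tensor f g c d : taylor_series f c -> (forall j, taylor_series (g j) (d j)) ->
  taylor_series (elem_tensor hk f g) (tensor_coef c d).
Proof.
move=> hc hd z; apply/hsum_partial_sum; rewrite elem_tensorE.
have := hsum_tensor (taylor_psum (head_pt hk z) hc)
  (fun j => taylor_psum (tail_pt hk j z) (hd j)).
congr (hsum _ _); apply/funext => a.
rewrite monom_split val_head_pt big_split /= mulrACA; congr (_ * (_ * _)).
by apply: eq_bigr => j _; rewrite val_tail_pt.
Qed.

Lemma sqs_tensor c d : sqs c -> (forall j, sqs (d j)) -> sqs (tensor_coef c d).
Proof.
move=> /sqs_absum/absum_hsum[s hs] hd; apply/sqs_absum.
have /choice[t ht] j : exists t, hsum (fun b => d j b * d j b) t.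
  by apply: absum_hsum; exact/sqs_absum.
have := hsum_absum (hsum_tensor hs ht); apply: absum_le => a.
by rewrite /tensor_coef big_split /= mulrACA.
Qed.

Lemma H2_tensor f g : H2 R k f -> (forall j, H2 R 1 (g j)) ->
  H2 R n (elem_tensor hk f g) /\
  tc (elem_tensor hk f g) = tensor_coef (tc f) (fun j => tc (g j)).
Proof.
move=> /H2P[hf sf] hg; apply: H2I.
  by apply: taylor_tensor => // j; exact: (H2P (hg j)).1.
by apply: sqs_tensor => // j; exact: (H2P (hg j)).2.
Qed.

Lemma ip_tensor f f' g g' : H2 R k f -> H2 R k f' ->
  (forall j, H2 R 1 (g j)) -> (forall j, H2 R 1 (g' j)) ->
  H2ip R n (elem_tensor hk f g) (elem_tensor hk f' g') =
  H2ip R k f f' * \prod_(j < n - k) H2ip R 1 (g j) (g' j).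
Proof.
move=> Hf Hf' Hg Hg'; have [HT ET] := H2_tensor Hf Hg; have [HT' ET'] := H2_tensor Hf' Hg'.
apply: (ip_coef HT HT' ET ET').
have := hsum_tensor (ipP Hf Hf') (fun j => ipP (Hg j) (Hg' j)).
congr (hsum _ _); apply/funext => a; rewrite /tensor_coef conjM mulrACA.
by congr (_ * _); rewrite [X in _ * X]rmorph_prod -big_split.
Qed.

Definition upd g j (h : dfun R 1) : J -> dfun R 1 := fun l => if l == j then h else g l.

Lemma upd_same g j h : upd g j h j = h.
Proof. by rewrite /upd eqxx. Qed.

Lemma upd_other g j l h : l != j -> upd g j h l = g l.
Proof. by rewrite /upd => /negbTE ->. Qed.

(** Operations on distinct slots commute; the statement has the form to which two successive [opV]
    or [opW] on tail slots unfold. *)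
Lemma updC (A B : J -> dfun R 1 -> dfun R 1) g j l : j != l ->
  upd (upd g l (B l (g l))) j (A j (upd g l (B l (g l)) j)) =
  upd (upd g j (A j (g j))) l (B l (upd g j (A j (g j)) l)).
Proof.
move=> jl; apply/funext => m; rewrite /upd (negbTE jl) (eq_sym l j) (negbTE jl).
by have [->|//] := eqVneq m j; rewrite (negbTE jl).
Qed.

Lemma Mz_tensor_head f g j :
  Mz (head_ord hk j) (elem_tensor hk f g) = elem_tensor hk (Mz j f) g.
Proof.
apply/funext => z; rewrite /Mz elem_tensorE.
transitivity ((val z 0 (head_ord hk j) * f (head_pt hk z) : R[i]) *
  \prod_(j < n - k) (g j (tail_pt hk j z) : R[i])); first exact: mulrA.
by rewrite [in RHS]elem_tensorE val_head_pt mxE.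
Qed.

Lemma Mz_tensor_tail f g j :
  Mz (tail_ord hk j) (elem_tensor hk f g) = elem_tensor hk f (upd g j (Mz ord0 (g j))).
Proof.
apply/funext => z; rewrite /Mz elem_tensorE.
rewrite [in RHS]elem_tensorE (bigD1 j) //= [in RHS](bigD1 j) //= upd_same val_tail_pt mxE.
rewrite [in RHS](eq_bigr (fun l => g l (tail_pt hk l z) : R[i])); last first.
  by move=> l lj; rewrite upd_other.
transitivity ((f (head_pt hk z) : R[i]) * (val z 0 (tail_ord hk j) * (g j (tail_pt hk j z) *
  \prod_(l < n - k | l != j) (g l (tail_pt hk l z) : R[i])))); last by congr (_ * _); exact: mulrA.
exact: mulrCA.
Qed.

End Tensor.

(** * Compressions to the submodule *)

Section Submodule.
Variables (R : realType) (n k : nat) (hk : (k <= n)%N).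
Variables (Theta : dfun R k) (Q : 'I_(n - k) -> set (dfun R 1)).
Local Notation J := 'I_(n - k).
Local Notation Hn := (H2 R n).
Local Notation Hk := (H2 R k).
Local Notation ip := (H2ip R n).
Local Notation ip1 := (H2ip R 1).
Local Notation mulT := (multT Theta).
Local Opaque tcoef of_coef Mz H2 H2ip hnorm multT elem_tensor.

Hypothesis T_H2 : forall f, Hk f -> Hk (mulT f).
Hypothesis T_ip : forall f g, Hk f -> Hk g -> H2ip R k (mulT f) (mulT g) = H2ip R k f g.
Hypothesis T_Mz : forall j f, Mz j (mulT f) = mulT (Mz j f).
Hypothesis Q_closed : forall j, closed_subspace ip1 (H2 R 1) (Q j).
Hypothesis Q_Bz : forall j g, Q j g -> Q j (Bz ord0 g).

Let hn := H2_hilbert R n.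

(** Operators are described on the data of an elementary tensor rather than on the tensor itself,
    which does not determine its factors. *)
Definition slots : Type := dfun R k * (J -> dfun R 1).
Implicit Types (p q : slots).

Definition valid p : Prop := Hk p.1 /\ forall j, Q j (p.2 j).
Definition tens p : dfun R n := elem_tensor hk (mulT p.1) p.2.
Definition gens : set (dfun R n) := [set h | exists2 p, valid p & h = tens p].

Variable S : set (dfun R n).
Hypothesis hS : S = hclosure ip Hn (lin_span gens).

Let QH j g : Q j g -> H2 R 1 g. Proof. by case: (Q_closed j) => + _ _ _; apply. Qed.

Lemma valid_H2 p : valid p -> Hk p.1 /\ forall j, H2 R 1 (p.2 j).
Proof. by move=> [h1 h2]; split; [exact: h1 | move=> j; exact: QH (h2 j)]. Qed.

Lemma tens_H2 p : valid p -> Hn (tens p).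
Proof. by move=> /valid_H2[h1 h2]; exact: (H2_tensor hk (T_H2 h1) h2).1. Qed.

Lemma gens_H2 : gens `<=` Hn.
Proof. by move=> _ [p hp ->]; exact: tens_H2. Qed.

Let cS : closed_subspace ip Hn S := span_closed hn gens_H2 hS.

Lemma tens_S p : valid p -> S (tens p).
Proof. by move=> hp; apply: (span_gen hn gens_H2 hS); exists p. Qed.

Lemma tens_ip p q : valid p -> valid q ->
  ip (tens p) (tens q) = H2ip R k p.1 q.1 * \prod_(j < n - k) ip1 (p.2 j) (q.2 j).
Proof.
move=> /valid_H2[p1 p2] /valid_H2[q1 q2].
by rewrite (ip_tensor hk (T_H2 p1) (T_H2 q1) p2 q2) (T_ip p1 q1).
Qed.

(** The generators span a dense part of [S], so testing against them is enough. They stand on the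
    left because [span_ip_ext] varies the first argument; conjugation swaps the sides. *)
Lemma orthoproj_gens x p : Hn x -> valid p ->
  (forall q, valid q -> ip (tens q) x = ip (tens q) (tens p)) -> orthoproj ip S x = tens p.
Proof.
move=> Hx hp E; have Hp := tens_H2 hp; have [SH _ _ _] := cS.
apply: (orthoproj_uniq hn cS Hx (tens_S hp)) => h Sh.
have EG : forall f, gens f -> ip f x = ip f (tens p) by move=> _ [q hq ->]; exact: E.
have Eh := span_ip_ext hn gens_H2 hS Hx Hp EG Sh.
exact: (etrans (ip_conj hn (SH _ Sh) Hx)
  (etrans (congr1 Num.conj Eh) (esym (ip_conj hn (SH _ Sh) Hp)))).
Qed.

Definition opV (i : 'I_n) p : slots :=
  match splitn hk i with
  | inl j => (Mz j p.1, p.2)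
  | inr j => (p.1, upd p.2 j (orthoproj ip1 (Q j) (Mz ord0 (p.2 j))))
  end.

(** On a head slot [Bz j] acts on the function before its multiplication by [Theta]: compressed to
    [S], the backward shift turns the factor [Theta f] into [Theta (Bz j f)]. *)
Definition opW (i : 'I_n) p : slots :=
  match splitn hk i with
  | inl j => (Bz j p.1, p.2)
  | inr j => (p.1, upd p.2 j (Bz ord0 (p.2 j)))
  end.

Lemma upd_valid p j g : valid p -> Q j g -> valid (p.1, upd p.2 j g).
Proof.
move=> [p1 p2] hg; split; first exact: p1.
move=> l /=; rewrite /upd; have [->|_] := eqVneq l j; [exact: hg | exact: p2].
Qed.

Let hn1 := H2_hilbert R 1.

Lemma Q_projP j g : Q j g -> Q j (orthoproj ip1 (Q j) (Mz ord0 g)) /\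
  forall h, Q j h -> ip1 h (orthoproj ip1 (Q j) (Mz ord0 g)) = ip1 h (Mz ord0 g).
Proof.
move=> hg; have HM := (H2_Mz ord0 (QH hg)).1.
have [h1 h2] := orthoprojP hn1 (Q_closed j) HM; split; first exact: h1.
move=> h hh; rewrite (ip_conj hn1 (QH h1) (QH hh)) (ip_conj hn1 HM (QH hh)).
by rewrite (h2 _ hh).
Qed.

Lemma opV_valid i p : valid p -> valid (opV i p).
Proof.
move=> hp; rewrite /opV; case: (splitn hk i) => j.
  by split; [exact: (H2_Mz j hp.1).1 | exact: hp.2].
by apply: upd_valid => //; exact: (Q_projP (hp.2 j)).1.
Qed.

Lemma opW_valid i p : valid p -> valid (opW i p).
Proof.
move=> hp; rewrite /opW; case: (splitn hk i) => j.
  by split; [exact: (H2_Bz j hp.1).1 | exact: hp.2].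
by apply: upd_valid => //; exact: Q_Bz (hp.2 j).
Qed.

Lemma Mz_tens_head j p : Mz (head_ord hk j) (tens p) = tens (Mz j p.1, p.2).
Proof. by rewrite /tens Mz_tensor_head T_Mz. Qed.

Lemma Mz_tens_tail j p :
  Mz (tail_ord hk j) (tens p) = elem_tensor hk (mulT p.1) (upd p.2 j (Mz ord0 (p.2 j))).
Proof. by rewrite /tens Mz_tensor_tail. Qed.

Lemma upd_H2 (g : J -> dfun R 1) j h : (forall l, H2 R 1 (g l)) -> H2 R 1 h ->
  forall l, H2 R 1 (upd g j h l).
Proof. by move=> hg hh l; rewrite /upd; case: (l == j); [exact: hh | exact: hg]. Qed.

(** Inner products of elementary tensors factor, and a single slot changes. On a head slot [Mz]
    commutes with [Theta]; on a tail slot, elements of [Q j] see [Mz g] only through its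
    projection. *)
Lemma compression_tens i p : valid p -> compression ip S (Mz i) (tens p) = tens (opV i p).
Proof.
move=> hp; have Hi := opV_valid i hp; rewrite /compression.
have HM := (H2_Mz i (tens_H2 hp)).1.
apply: (orthoproj_gens HM Hi) => q hq; rewrite /opV in Hi *.
have [[j E]|[j E]] := splitnP hk i; rewrite E.
  by rewrite splitn_head Mz_tens_head.
rewrite E in Hi; rewrite splitn_tail Mz_tens_tail in Hi *.
rewrite (tens_ip hq Hi) /=.
have [q1 q2] := valid_H2 hq; have [p1 p2] := valid_H2 hp.
rewrite /tens (ip_tensor hk (T_H2 q1) (T_H2 p1) q2 (upd_H2 j p2 (H2_Mz ord0 (p2 j)).1)) (T_ip q1 p1).
apply: (congr1 ( *%R (H2ip R k q.1 _))); apply: eq_bigr => l _; rewrite /upd.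
have [->|_] := eqVneq l j; last by reflexivity.
exact: (esym ((Q_projP (hp.2 j)).2 _ (hq.2 j))).
Qed.

(** The backward shift moves to the other argument as [Mz i], which acts on one slot of [tens q].
    The isometry of [multT Theta] then removes [Theta], and the adjunction within that slot brings
    the shift back. *)
Lemma cocompression_tens i p : valid p -> compression ip S (Bz i) (tens p) = tens (opW i p).
Proof.
move=> hp; have Hi := opW_valid i hp; rewrite /compression.
have HB := (H2_Bz i (tens_H2 hp)).1.
apply: (orthoproj_gens HB Hi) => q hq; rewrite -(Mz_adj i (tens_H2 hq) (tens_H2 hp)) /opW in Hi *.
have [q1 q2] := valid_H2 hq; have [p1 p2] := valid_H2 hp.
have [[j E]|[j E]] := splitnP hk i; rewrite E.
  rewrite E splitn_head in Hi; rewrite splitn_head Mz_tens_head (tens_ip hq Hi) /=.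
  have hMq : valid (Mz j q.1, q.2) by split; [exact: (H2_Mz j q1).1 | exact: hq.2].
  by rewrite (tens_ip hMq hp) /= (Mz_adj j q1 p1).
rewrite E splitn_tail in Hi; rewrite splitn_tail Mz_tens_tail (tens_ip hq Hi) /=.
rewrite /tens (ip_tensor hk (T_H2 q1) (T_H2 p1) (upd_H2 j q2 (H2_Mz ord0 (q2 j)).1) p2) (T_ip q1 p1).
apply: (congr1 ( *%R (H2ip R k q.1 _))); apply: eq_bigr => l _; rewrite /upd.
have [->|_] := eqVneq l j; last by reflexivity.
exact: (Mz_adj ord0 (q2 j) (p2 j)).
Qed.

Lemma opV_opV i i' p : i != i' -> opV i (opV i' p) = opV i' (opV i p).
Proof.
rewrite /opV; have [[j ->]|[j ->]] := splitnP hk i; have [[j' ->]|[j' ->]] := splitnP hk i' => ij;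
  rewrite ?splitn_head ?splitn_tail /=.
- by rewrite MzC.
- reflexivity.
- reflexivity.
- have jj : j != j' by apply: contraNneq ij => ->.
  pose P j g := orthoproj ip1 (Q j) (Mz ord0 g).
  exact: (congr1 (pair p.1) (updC P P p.2 jj)).
Qed.

Lemma opV_opW i i' p : i != i' -> valid p -> opV i (opW i' p) = opW i' (opV i p).
Proof.
rewrite /opV /opW; have [[j ->]|[j ->]] := splitnP hk i; have [[j' ->]|[j' ->]] := splitnP hk i' => ij hp;
  rewrite ?splitn_head ?splitn_tail /=.
- have jj : j != j' by apply: contraNneq ij => ->.
  by rewrite (MzBzC jj hp.1).
- reflexivity.
- reflexivity.
- have jj : j != j' by apply: contraNneq ij => ->.
  pose P j g := orthoproj ip1 (Q j) (Mz ord0 g).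
  exact: (congr1 (pair p.1) (updC P (fun=> Bz ord0) p.2 jj)).
Qed.

Let cV i := compression_contraction hn cS (Mz_pair R i).
Let cW i := compression_contraction hn cS (contraction_pairC hn (Mz_pair R i)).

(** By [adjoint_compression] the adjoints are compressions of the [Bz j], so both relations are
    commutators of contractions that vanish on the generators. *)
Lemma submodule_doubly_commuting :
  doubly_commuting ip S (fun j : 'I_n => compression ip S (Mz j)).
Proof.
split; first by move=> j; exact: (cV j).1.
move=> i j ij f Sf; split.
  apply: (commute_span hn gens_H2 hS (cV i) (cV j) _ Sf) => _ [p hp ->].
  rewrite (compression_tens j hp) (compression_tens i hp).
  rewrite (compression_tens i (opV_valid j hp)) (compression_tens j (opV_valid i hp)).
  by rewrite (opV_opV _ ij).
have [[iV _ _] _] := cV i.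
rewrite (adjoint_compression hn cS (Mz_pair R j) Sf).
rewrite (adjoint_compression hn cS (Mz_pair R j) (iV _ Sf)).
apply: (commute_span hn gens_H2 hS (cV i) (cW j) _ Sf) => _ [p hp ->].
rewrite (cocompression_tens j hp) (compression_tens i hp).
rewrite (compression_tens i (opW_valid j hp)) (cocompression_tens j (opV_valid i hp)).
by rewrite (opV_opW ij hp).
Qed.

End Submodule.

(** * Purity of the compressions *)

Section Purity.
Variables (R : realType) (n : nat) (S : set (dfun R n)) (j : 'I_n).
Local Notation Hn := (H2 R n).
Local Notation ip := (H2ip R n).
Local Opaque tcoef of_coef Mz H2 H2ip hnorm.
Hypothesis cS : closed_subspace ip Hn S.

Let hn := H2_hilbert R n.
Let V := compression ip S (Mz j).
Let W := compression ip S (Bz j).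
Let cW : is_contraction ip S W := compression_contraction hn cS (contraction_pairC hn (Mz_pair R j)).

Lemma iter_adjoint_compression m f : S f -> iter m (adjoint ip S V) f = iter m W f /\ S (iter m W f).
Proof.
move=> Sf; have [[iW _ _] _] := cW.
elim: m => [|m [E Sm]]; first by split; [reflexivity | exact: Sf].
rewrite !iterS E; split; last exact: iW.
exact: (adjoint_compression hn cS (Mz_pair R j) Sm).
Qed.

(** Powers of the adjoint are powers of [W], so the strong convergence of the powers of [Bz j] to 0
    carries over once they dominate; each kind of invariance of [S] supplies this domination. *)
Lemma compression_is_pure :
  (forall m f, S f -> hnorm ip (iter m W f) <= hnorm ip (iter m (Bz j) f)) -> is_pure ip S V.
Proof.
move=> le f Sf; have [SH _ _ _] := cS.
(* [Bz_pure] gives a weak inequality; taking half of [e] makes the final one strict. *)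
apply/cvgrPdist_lt => e e0; have e2 : 0 < e / 2 by rewrite divr_gt0.
have [N hN] := Bz_pure j (SH _ Sf) e2; exists N; first exact: I.
move=> m /= Nm; rewrite sub0r normrN (iter_adjoint_compression m Sf).1.
rewrite (ger0_norm (hnorm_ge0 _ _)).
apply: (le_lt_trans (le m f Sf)); apply: (le_lt_trans (hN m Nm)).
by rewrite ltr_pdivrMr // ltr_pMr // ltr1n.
Qed.

Lemma compression_pure_isometry : invariant_under S (Mz j) -> pure_isometry ip S V.
Proof.
move=> iS; have [SH _ _ _] := cS; have hV := compression_contraction hn cS (Mz_pair R j).
split; first split.
- exact: hV.1.
- move=> f Sf; rewrite /V (compression_invariant hn cS iS Sf).
  exact: (Mz_isometry j (SH _ Sf)).
- apply: compression_is_pure => m f Sf.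
  rewrite /W (iter_compression_coinvariant hn m cS (contraction_pairC hn (Mz_pair R j)) iS Sf).
  exact: (orthoproj_le hn cS (iter_Bz j m (SH _ Sf)).1).
Qed.

Lemma compression_pure_contraction : invariant_under S (Bz j) -> pure_contraction ip S V.
Proof.
move=> iS; split; first exact: (compression_contraction hn cS (Mz_pair R j)).
apply: compression_is_pure => m f Sf.
by rewrite /W (iter_compression_invariant hn m cS iS Sf).1.
Qed.

End Purity.

Lemma Mz_multT (R : realType) (k : nat) (Theta f : dfun R k) (j : 'I_k) :
  Mz j (multT Theta f) = multT Theta (Mz j f).
Proof. by apply/funext => z; exact: (mulrCA (val z 0 j) (Theta z : R[i]) (f z)). Qed.

Lemma factor_closed_coinvariant (R : realType) (Q : set (dfun R 1)) :
  jordan_block Q \/ Q = H2 R 1 ->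
  closed_subspace (H2ip R 1) (H2 R 1) Q /\ forall g, Q g -> Q (Bz ord0 g).
Proof.
case=> [[cQ _ iQ]|->].
  split=> // g Qg; have [QH _ _ _] := cQ.
  by rewrite -(adjoint_Mz ord0 (QH _ Qg)); exact: iQ.
split; first exact: closed_subspaceT (H2_hilbert R 1).
by move=> g Hg; exact: (H2_Bz ord0 Hg).1.
Qed.

Theorem theorem4p3 (R : realType) (n k : nat)
  (hn : (2 <= n)%N) (hk1 : (1 <= k)%N) (hkn : (k < n)%N)
  (Theta : dfun R k) (Q : 'I_(n - k) -> set (dfun R 1)) (S : set (dfun R n))
  (hTheta : inner_function Theta)
  (hQ : forall j, jordan_block (Q j) \/ Q j = H2 R 1)
  (hS : S = tensor_subspace (ltnW hkn) (mul_range Theta) Q)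
  (hSinv : forall j : 'I_n,
     ((j < k)%N -> invariant_under S (Mz j)) /\
     ((k <= j)%N -> invariant_under S (adjoint (H2ip R n) (H2 R n) (Mz j)))) :
  let V := fun j : 'I_n => compression (H2ip R n) S (Mz j) in
  doubly_commuting (H2ip R n) S V /\
  (forall j : 'I_n,
     ((j < k)%N -> pure_isometry (H2ip R n) S (V j)) /\
     ((k <= j)%N -> pure_contraction (H2ip R n) S (V j))).
Proof.
have [[hol [M TM]] rad] := hTheta.
have [cT hT] := taylor_exists hol TM.
have T_H2 f (Hf : H2 R k f) := (multT_H2 hT TM Hf).1.
have T_ip f g (Hf : H2 R k f) (Hg : H2 R k g) := multT_ip hT TM rad Hf Hg.
have Q_closed j := (factor_closed_coinvariant (hQ j)).1.
have Q_Bz j := (factor_closed_coinvariant (hQ j)).2.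
pose G := gens (ltnW hkn) Theta Q.
have hG : S = hclosure (H2ip R n) (H2 R n) (lin_span G).
  rewrite hS /tensor_subspace; congr (hclosure _ _ (lin_span _)).
  (* A first factor in [mul_range Theta] is [Theta F] for some [F] in [H2], and this [F] is the
     first slot; so both sets consist of the same elementary tensors. *)
  apply/seteqP; split=> h.
    move=> [_ [g [[F HF <-] Qg ->]]]; exists (F, g) => //.
  move=> [[F g] [HF Qg] ->]; exists (multT Theta F), g; split => //.
  by exists F.
have GH : G `<=` H2 R n := gens_H2 T_H2 Q_closed.
have cS := span_closed (H2_hilbert R n) GH hG.
have [SH _ _ _] := cS.
move=> V; split.
  exact (submodule_doubly_commuting T_H2 T_ip (fun j f => Mz_multT Theta f j) Q_closed Q_Bz hG).
move=> j; have [inv1 inv2] := hSinv j; split => jk.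
  exact: compression_pure_isometry cS (inv1 jk).
apply: (compression_pure_contraction cS) => f Sf.
(* On [H2] the chosen adjoint of [Mz j] is [Bz j], which turns the assumed invariance into
   invariance under the backward shift. *)
by rewrite -(adjoint_Mz j (SH _ Sf)); exact: inv2 jk _ Sf.
Qed.
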